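(* Let $S$ be any set and $F_S^{\mathbb{Q}}$ the free $\mathbb{Q}$-group on $S$. Then every non-identity element $g\in F_S^{\mathbb{Q}}$ satisfies $\operatorname{scl}_{F_S^{\mathbb{Q}}}(g)>0$.
   Context: A $\mathbb{Q}$-group is a group together with a map $G\times\mathbb{Q}\to G$, $(g,a)\mapsto g^a$, such that for all $g,h\in G$, $a,b\in\mathbb{Q}$: $g^0=e$, $g^1=g$, $e^a=e$; $g^{a+b}=g^ag^b$, $(g^a)^b=g^{ab}$; $(hgh^{-1})^a=hg^ah^{-1}$; and if $gh=hg$ then $(gh)^a=g^ah^a$. The free $\mathbb{Q}$-group $F_S^{\mathbb{Q}}$ is the $\mathbb{Q}$-completion of the free group $F_S$: a $\mathbb{Q}$-group with a homomorphism $F_S\to F_S^{\mathbb{Q}}$ through which every homomorphism from $F_S$ to a $\mathbb{Q}$-group factors uniquely via a homomorphism commuting with $\mathbb{Q}$-powers. For a group $G$ and $g\in[G,G]$, $\operatorname{cl}_G(g)$ is the minimal number of commutators with product $g$ and $\operatorname{scl}_G(g)=\lim_{n\to\infty}\operatorname{cl}_G(g^n)/n$. If $g^k\in[G,G]$ for some $k\ge1$, $\operatorname{scl}_G(g)=\operatorname{scl}_G(g^k)/k$; otherwise $\operatorname{scl}_G(g)=\infty$ (which counts as positive). *)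

(* Defs.v *)
From Stdlib Require Import Reals ClassicalEpsilon.
From Coquelicot Require Import Coquelicot.
From mathcomp Require Import ssreflect ssrfun ssrbool eqtype ssrnat ssralg rat.

Set Implicit Arguments.
Unset Strict Implicit.

Record Group := {
  gcar :> Type;
  gmul : gcar -> gcar -> gcar;
  ginv : gcar -> gcar;
  gone : gcar;
  gmulA : forall x y z, gmul x (gmul y z) = gmul (gmul x y) z;
  gmul1 : forall x, gmul gone x = x;
  gmulV : forall x, gmul (ginv x) x = gone
}.

Arguments gmul {g}.
Arguments ginv {g}.
Arguments gone {g}.

Definition is_group_hom (G H : Group) (f : G -> H) : Prop :=
  forall x y : G, f (gmul x y) = gmul (f x) (f y).

Record QGroup := {
  qgrp :> Group;
  qpow : qgrp -> rat -> qgrp;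
  qpow0 : forall g, qpow g 0%R = gone;
  qpow1 : forall g, qpow g 1%R = g;
  qpow_e : forall a, qpow gone a = gone;
  qpowD : forall g a b, qpow g (a + b)%R = gmul (qpow g a) (qpow g b);
  qpowM : forall g a b, qpow (qpow g a) b = qpow g (a * b)%R;
  qpowJ : forall g h a,
      qpow (gmul h (gmul g (ginv h))) a = gmul h (gmul (qpow g a) (ginv h));
  qpow_comm : forall g h a, gmul g h = gmul h g ->
      qpow (gmul g h) a = gmul (qpow g a) (qpow h a)
}.

Definition is_Qhom (G H : QGroup) (f : G -> H) : Prop :=
  is_group_hom f /\ forall (g : G) (a : rat), f (qpow g a) = qpow (f g) a.

Definition is_free_group (S : Type) (F : Group) (i : S -> F) : Prop :=
  forall (H : Group) (f : S -> H),
    exists phi : F -> H, is_group_hom phi /\ (forall s, phi (i s) = f s) /\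
      forall psi : F -> H, is_group_hom psi -> (forall s, psi (i s) = f s) ->
        forall x, psi x = phi x.

(* ---------- Q-completion (the free Q-group F_S^Q when F = F_S) ---------- *)
Definition is_Q_completion (F : Group) (G : QGroup) (j : F -> G) : Prop :=
  is_group_hom j /\
  forall (H : QGroup) (h : F -> H), is_group_hom h ->
    exists phi : G -> H, is_Qhom phi /\ (forall x, phi (j x) = h x) /\
      forall psi : G -> H, is_Qhom psi -> (forall x, psi (j x) = h x) ->
        forall y, psi y = phi y.

Definition commg (G : Group) (a b : G) : G :=
  gmul a (gmul b (gmul (ginv a) (ginv b))).

Fixpoint prod_comm (G : Group) (a b : nat -> G) (n : nat) : G :=
  match n with
  | 0 => gone
  | S m => gmul (prod_comm a b m) (commg (a m) (b m))
  end.

Definition is_prod_comm (G : Group) (n : nat) (g : G) : Prop :=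
  exists a b : nat -> G, g = prod_comm a b n.

(* g lies in [G,G] (products of commutators; the inverse of a commutator
   is a commutator) *)
Definition in_commutator_subgroup (G : Group) (g : G) : Prop :=
  exists n, is_prod_comm n g.

(* cl_G(g): minimal number of commutators with product g
   (junk value when g is not in [G,G]) *)
Definition cl (G : Group) (g : G) : nat :=
  epsilon (inhabits 0%nat)
    (fun n => is_prod_comm n g /\ forall m, is_prod_comm m g -> (n <= m)%coq_nat).

Fixpoint gpow (G : Group) (g : G) (n : nat) : G :=
  match n with
  | 0 => gone
  | S m => gmul (gpow g m) g
  end.

Definition scl_comm (G : Group) (g : G) : Rbar :=
  Lim_seq (fun n => Rdiv (INR (cl (gpow g n))) (INR n)).

Definition scl (G : Group) (g : G) : Rbar :=
  match excluded_middle_informative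
          (exists k, (1 <= k)%coq_nat /\ in_commutator_subgroup (gpow g k)) with
  | left ex =>
      let k := proj1_sig (constructive_indefinite_description _ ex) in
      Rbar_mult (Rinv (INR k)) (scl_comm (gpow g k))
  | right _ => p_infty
  end.

(* Main.v *)
(* A Q-group is the same thing as a group in which every element has a unique n-th root for all
   n >= 1, so the free Q-group is built from the free group by adjoining roots: at each step
   all maximal abelian subgroups C of H are embedded in copies of themselves by x |-> x^n, and
   one passes to the amalgamated product E of H with these copies. The class of torsion-free
   CSA groups is preserved, as one sees from the Bass-Serre tree, on which every nontrivial
   elliptic element fixes exactly one vertex of the second kind. An element g of E acting
   hyperbolically has positive scl by a Brooks counting quasimorphism on the tree: no element
   of E can reverse a long segment of the axis of g. For an elliptic g, g^n is conjugate into
   H. Finally, mapping E to a wreath product of H and averaging shows that a quasimorphism of H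
   extends to E without increasing its defect, so a lower bound obtained at one stage persists
   in the limit. The limit is a Q-group M with maps F_S^Q -> M -> F_S^Q whose composite is the
   identity. *)

Require Import Defs.
From Stdlib Require Import Reals ZArith Lia Lra List Permutation.
From Stdlib Require Import ClassicalEpsilon FunctionalExtensionality PropExtensionality ProofIrrelevance.
From Coquelicot Require Import Coquelicot.
From mathcomp Require ssreflect ssrfun ssrbool eqtype ssrnat ssralg ssrint ssrnum rat ring.

Set Implicit Arguments.
Unset Strict Implicit.

Local Open Scope nat_scope.

Infix "**" := gmul (at level 40, left associativity).

(** * Groups *)

(** Averaging meets an obstacle: a root extension amalgamates infinitely many groups, and in general
    no finite set of points of the wreath product is invariant under all of E. Commutator length
    asks for less: one product of c commutators has 4c factors, so for each finite list of right
    factors a function of defect at most D is enough, provided that D and the growth along powers of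
    g do not depend on the list. Such constants pass unchanged to the next stage, and an identity in
    the limit already holds at a finite stage. For an elliptic element only the exponent is
    multiplied by n.

    The CSA property makes the construction repeatable: each nontrivial element lies in exactly one
    maximal abelian subgroup, and this subgroup is malnormal. In the tree it becomes acylindricity:
    only the identity fixes a path of three edges. This yields in turn the CSA property of E and the
    absence of reversed segments.

    The orders of the adjoined roots run through 1, 2, 3, ..., so multiples of each n recur forever.
    A retract of M is good enough: it embeds in M, and homomorphisms do not increase commutator
    length. *)

Lemma gmulK (G : Group) (x y : G) : ginv x ** (x ** y) = y.
Proof. now rewrite gmulA, gmulV, gmul1. Qed.

Lemma gcancel_l (G : Group) (x y z : G) : x ** y = x ** z -> y = z.
Proof. intros E. rewrite <- (gmulK x y), E. apply gmulK. Qed.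

Lemma gmul1r (G : Group) (x : G) : x ** gone = x.
Proof. apply (@gcancel_l G (ginv x)). now rewrite gmulA, gmulV, gmul1. Qed.

Lemma gmulVr (G : Group) (x : G) : x ** ginv x = gone.
Proof. apply (@gcancel_l G (ginv x)). now rewrite gmulA, gmulV, gmul1, gmul1r. Qed.

Lemma gmulKV (G : Group) (x y : G) : x ** (ginv x ** y) = y.
Proof. now rewrite gmulA, gmulVr, gmul1. Qed.

Lemma ginv_unique (G : Group) (x y : G) : x ** y = gone -> y = ginv x.
Proof. intros E. apply (@gcancel_l G x). now rewrite E, gmulVr. Qed.

Lemma ginvM (G : Group) (x y : G) : ginv (x ** y) = ginv y ** ginv x.
Proof.
  symmetry. apply ginv_unique.
  now rewrite <- gmulA, (gmulA y), gmulVr, gmul1, gmulVr.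
Qed.

Lemma ginvK (G : Group) (x : G) : ginv (ginv x) = x.
Proof. symmetry. apply ginv_unique. apply gmulV. Qed.

Lemma ginv1 (G : Group) : ginv (@gone G) = gone.
Proof. symmetry. apply ginv_unique. apply gmul1. Qed.

Lemma gmulA_r (G : Group) (x y z : G) : x ** y ** z = x ** (y ** z).
Proof. symmetry. apply gmulA. Qed.

#[local] Hint Rewrite gmulA_r ginvM ginvK ginv1 gmul1 gmul1r gmulV gmulVr gmulK gmulKV : grp.
Ltac gsimp := autorewrite with grp.
Ltac gsimp_in H := autorewrite with grp in H.

Lemma gcancel_r (G : Group) (x y z : G) : y ** x = z ** x -> y = z.
Proof. intros E. apply (f_equal (fun t => t ** ginv x)) in E. now gsimp_in E. Qed.

Lemma eq_of_inv_mul (G : Group) (x y : G) : ginv x ** y = gone -> x = y.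
Proof. intros E. apply (@gcancel_l G (ginv x)). now rewrite E, gmulV. Qed.

Definition comm (G : Group) (x y : G) : Prop := x ** y = y ** x.
Definition gconj (G : Group) (h x : G) : G := h ** x ** ginv h.

Lemma conj_comm (G : Group) (h x y : G) : comm x y -> comm (gconj h x) (gconj h y).
Proof.
  unfold comm, gconj; intros E. gsimp.
  rewrite (gmulA x y), E. now gsimp.
Qed.

Lemma conj_eq1 (G : Group) (h x : G) : gconj h x = gone -> x = gone.
Proof.
  unfold gconj; intros E. apply (@gcancel_l G h). apply (@gcancel_r G (ginv h)).
  rewrite E. now gsimp.
Qed.

Lemma conj_fix_comm (G : Group) (h x : G) : gconj h x = x <-> comm h x.
Proof.
  unfold gconj, comm; split; intros E.
  - apply (@gcancel_r G (ginv h)). rewrite E. now gsimp.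
  - rewrite E. now gsimp.
Qed.

Lemma conjM (G : Group) (h x y : G) : gconj h (x ** y) = gconj h x ** gconj h y.
Proof. unfold gconj; now gsimp. Qed.

Lemma conjK (G : Group) (h x : G) : gconj (ginv h) (gconj h x) = x.
Proof. unfold gconj; now gsimp. Qed.

Lemma conj_conj (G : Group) (h k x : G) : gconj h (gconj k x) = gconj (h ** k) x.
Proof. unfold gconj; now gsimp. Qed.

Lemma comm_sym (G : Group) (x y : G) : comm x y -> comm y x.
Proof. unfold comm; congruence. Qed.

Lemma commM (G : Group) (x y z : G) : comm x y -> comm x z -> comm x (y ** z).
Proof.
  unfold comm; intros E1 E2. now rewrite gmulA, E1, gmulA_r, E2, gmulA.
Qed.

Lemma comm1 (G : Group) (x : G) : comm x gone.
Proof. unfold comm; now gsimp. Qed.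

Lemma commV (G : Group) (x y : G) : comm x y -> comm x (ginv y).
Proof.
  unfold comm; intros E. apply (@gcancel_l G y). apply (@gcancel_r G y).
  gsimp. now rewrite E.
Qed.

Lemma gpowS (G : Group) (x : G) n : gpow x (S n) = gpow x n ** x.
Proof. reflexivity. Qed.

Lemma comm_gpow (G : Group) (x y : G) n : comm x y -> comm x (gpow y n).
Proof.
  intros E. induction n as [|n IH]; [apply comm1|]. rewrite gpowS. now apply commM.
Qed.

Lemma comm_refl (G : Group) (x : G) : comm x x.
Proof. reflexivity. Qed.

Lemma gpowSl (G : Group) (x : G) n : gpow x (S n) = x ** gpow x n.
Proof. rewrite gpowS. symmetry. apply comm_gpow, comm_refl. Qed.

Lemma gpow1 (G : Group) (x : G) : gpow x 1 = x.
Proof. apply gmul1. Qed.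

Lemma gpowD (G : Group) (x : G) m n : gpow x (m + n) = gpow x m ** gpow x n.
Proof.
  induction n as [|n IH]; [now rewrite Nat.add_0_r; cbn; gsimp|].
  now rewrite Nat.add_succ_r, !gpowS, IH, gmulA.
Qed.

Lemma gpowM (G : Group) (x : G) m n : gpow x (m * n) = gpow (gpow x m) n.
Proof.
  induction n as [|n IH]; [now rewrite Nat.mul_0_r|].
  now rewrite Nat.mul_succ_r, gpowD, IH.
Qed.

Lemma gpow_one (G : Group) n : gpow (@gone G) n = gone.
Proof. induction n as [|n IH]; [reflexivity|]. now rewrite gpowS, IH, gmul1. Qed.

Lemma gpow_mul (G : Group) (x y : G) n :
  comm x y -> gpow (x ** y) n = gpow x n ** gpow y n.
Proof.
  intros E. induction n as [|n IH]; [cbn; now gsimp|].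
  rewrite !gpowS, IH, !gmulA_r. f_equal. rewrite !gmulA. f_equal.
  symmetry. now apply comm_gpow.
Qed.

Lemma gpow_inv (G : Group) (x : G) n : gpow (ginv x) n = ginv (gpow x n).
Proof.
  induction n as [|n IH]; [cbn; now gsimp|].
  now rewrite gpowS, IH, gpowSl, ginvM.
Qed.

Lemma gpow_conj (G : Group) (h x : G) n : gpow (gconj h x) n = gconj h (gpow x n).
Proof.
  induction n as [|n IH]; [unfold gconj; cbn; now gsimp|].
  now rewrite !gpowS, IH, conjM.
Qed.

Section Hom.
Context (G H : Group) (f : G -> H) (Hf : is_group_hom f).

Lemma hom1 : f gone = gone.
Proof.
  apply (@gcancel_l H (f gone)). now rewrite <- Hf, gmul1, gmul1r.
Qed.

Lemma homV x : f (ginv x) = ginv (f x).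
Proof. apply ginv_unique. now rewrite <- Hf, gmulVr, hom1. Qed.

Lemma hom_gpow x n : f (gpow x n) = gpow (f x) n.
Proof.
  induction n as [|n IH]; [apply hom1|]. now rewrite !gpowS, Hf, IH.
Qed.

Lemma hom_conj h x : f (gconj h x) = gconj (f h) (f x).
Proof. unfold gconj. now rewrite !Hf, homV. Qed.

Lemma hom_comm x y : comm x y -> comm (f x) (f y).
Proof. unfold comm; intros E. now rewrite <- !Hf, E. Qed.

Lemma hom_injective : (forall x, f x = gone -> x = gone) -> forall x y, f x = f y -> x = y.
Proof.
  intros K x y E. apply eq_of_inv_mul, K. now rewrite Hf, homV, E, gmulV.
Qed.
End Hom.

Definition gzpow (G : Group) (x : G) (k : Z) : G :=
  match k with
  | Z0 => gone
  | Zpos p => gpow x (Pos.to_nat p)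
  | Zneg p => ginv (gpow x (Pos.to_nat p))
  end.

Lemma gzpow_nat (G : Group) (x : G) n : gzpow x (Z.of_nat n) = gpow x n.
Proof. destruct n; cbn [Z.of_nat gzpow]; [reflexivity|]. now rewrite SuccNat2Pos.id_succ. Qed.

Lemma gzpow_opp_nat (G : Group) (x : G) n : gzpow x (- Z.of_nat n) = ginv (gpow x n).
Proof.
  destruct n; cbn [Z.of_nat Z.opp gzpow]; [cbn; now gsimp|].
  now rewrite SuccNat2Pos.id_succ.
Qed.

Lemma gzpow_succ (G : Group) (x : G) k : gzpow x (k + 1) = x ** gzpow x k.
Proof.
  destruct (Z_lt_le_dec k 0) as [L|L].
  - replace k with (- Z.of_nat (S (Z.to_nat (- k - 1))))%Z by lia.
    set (m := Z.to_nat (- k - 1)).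
    replace (- Z.of_nat (S m) + 1)%Z with (- Z.of_nat m)%Z by lia.
    rewrite !gzpow_opp_nat, gpowS. now gsimp.
  - replace k with (Z.of_nat (Z.to_nat k)) by lia. set (m := Z.to_nat k).
    replace (Z.of_nat m + 1)%Z with (Z.of_nat (S m)) by lia.
    now rewrite !gzpow_nat, gpowSl.
Qed.

Lemma gzpow_add (G : Group) (x : G) k m : gzpow x (k + m) = gzpow x k ** gzpow x m.
Proof.
  assert (S : forall k, gzpow x (k - 1) = ginv x ** gzpow x k).
  { intros k'. replace k' with (k' - 1 + 1)%Z at 2 by lia. rewrite gzpow_succ. now gsimp. }
  induction k as [|k IH|k IH] using Z.peano_ind.
  - cbn. now gsimp.
  - replace (Z.succ k + m)%Z with (k + m + 1)%Z by lia.
    replace (Z.succ k) with (k + 1)%Z by lia. now rewrite !gzpow_succ, IH, gmulA.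
  - replace (Z.pred k + m)%Z with (k + m - 1)%Z by lia.
    replace (Z.pred k) with (k - 1)%Z by lia. now rewrite !S, IH, gmulA.
Qed.

Lemma hom_gzpow (G H : Group) (f : G -> H) x z : is_group_hom f -> f (gzpow x z) = gzpow (f x) z.
Proof.
  intros F. destruct z; cbn; [apply (hom1 F)|apply (hom_gpow F)|].
  now rewrite (homV F), (hom_gpow F).
Qed.

Lemma gzpow_conj (G : Group) (h x : G) z : gzpow (gconj h x) z = gconj h (gzpow x z).
Proof.
  symmetry. apply (@hom_gzpow G G (gconj h)). intros a b. apply conjM.
Qed.

Lemma comm_gzpow (G : Group) (x y : G) z : comm x y -> comm x (gzpow y z).
Proof.
  intros C. destruct z; cbn; [apply comm1|now apply comm_gpow|now apply commV, comm_gpow].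
Qed.

Lemma gzpow_mul_comm (G : Group) (x y : G) z : comm x y -> gzpow (x ** y) z = gzpow x z ** gzpow y z.
Proof.
  intros C. destruct z; cbn; [now gsimp|now apply gpow_mul|].
  rewrite gpow_mul, <- ginvM by trivial. f_equal.
  apply comm_gpow, comm_sym, comm_gpow, comm_sym, C.
Qed.

Lemma gzpow_mult (G : Group) (x : G) z z' : gzpow (gzpow x z) z' = gzpow x (z * z').
Proof.
  induction z' as [|z' IH|z' IH] using Z.peano_ind.
  - now rewrite Z.mul_0_r.
  - rewrite Z.mul_succ_r, gzpow_add, <- IH, <- Z.add_1_r, gzpow_add.
    f_equal. apply gpow1.
  - rewrite Z.mul_pred_r. apply (@gcancel_r G (gzpow x z)).
    transitivity (gzpow (gzpow x z) (Z.pred z' + 1)).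
    + rewrite gzpow_add. f_equal. symmetry. apply gpow1.
    + replace (Z.pred z' + 1)%Z with z' by lia. rewrite IH, <- gzpow_add. f_equal. lia.
Qed.

(** * Torsion-free CSA groups *)

Definition torsion_free (G : Group) : Prop :=
  forall (x : G) n, 1 <= n -> gpow x n = gone -> x = gone.

(* The CSA property: the centralizers of nontrivial elements are abelian and malnormal. *)
Definition csa (G : Group) : Prop :=
  forall x y h : G, x <> gone -> y <> gone ->
    comm x y -> comm x (gconj h y) -> comm x h.

(** Conjugation by [z] fixes [x], so the CSA property applies to [y] and [x] with conjugator [z]. *)
Lemma csa_trans (G : Group) (x y z : G) :
  csa G -> x <> gone -> y <> gone -> comm x y -> comm x z -> comm y z.
Proof.
  intros HG Hx Hy E1 E2. apply (HG y x z); trivial.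
  - now apply comm_sym.
  - replace (gconj z x) with x; [now apply comm_sym|].
    symmetry. apply conj_fix_comm. now apply comm_sym.
Qed.

(** Both roots commute with their common power, hence with each other by [csa_trans]; their quotient
    is then torsion. *)
Lemma csa_root_unique (G : Group) (x y : G) n :
  csa G -> torsion_free G -> 1 <= n -> gpow x n = gpow y n -> x = y.
Proof.
  intros HC HT Hn E.
  destruct (excluded_middle_informative (gpow x n = gone)) as [E1|N].
  - rewrite (HT x n Hn E1). symmetry. apply (HT y n Hn). congruence.
  - assert (C : comm x y).
    { apply (@csa_trans G (gpow x n)); trivial.
      - intros ->. apply N, gpow_one.
      - apply comm_sym, comm_gpow, comm_refl.
      - rewrite E. apply comm_sym, comm_gpow, comm_refl. }
    symmetry. apply eq_of_inv_mul. apply (HT _ n Hn).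
    rewrite gpow_mul, gpow_inv, E; [apply gmulV|].
    apply comm_sym, commV, C.
Qed.

(** * Reduced paths and group actions on trees *)

Lemma exists_min (A : Type) (f : A -> nat) (a0 : A) :
  exists a, forall b, f a <= f b.
Proof.
  remember (f a0) as n eqn:En. revert a0 En.
  induction n as [n IH] using lt_wf_ind. intros a0 ->.
  destruct (classic (exists b, f b < f a0)) as [[b L]|N].
  - exact (IH (f b) L b eq_refl).
  - exists a0. intros b. destruct (le_lt_dec (f a0) (f b)); [easy|].
    exfalso; apply N; now exists b.
Qed.

(** Only backtracking is excluded; in a tree this already makes the path shortest. Values of [p]
    beyond [n] are arbitrary. *)
Definition geod (V : Type) (adj : V -> V -> Prop) (p : nat -> V) (n : nat) : Prop :=
  (forall k, k < n -> adj (p k) (p (S k))) /\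
  (forall k, S k < n -> p k <> p (S (S k))).

(* [isB] is one of the two classes of a bipartite tree; the last four fields force a nontrivial
   elliptic element to fix exactly one vertex of that class, whose stabilizer is abelian and
   torsion-free. *)
Record tree_action (E : Group) := {
  vert :> Type;
  adj : vert -> vert -> Prop;
  isB : vert -> Prop;
  act : E -> vert -> vert;
  base : vert;
  adj_sym : forall v w, adj v w -> adj w v;
  adj_isB : forall v w, adj v w -> (isB v <-> ~ isB w);
  no_closed : forall p n, geod adj p n -> p 0 = p n -> n = 0;
  geod_exists : forall v w, exists p n, geod adj p n /\ p 0 = v /\ p n = w;
  act_one : forall v, act gone v = v;
  act_mul : forall x y v, act (x ** y) v = act x (act y v);
  act_adj : forall x v w, adj v w -> adj (act x v) (act x w);
  act_isB : forall x v, isB (act x v) <-> isB v;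
  fixB : forall x v, x <> gone -> act x v = v -> exists w, isB w /\ act x w = w;
  fixB_local : forall x v u w, x <> gone -> isB v -> adj v u -> adj u w ->
    act x v = v -> act x u = u -> act x w = w -> v = w;
  stabB_comm : forall x y v, isB v -> act x v = v -> act y v = v -> comm x y;
  stabB_torsion_free : forall x v n, isB v -> act x v = v -> 1 <= n ->
    gpow x n = gone -> x = gone
}.

Definition pcat (V : Type) (p : nat -> V) (n : nat) (q : nat -> V) : nat -> V :=
  fun k => if k <=? n then p k else q (k - n).
Definition prev (V : Type) (p : nat -> V) (n : nat) : nat -> V := fun k => p (n - k).

Lemma pcat_l (V : Type) (p q : nat -> V) n k : k <= n -> pcat p n q k = p k.
Proof. intros L. unfold pcat. now rewrite (proj2 (Nat.leb_le k n) L). Qed.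

Lemma pcat_r (V : Type) (p q : nat -> V) n k :
  p n = q 0 -> n <= k -> pcat p n q k = q (k - n).
Proof.
  intros E L. unfold pcat. destruct (Nat.leb_spec k n); [|easy].
  replace k with n by lia. now rewrite Nat.sub_diag.
Qed.

Fixpoint zsum (f : nat -> Z) (n : nat) : Z :=
  match n with 0 => 0%Z | S m => (zsum f m + f m)%Z end.

Lemma zsum_ext f g n : (forall k, k < n -> f k = g k) -> zsum f n = zsum g n.
Proof.
  induction n as [|n IH]; intros H; [reflexivity|]. cbn.
  rewrite IH, (H n); auto with arith.
Qed.

Lemma zsum_add f n m : zsum f (n + m) = (zsum f n + zsum (fun k => f (n + k)%nat) m)%Z.
Proof.
  induction m as [|m IH]; [rewrite Nat.add_0_r; cbn; lia|].
  rewrite Nat.add_succ_r. cbn. rewrite IH. lia.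
Qed.

Lemma zsum_opp f n : zsum (fun k => - f k)%Z n = (- zsum f n)%Z.
Proof. induction n as [|n IH]; [reflexivity|]. cbn. rewrite IH. lia. Qed.

Lemma zsum_rev f n : zsum (fun k => f (n - 1 - k)) n = zsum f n.
Proof.
  induction n as [|n IH]; [reflexivity|].
  change (S n) with (1 + n) at 2. rewrite zsum_add.
  cbn [zsum]. rewrite <- IH.
  rewrite (@zsum_ext (fun k => f (S n - 1 - (1 + k))) (fun k => f (n - 1 - k))).
  - replace (S n - 1 - 0) with n by lia. lia.
  - intros k L. f_equal. lia.
Qed.

Lemma zsum_bound f n : (forall k, Z.abs (f k) <= 1)%Z -> (Z.abs (zsum f n) <= Z.of_nat n)%Z.
Proof.
  intros H. induction n as [|n IH]; [cbn; lia|]. cbn [zsum]. specialize (H n). lia.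
Qed.

Lemma zsum_nonneg f n : (forall k, 0 <= f k)%Z -> (0 <= zsum f n)%Z.
Proof.
  intros H. induction n as [|n IH]; [cbn; lia|]. cbn [zsum]. specialize (H n). lia.
Qed.

Lemma zsum_mult f s i : 1 <= s -> (forall k, 0 <= f k)%Z ->
  (forall j, 1 <= f (s * j)%nat)%Z -> (Z.of_nat i <= zsum f (s * i))%Z.
Proof.
  intros Hs H0 H1. induction i as [|i IH]; [rewrite Nat.mul_0_r; cbn; lia|].
  replace (s * S i) with (s * i + (1 + (s - 1))) by lia.
  rewrite !zsum_add. cbn [zsum]. rewrite Nat.add_0_r.
  specialize (H1 i).
  assert (0 <= zsum (fun k => f (s * i + (1 + k))%nat) (s - 1))%Z by (apply zsum_nonneg; auto).
  lia.
Qed.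

Section TreeAction.
Context (E : Group) (T : tree_action E).
Notation geo := (geod (@adj E T)).
Notation "x · v" := (act x v) (at level 35, right associativity).

Lemma act_inv_l (x : E) (v : T) : ginv x · x · v = v.
Proof. now rewrite <- act_mul, gmulV, act_one. Qed.

Lemma act_inj (x : E) (v w : T) : x · v = x · w -> v = w.
Proof. intros H. now rewrite <- (act_inv_l x v), H, act_inv_l. Qed.

Lemma geo_sub (p : nat -> T) n a m : geo p n -> a + m <= n -> geo (fun k => p (a + k)) m.
Proof.
  intros [A R] L. split; intros k L'.
  - rewrite Nat.add_succ_r. apply A. lia.
  - rewrite !Nat.add_succ_r. apply R. lia.
Qed.

Lemma geo_prefix (p : nat -> T) n m : geo p n -> m <= n -> geo p m.
Proof. intros H L. exact (geo_sub (a := 0) H L). Qed.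

Lemma geo_rev (p : nat -> T) n : geo p n -> geo (prev p n) n.
Proof.
  intros [A R]. unfold prev. split; intros k L.
  - apply adj_sym. replace (n - k) with (S (n - S k)) by lia. apply A. lia.
  - replace (n - k) with (S (S (n - S (S k)))) by lia. apply not_eq_sym, R. lia.
Qed.

Lemma geo_act x (p : nat -> T) n : geo p n -> geo (fun k => x · p k) n.
Proof.
  intros [A R]. split; intros k L.
  - apply act_adj; auto.
  - intros H. apply act_inj in H. now apply (R k).
Qed.

Lemma geo_cat (p q : nat -> T) n m : geo p n -> geo q m -> p n = q 0 ->
  (1 <= n -> 1 <= m -> p (n - 1) <> q 1) -> geo (pcat p n q) (n + m).
Proof.
  intros [A1 R1] [A2 R2] H J. split; intros k L.
  - destruct (le_lt_dec (S k) n).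
    + rewrite !pcat_l by lia. apply A1. lia.
    + rewrite !pcat_r by (trivial; lia). replace (S k - n) with (S (k - n)) by lia.
      apply A2. lia.
  - destruct (le_lt_dec (S (S k)) n).
    + rewrite !pcat_l by lia. apply R1. lia.
    + destruct (le_lt_dec n k).
      * rewrite !pcat_r by (trivial; lia). replace (S (S k) - n) with (S (S (k - n))) by lia.
        apply R2. lia.
      * rewrite pcat_l, pcat_r by (trivial; lia).
        replace (S (S k) - n) with 1 by lia. replace k with (n - 1) by lia. apply J; lia.
Qed.

(** If the last edges differ, [p] followed by the reverse of [q] is reduced and closed; otherwise
    both paths lose their last edge. *)
Lemma geo_unique (p q : nat -> T) n m : geo p n -> geo q m -> p 0 = q 0 -> p n = q m ->
  n = m /\ forall k, k <= n -> p k = q k.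
Proof.
  revert m. induction n as [|n IH]; intros m Hp Hq H0 H1.
  - assert (m = 0) by (apply (no_closed Hq); congruence). subst. split; trivial.
    intros k L. now replace k with 0 by lia.
  - destruct m as [|m].
    + exfalso. enough (S n = 0) by easy. apply (no_closed Hp). congruence.
    + destruct (classic (p n = q m)) as [e|N].
      * destruct (IH m) as [-> K]; trivial.
        { apply (geo_prefix Hp); lia. } { apply (geo_prefix Hq); lia. }
        split; trivial. intros k L. destruct (Nat.eq_dec k (S m)) as [->|]; trivial.
        apply K. lia.
      * exfalso. enough (S n + S m = 0) by easy.
        apply (no_closed (p := pcat p (S n) (prev q (S m)))).
        -- apply geo_cat; [exact Hp|now apply geo_rev| | ]; unfold prev.
           ++ now rewrite Nat.sub_0_r.
           ++ intros _ _. replace (S n - 1) with n by lia. now replace (S m - 1) with m by lia.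
        -- rewrite pcat_l by lia. rewrite pcat_r; [|unfold prev; now rewrite Nat.sub_0_r|lia].
           unfold prev. now replace (S m - (S n + S m - S n)) with 0 by lia.
Qed.

Definition gp_len (v w : T) : (nat -> T) * nat :=
  epsilon (inhabits (fun _ => v, 0))
    (fun r => geo (fst r) (snd r) /\ fst r 0 = v /\ fst r (snd r) = w).
Definition gp (v w : T) : nat -> T := fst (gp_len v w).
Definition len (v w : T) : nat := snd (gp_len v w).

Lemma gp_spec v w : geo (gp v w) (len v w) /\ gp v w 0 = v /\ gp v w (len v w) = w.
Proof.
  unfold gp, len, gp_len. apply epsilon_spec.
  destruct (geod_exists v w) as (p & n & H). now exists (p, n).
Qed.

Lemma geo_gp (p : nat -> T) n :
  geo p n -> len (p 0) (p n) = n /\ forall k, k <= n -> gp (p 0) (p n) k = p k.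
Proof.
  intros H. destruct (gp_spec (p 0) (p n)) as (A & B & C).
  destruct (geo_unique A H B C) as [-> K]. auto.
Qed.

Lemma geo_len (p : nat -> T) n v w : geo p n -> p 0 = v -> p n = w -> len v w = n.
Proof. intros H <- <-. now apply geo_gp. Qed.

Lemma len_act x v w : len (x · v) (x · w) = len v w.
Proof.
  destruct (gp_spec v w) as (A & B & C).
  apply (geo_len (geo_act x A)); congruence.
Qed.

Lemma len_eq0 v w : len v w = 0 -> v = w.
Proof. destruct (gp_spec v w) as (_ & B & C). intros H. congruence. Qed.

Lemma len_refl v : len v v = 0.
Proof.
  apply (@geo_len (fun _ => v)); trivial. split; intros; lia.
Qed.

(** By uniqueness of geodesics, [x] fixes the whole path from [v] to [w]. Length one would change
    the class, and a longer path starts with a triple excluded by [fixB_local]. *)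
Lemma fixB_unique x (v w : T) : x <> gone -> isB v -> isB w ->
  x · v = v -> x · w = w -> v = w.
Proof.
  intros Nx Bv Bw Fv Fw. destruct (gp_spec v w) as (A & B & C).
  set (p := gp v w) in *. set (n := len v w) in *.
  assert (F : forall k, k <= n -> x · p k = p k).
  { apply (@geo_unique (fun k => x · p k) p n n); trivial; [now apply geo_act| |]; congruence. }
  destruct n as [|[|n]]; [congruence| |].
  - pose proof (adj_isB (proj1 A 0 ltac:(lia))) as X. rewrite B, C in X. tauto.
  - exfalso. apply (proj2 A 0 ltac:(lia)).
    apply (fixB_local (x := x) (u := p 1)); trivial; try (apply F; lia); try (apply A; lia).
    now rewrite B.
Qed.

(** Four consecutive vertices contain two distinct ones of the class [isB], and a nontrivial element
    fixes at most one. *)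
Lemma acylindrical x (p : nat -> T) :
  geo p 3 -> (forall k, k <= 3 -> x · p k = p k) -> x = gone.
Proof.
  intros [A R] F. destruct (classic (x = gone)) as [|N]; trivial. exfalso.
  pose proof (adj_isB (A 0 ltac:(lia))). pose proof (adj_isB (A 1 ltac:(lia))).
  pose proof (adj_isB (A 2 ltac:(lia))).
  destruct (classic (isB (p 0))).
  - apply (R 0); [lia|]. apply (fixB_unique N); try apply F; try lia; tauto.
  - apply (R 1); [lia|]. apply (fixB_unique N); try apply F; try lia; try tauto.
Qed.

(** * Lines, translation lengths and axes *)

Definition line (a : Z -> T) : Prop :=
  (forall k, adj (a k) (a (k + 1)%Z)) /\ (forall k, a k <> a (k + 2)%Z).

Lemma line_geo a i n : line a -> geo (fun k => a (i + Z.of_nat k)%Z) n.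
Proof.
  intros [A R]. split; intros k _.
  - replace (i + Z.of_nat (S k))%Z with (i + Z.of_nat k + 1)%Z by lia. apply A.
  - replace (i + Z.of_nat (S (S k)))%Z with (i + Z.of_nat k + 2)%Z by lia. apply R.
Qed.

Lemma line_opp a : line a -> line (fun k => a (- k)%Z).
Proof.
  intros [A R]. split; intros k.
  - apply adj_sym. replace (- k)%Z with (- (k + 1) + 1)%Z by lia. apply A.
  - apply not_eq_sym. replace (- k)%Z with (- (k + 2) + 2)%Z by lia. apply R.
Qed.

Lemma len_line a i j : line a -> len (a i) (a j) = Z.abs_nat (j - i).
Proof.
  intros H. destruct (Z_le_gt_dec i j).
  - apply (geo_len (line_geo i (Z.abs_nat (j - i)) H)); f_equal; lia.
  - apply (geo_len (line_geo (- i) (Z.abs_nat (j - i)) (line_opp H))); f_equal; lia.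
Qed.

Lemma line_inj a i j : line a -> a i = a j -> i = j.
Proof.
  intros H e. pose proof (len_line i j H) as L. rewrite e, len_refl in L. lia.
Qed.

Lemma line_fix_trivial a x : line a -> (forall k, x · a k = a k) -> x = gone.
Proof. intros H F. apply (acylindrical (line_geo 0 3 H)). intros; apply F. Qed.

(** Let [a k] be a point of the line nearest to [v]. The path from [v] to [a k], one period of the
    line, and the [g]-translate of the first path read backwards fit together without
    backtracking. *)
Lemma translation_length_pos a g s v : line a -> (forall k, g · a k = a (k + s)%Z) ->
  (0 < s)%Z -> exists k, len v (g · v) = 2 * len v (a k) + Z.to_nat s.
Proof.
  intros H Hg Hs.
  destruct (exists_min (fun k => len v (a k)) 0%Z) as [k Hk].
  exists k. destruct (gp_spec v (a k)) as (A & B & C).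
  set (p := gp v (a k)) in *. set (m := len v (a k)) in *.
  (* By minimality the path from [v] meets the line only at its end. *)
  assert (K : forall j, 1 <= m -> p (m - 1) <> a j).
  { intros j L e. specialize (Hk j).
    rewrite (@geo_len p (m - 1) v (a j)) in Hk; trivial; [lia|].
    apply (geo_prefix A); lia. }
  assert (G1 : geo (pcat p m (fun i => a (k + Z.of_nat i)%Z)) (m + Z.to_nat s)).
  { apply geo_cat; trivial.
    - now apply line_geo.
    - rewrite C. f_equal. lia.
    - intros L _. now apply K. }
  assert (P0 : p m = a (k + Z.of_nat 0)%Z) by (rewrite C; f_equal; lia).
  assert (P1 : pcat p m (fun i => a (k + Z.of_nat i)%Z) (m + Z.to_nat s) = a (k + s)%Z).
  { rewrite pcat_r by (trivial; lia). f_equal. lia. }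
  assert (G2 : geo (pcat (pcat p m (fun i => a (k + Z.of_nat i)%Z)) (m + Z.to_nat s)
                     (prev (fun i => g · p i) m)) (m + Z.to_nat s + m)).
  { apply geo_cat; trivial.
    - now apply geo_rev, geo_act.
    - rewrite P1. unfold prev. now rewrite Nat.sub_0_r, C, Hg.
    - intros _ L. rewrite pcat_r by (trivial; lia). unfold prev.
      replace (k + Z.of_nat (m + Z.to_nat s - 1 - m))%Z with (k - 1 + s)%Z by lia.
      rewrite <- Hg. intros e. apply act_inj in e. now apply (@K (k - 1)%Z). }
  rewrite (geo_len (v := v) (w := g · v) G2); [lia| |].
  - rewrite !pcat_l by lia. trivial.
  - rewrite pcat_r; [|rewrite P1; unfold prev; now rewrite Nat.sub_0_r, C, Hg|lia].
    unfold prev. replace (m - (m + Z.to_nat s + m - (m + Z.to_nat s))) with 0 by lia.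
    congruence.
Qed.

Lemma translation_length a g s v : line a -> (forall k, g · a k = a (k + s)%Z) ->
  s <> 0%Z -> exists k, len v (g · v) = 2 * len v (a k) + Z.abs_nat s.
Proof.
  intros H Hg Hs. destruct (Z_lt_le_dec 0 s) as [L|L].
  - destruct (translation_length_pos v H Hg L) as [k K]. exists k. lia.
  - destruct (@translation_length_pos (fun k => a (- k)%Z) g (- s)%Z v) as [k K].
    + now apply line_opp.
    + intros k. rewrite Hg. f_equal. lia.
    + lia.
    + exists (- k)%Z. lia.
Qed.

Definition elliptic (g : E) : Prop := exists v : T, g · v = v.

(** At a vertex of least displacement, the translates of the geodesic from [v] to [g · v] by the
    powers of [g] concatenate to a line. *)
Lemma axis_exists g : ~ elliptic g ->
  exists a s, line a /\ (0 < s)%Z /\ forall k, g · a k = a (k + s)%Z.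
Proof.
  intros N.
  destruct (exists_min (fun v => len v (g · v)) (base T)) as [v Hv].
  destruct (gp_spec v (g · v)) as (A & B & C).
  set (p := gp v (g · v)) in *. set (t := len v (g · v)) in *.
  assert (t <> 0) by (intros e; apply N; exists v; symmetry; now apply len_eq0).
  (* The action preserves the class [isB], so no element inverts an edge. *)
  assert (t <> 1).
  { intros e. rewrite e in *. pose proof (adj_isB (proj1 A 0 ltac:(lia))) as X.
    rewrite B, C in X. rewrite act_isB in X. tauto. }
  (* Backtracking at [g · v] would give [p 1] the displacement [t - 2]. *)
  assert (J : p (t - 1) <> g · p 1).
  { intros e. specialize (Hv (p 1)).
    rewrite <- e in Hv. rewrite (@geo_len (fun k => p (1 + k)) (t - 2) (p 1) (p (t - 1))) in Hv.
    - lia.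
    - apply (geo_sub A). lia.
    - reflexivity.
    - f_equal. lia. }
  set (s := Z.of_nat t).
  set (a := fun k : Z => gzpow g (k / s) · p (Z.to_nat (k mod s))).
  (* The value [r = s] is included: there two consecutive translates meet. *)
  assert (Ha : forall q r, (0 <= r <= s)%Z -> a (q * s + r)%Z = gzpow g q · p (Z.to_nat r)).
  { intros q r L. destruct (Z.eq_dec r s) as [->|].
    - replace (q * s + s)%Z with (0 + (q + 1) * s)%Z by lia. unfold a.
      rewrite Z.div_add, Z.mod_add by lia. cbn [Z.to_nat Z.modulo Z.div].
      rewrite Z.div_0_l, Z.mod_0_l by lia. cbn [Z.to_nat]. rewrite B.
      unfold s. rewrite Nat2Z.id, C, Z.add_0_l, gzpow_succ, (comm_gzpow q (comm_refl g)).
      apply act_mul.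
    - unfold a. rewrite Z.add_comm, Z.div_add, Z.mod_add by lia.
      now rewrite Z.div_small, Z.mod_small, Z.add_0_l by lia. }
  assert (D : forall k, exists q r, k = (q * s + r)%Z /\ (0 <= r < s)%Z).
  { intros k. exists (k / s)%Z, (k mod s)%Z. split.
    - rewrite (Z.div_mod k s) at 1 by lia. lia.
    - apply Z.mod_pos_bound. lia. }
  exists a, s. repeat split.
  - intros k. destruct (D k) as (q & r & -> & L).
    rewrite <- Z.add_assoc, !Ha by lia. apply act_adj.
    replace (Z.to_nat (r + 1)) with (S (Z.to_nat r)) by lia. apply A. lia.
  - intros k. destruct (D k) as (q & r & -> & L).
    destruct (Z_le_gt_dec (r + 2) s).
    + rewrite <- Z.add_assoc, !Ha by lia. intros e. apply act_inj in e.
      revert e. replace (Z.to_nat (r + 2)) with (S (S (Z.to_nat r))) by lia. apply A. lia.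
    + replace (q * s + r + 2)%Z with ((q + 1) * s + 1)%Z by lia.
      rewrite !Ha by lia. rewrite gzpow_succ, (comm_gzpow q (comm_refl g)), act_mul. intros e.
      apply act_inj in e. apply J. change (Z.to_nat 1) with 1 in e. rewrite <- e. f_equal. lia.
  - lia.
  - intros k. unfold a. replace (k + s)%Z with (k + 1 * s)%Z by lia.
    rewrite Z.div_add, Z.mod_add by lia. now rewrite gzpow_succ, act_mul.
Qed.

Lemma act_gpow_line (a : Z -> T) (g : E) s i n : (forall k, g · a k = a (k + s)%Z) ->
  gpow g n · a i = a (i + Z.of_nat n * s)%Z.
Proof.
  intros H. revert i. induction n as [|n IH]; intros i.
  - cbn [gpow]. rewrite act_one. f_equal. lia.
  - rewrite gpowS, act_mul, H, IH. f_equal. lia.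
Qed.

(** A nontrivial elliptic element lies in a torsion-free stabilizer; powers of a hyperbolic one
    still translate its axis. *)
Lemma tree_torsion_free : torsion_free E.
Proof.
  intros x n Hn e. destruct (classic (x = gone)) as [|N]; trivial.
  destruct (classic (elliptic x)) as [[v Hv]|NE].
  - destruct (fixB N Hv) as (w & Hw & Fw). now apply (stabB_torsion_free (n := n) Hw Fw).
  - exfalso. destruct (axis_exists NE) as (a & s & La & Hs & Hx).
    pose proof (act_gpow_line 0 n Hx) as K. rewrite e, act_one in K.
    apply line_inj in K; trivial. nia.
Qed.

(** The induced map on indices is an isometry of the integers. *)
Lemma line_map (a : Z -> T) (h : E) : line a -> (forall k, exists r, h · a k = a r) ->
  exists t, (forall k, h · a k = a (t + k)%Z) \/ (forall k, h · a k = a (t - k)%Z).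
Proof.
  intros H K. destruct (choice _ K) as [r Hr].
  assert (D : forall i j, Z.abs (r i - r j) = Z.abs (i - j)).
  { intros i j. pose proof (len_act h (a j) (a i)) as L.
    rewrite !Hr, !len_line in L by trivial. lia. }
  exists (r 0%Z). pose proof (D 1 0)%Z.
  destruct (Z.eq_dec (r 1%Z) (r 0%Z + 1)).
  - left. intros k. rewrite Hr. f_equal. pose proof (D k 0)%Z. pose proof (D k 1)%Z. lia.
  - right. intros k. rewrite Hr. f_equal. pose proof (D k 0)%Z. pose proof (D k 1)%Z. lia.
Qed.

(** The square of such an [h] fixes the line pointwise, hence is trivial, and so is [h] by
    torsion-freeness. *)
Lemma no_reversal (a : Z -> T) (h : E) t : line a -> ~ (forall k, h · a k = a (t - k)%Z).
Proof.
  intros H R.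
  assert (e : h = gone).
  { apply (@tree_torsion_free h 2); [lia|]. apply (line_fix_trivial H).
    intros k. rewrite gpowS, gpow1, act_mul, !R. f_equal. lia. }
  pose proof (R 0%Z) as R0. pose proof (R 1%Z) as R1. rewrite e, act_one in *.
  apply line_inj in R0; trivial. apply line_inj in R1; trivial. lia.
Qed.

(** The displacement of [x] at [y · a k] is the one at [a k], namely [s]. By [translation_length]
    only points of the axis have this displacement. *)
Lemma comm_preserves_axis (a : Z -> T) (x : E) s y :
  line a -> (0 < s)%Z -> (forall k, x · a k = a (k + s)%Z) ->
  comm x y -> exists t, forall k, y · a k = a (k + t)%Z.
Proof.
  intros H Hs Hx C.
  destruct (@line_map a y H) as [t [K|K]].
  - intros k. destruct (@translation_length a x s (y · a k) H Hx) as [r Hr]; [lia|].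
    exists r. apply len_eq0. rewrite <- act_mul, C, act_mul, len_act, Hx, len_line in Hr by trivial.
    lia.
  - exists t. intros k. rewrite K. f_equal. lia.
  - now apply no_reversal in K.
Qed.

(** If [x] is elliptic, [y], its conjugate and then [h] all fix the unique [isB] vertex of [x],
    whose stabilizer is abelian. If [x] is hyperbolic, [h] maps the axis of [x] to itself without
    reversing it, so it translates the axis as [x] does. *)
Lemma tree_csa : csa E.
Proof.
  intros x y h Nx Ny C1 C2.
  assert (Nz : gconj h y <> gone) by (intros e; now apply conj_eq1 in e).
  destruct (classic (elliptic x)) as [[v Hv]|NE].
  - destruct (fixB Nx Hv) as (w & Hw & Fw).
    assert (K : forall z, comm x z -> z · w = w).
    { intros z Cz. apply (fixB_unique Nx); trivial.
      - now apply act_isB.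
      - now rewrite <- act_mul, Cz, act_mul, Fw. }
    assert (Fy := K _ C1). assert (Fz := K _ C2).
    apply (stabB_comm Hw); trivial. symmetry.
    apply (fixB_unique Nz); trivial.
    + now apply act_isB.
    + unfold gconj. now rewrite !act_mul, act_inv_l, Fy.
  - destruct (axis_exists NE) as (a & s & La & Hs & Hx).
    destruct (comm_preserves_axis La Hs Hx C1) as [t Ht].
    destruct (comm_preserves_axis La Hs Hx C2) as [t' Ht'].
    assert (nontriv : forall z r, z <> gone -> (forall k, z · a k = a (k + r)%Z) -> r <> 0%Z).
    { intros z r Nz0 Hz ->. apply Nz0, (line_fix_trivial La). intros k. rewrite Hz. f_equal. lia. }
    (* Displacements at [h · a k] give |t| = 2 dist + |t'|, and those at [ginv h · a k] give |t'| =
       2 dist + |t|; hence both distances vanish. *)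
    assert (M : forall k, exists r, h · a k = a r).
    { intros k. destruct (translation_length (h · a k) La Ht' (nontriv _ _ Nz Ht')) as [r Hr].
      destruct (translation_length (ginv h · a k) La Ht (nontriv _ _ Ny Ht)) as [r' Hr'].
      exists r. apply len_eq0.
      replace (gconj h y · h · a k) with (h · y · a k) in Hr
        by (unfold gconj; now rewrite !act_mul, act_inv_l).
      rewrite len_act, Ht, len_line in Hr by trivial.
      replace (y · ginv h · a k) with (ginv h · gconj h y · a k) in Hr'
        by (unfold gconj; now rewrite !act_mul, act_inv_l).
      rewrite len_act, Ht', len_line in Hr' by trivial. lia. }
    destruct (line_map La M) as [u [K|K]]; [|now apply no_reversal in K].
    apply (@gcancel_l E (ginv (x ** h))). rewrite gmulV. symmetry.
    apply (line_fix_trivial La). intros k.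
    rewrite !act_mul, Hx, K. replace (u + (k + s))%Z with (u + k + s)%Z by lia.
    now rewrite <- Hx, <- K, <- (act_mul x h (a k)), act_inv_l.
Qed.

(** * Brooks counting along an axis *)

Section Counting.
Context (a : Z -> T) (g : E) (s : Z).
Context (La : line a) (Hs : (0 < s)%Z) (Hg : forall k, g · a k = a (k + s)%Z).

(** The segment covers [k] and [k + s] for four consecutive [k], which is the input of
    [acylindrical] in the next proof. *)
Let l : nat := Z.to_nat (2 * s + 3).

(* An element reversing a segment longer than two periods of the axis would conjugate [g] to
   its inverse, by acylindricity, and hence reverse the whole axis. *)
Lemma no_reversed_copy e j : e · a 0%Z = a (j + Z.of_nat l)%Z -> e · a (Z.of_nat l) <> a j.
Proof.
  intros e0 e1.
  assert (R : forall k, (0 <= k <= Z.of_nat l)%Z -> e · a k = a (j + Z.of_nat l - k)%Z).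
  { intros k L.
    destruct (@geo_unique (fun i => e · a (0 + Z.of_nat i)%Z)
       (prev (fun i => a (j + Z.of_nat i)%Z) l) l l) as [_ K].
    - apply geo_act, line_geo, La.
    - apply geo_rev, line_geo, La.
    - unfold prev. cbn [Z.of_nat]. rewrite Z.add_0_l, e0. f_equal. lia.
    - unfold prev. rewrite Z.add_0_l, e1, Nat.sub_diag. f_equal. lia.
    - specialize (K (Z.to_nat k) ltac:(lia)). unfold prev in K.
      rewrite <- (Z2Nat.id k) at 1 by lia.
      rewrite Z.add_0_l in K. rewrite K. f_equal. lia. }
  assert (I : g ** e ** g = e).
  { symmetry. apply eq_of_inv_mul.
    apply (acylindrical (line_geo 0 3 La)). intros k Lk.
    rewrite !act_mul, Hg, R by lia.
    rewrite Hg. replace (j + Z.of_nat l - (0 + Z.of_nat k + s) + s)%Z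
      with (j + Z.of_nat l - (0 + Z.of_nat k))%Z by lia.
    rewrite <- R by lia. apply act_inv_l. }
  assert (St : forall k, e · a k = a (j + Z.of_nat l - k)%Z <->
                         e · a (k + s)%Z = a (j + Z.of_nat l - (k + s))%Z).
  { intros k. rewrite <- Hg.
    assert (X : g · e · g · a k = e · a k) by (rewrite <- I at 2; now rewrite !act_mul).
    split; intros Y.
    - apply (@act_inj g). rewrite X, Y, Hg. f_equal. lia.
    - rewrite <- X, Y, Hg. f_equal. lia. }
  apply (@no_reversal a e (j + Z.of_nat l)%Z La).
  assert (P : forall n k, (0 <= k < s)%Z ->
     e · a (k + Z.of_nat n * s)%Z = a (j + Z.of_nat l - (k + Z.of_nat n * s))%Z /\
     e · a (k - Z.of_nat n * s)%Z = a (j + Z.of_nat l - (k - Z.of_nat n * s))%Z).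
  { induction n as [|n IH]; intros k L.
    - replace (k + Z.of_nat 0 * s)%Z with k by lia. replace (k - Z.of_nat 0 * s)%Z with k by lia.
      split; apply R; lia.
    - destruct (IH k L) as [I1 I2]. split.
      + apply St in I1. replace (k + Z.of_nat (S n) * s)%Z with (k + Z.of_nat n * s + s)%Z by lia.
        exact I1.
      + apply St. replace (k - Z.of_nat (S n) * s + s)%Z with (k - Z.of_nat n * s)%Z by lia.
        exact I2. }
  intros k. pose proof (Z.div_mod k s ltac:(lia)) as D.
  pose proof (Z.mod_pos_bound k s ltac:(lia)) as B.
  set (q := (k / s)%Z) in *. set (r := (k mod s)%Z) in *.
  destruct (Z_le_gt_dec 0 q).
  - replace k with (r + Z.of_nat (Z.to_nat q) * s)%Z by lia. apply P, B.
  - replace k with (r - Z.of_nat (Z.to_nat (- q)) * s)%Z by lia. apply P, B.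
Qed.

(** Geodesics being unique, a translate of the segment is determined by its ordered endpoints. *)
Definition copy (v w : T) : Prop := exists e, v = e · a 0%Z /\ w = e · a (Z.of_nat l).

(** The Brooks weight: +1 for a translate of the segment, -1 for a reversed one. By [copy_asym] the
    order of the tests is immaterial. *)
Definition lam (v w : T) : Z :=
  if excluded_middle_informative (copy v w) then 1%Z
  else if excluded_middle_informative (copy w v) then (-1)%Z else 0%Z.

(** Translates by [e] and [f] in opposite directions would make [ginv f ** e] reverse the segment
    itself. *)
Lemma copy_asym v w : copy v w -> ~ copy w v.
Proof.
  intros (e & -> & ->) (f & H1 & H2).
  apply (@no_reversed_copy (ginv f ** e) 0%Z).
  - now rewrite act_mul, H2, act_inv_l.
  - now rewrite act_mul, H1, act_inv_l.
Qed.

Lemma lam_opp v w : lam w v = (- lam v w)%Z.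
Proof.
  unfold lam. pose proof (@copy_asym v w).
  destruct (excluded_middle_informative (copy v w));
  destruct (excluded_middle_informative (copy w v)); tauto || lia.
Qed.

Lemma lam_abs v w : (Z.abs (lam v w) <= 1)%Z.
Proof. unfold lam. repeat destruct excluded_middle_informative; lia. Qed.

Lemma copy_act e v w : copy (e · v) (e · w) <-> copy v w.
Proof.
  split; intros (f & H1 & H2).
  - exists (ginv e ** f). rewrite !act_mul, <- H1, <- H2. now rewrite !act_inv_l.
  - exists (e ** f). rewrite !act_mul. now subst.
Qed.

Lemma lam_act e v w : lam (e · v) (e · w) = lam v w.
Proof.
  unfold lam. pose proof (copy_act e v w). pose proof (copy_act e w v).
  repeat destruct excluded_middle_informative; tauto.
Qed.

(** There are [n + 1 - l] subpaths of length [l]; truncated subtraction gives none for short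
    paths. *)
Definition count (p : nat -> T) (n : nat) : Z := zsum (fun j => lam (p j) (p (j + l))) (n + 1 - l).
Definition cnt (v w : T) : Z := count (gp v w) (len v w).

Lemma cnt_geo (p : nat -> T) n : geo p n -> cnt (p 0) (p n) = count p n.
Proof.
  intros H. destruct (geo_gp H) as [H1 H2]. unfold cnt, count. rewrite H1.
  apply zsum_ext. intros k L. rewrite !H2 by lia. reflexivity.
Qed.

Lemma cnt_act e v w : cnt (e · v) (e · w) = cnt v w.
Proof.
  destruct (gp_spec v w) as (A & B & C).
  pose proof (cnt_geo (geo_act e A)) as H. cbn beta in H. rewrite B, C in H.
  rewrite H. unfold cnt, count.
  apply zsum_ext. intros k _. apply lam_act.
Qed.

Lemma cnt_opp v w : cnt w v = (- cnt v w)%Z.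
Proof.
  destruct (gp_spec v w) as (A & B & C).
  set (p := gp v w) in *. set (n := len v w) in *.
  replace (cnt w v) with (count (prev p n) n).
  - change (cnt v w) with (count p n). unfold count.
    rewrite <- zsum_opp, <- (zsum_rev _ (n + 1 - l)).
    apply zsum_ext. intros k L. unfold prev.
    rewrite lam_opp. f_equal. f_equal; f_equal; lia.
  - rewrite <- (cnt_geo (geo_rev A)). unfold prev. now rewrite Nat.sub_0_r, Nat.sub_diag, B, C.
Qed.

(** Only subpaths straddling the cut are lost, and there are fewer than [l] of them. *)
Lemma cnt_split (p : nat -> T) n m : geo p (n + m) ->
  (Z.abs (cnt (p 0%nat) (p (n + m)%nat) - cnt (p 0%nat) (p n) - cnt (p n) (p (n + m)%nat))
    <= Z.of_nat l)%Z.
Proof.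
  intros H.
  pose proof (cnt_geo (geo_sub (a := n) (m := m) H (le_n _))) as H2. cbn beta in H2.
  rewrite Nat.add_0_r in H2.
  rewrite (cnt_geo H), (cnt_geo (geo_prefix H (Nat.le_add_r n m))), H2. unfold count.
  set (f := fun j => lam (p j) (p (j + l))).
  assert (Bf : forall k, (Z.abs (f k) <= 1)%Z) by (intros; apply lam_abs).
  rewrite (@zsum_ext (fun j => lam (p (n + j)) (p (n + (j + l)))) (fun j => f (n + j)))
    by (intros; unfold f; now rewrite Nat.add_assoc).
  assert (Hl : 3 <= l) by lia. clearbody l.
  destruct (le_lt_dec l m).
  - replace (n + m + 1 - l) with (n + (m + 1 - l)) by lia. rewrite zsum_add.
    destruct (le_lt_dec l n).
    + replace n with ((n + 1 - l) + (l - 1)) at 1 by lia. rewrite zsum_add.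
      pose proof (@zsum_bound (fun k => f (n + 1 - l + k)) (l - 1) (fun k => Bf _)). lia.
    + pose proof (@zsum_bound f n Bf). replace (n + 1 - l) with 0 by lia. cbn [zsum]. lia.
  - replace (m + 1 - l) with 0 by lia. cbn [zsum].
    destruct (le_lt_dec l (n + 1)).
    + replace (n + m + 1 - l) with ((n + 1 - l) + m) by lia. rewrite zsum_add.
      pose proof (@zsum_bound (fun k => f (n + 1 - l + k)) m (fun k => Bf _)). lia.
    + replace (n + 1 - l) with 0 by lia. cbn [zsum].
      pose proof (@zsum_bound f (n + m + 1 - l) Bf). lia.
Qed.

(** The center is the vertex of the path from [x] to [y] nearest to [z]; minimality excludes
    backtracking there. *)
Lemma tripod x y z : exists (p q r : nat -> T) i j k,
  geo p (i + j) /\ geo q (i + k) /\ geo r (j + k) /\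
  p 0 = x /\ p (i + j) = y /\ q 0 = x /\ q (i + k) = z /\ r 0 = y /\ r (j + k) = z /\
  p i = q i /\ p i = r j.
Proof.
  destruct (gp_spec x y) as (A & B & C).
  set (p := gp x y) in *. set (n := len x y) in *.
  destruct (@exists_min {i | i <= n} (fun i => len (p (proj1_sig i)) z))
    as [[i Hi] Hm]; [now exists 0; lia|]. cbn in Hm.
  destruct (gp_spec (p i) z) as (A' & B' & C').
  set (c := gp (p i) z) in *. set (k := len (p i) z) in *.
  assert (J : forall i', i' <= n -> 1 <= k -> p i' <> c 1).
  { intros i' L1 L2 e. specialize (Hm (exist _ i' L1)). cbn in Hm.
    rewrite (@geo_len (fun t => c (1 + t)) (k - 1) (p i') z) in Hm.
    - lia.
    - apply (geo_sub A'). lia.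
    - now rewrite e.
    - rewrite <- C'. f_equal. lia. }
  exists p, (pcat p i c), (pcat (prev (fun t => p (i + t)) (n - i)) (n - i) c), i, (n - i), k.
  assert (Q : prev (fun t => p (i + t)) (n - i) (n - i) = c 0).
  { unfold prev. rewrite B'. f_equal. lia. }
  replace (i + (n - i)) with n by lia.
  refine (conj A (conj _ (conj _ (conj B (conj C (conj _ (conj _ (conj _ (conj _ (conj _ _)))))))))).
  - apply geo_cat; [apply (geo_prefix A); lia|exact A'|now symmetry|].
    intros _ L. apply J; trivial. lia.
  - apply geo_cat; [apply geo_rev, (geo_sub A); lia|exact A'|exact Q|].
    intros L1 L2. unfold prev. apply J; trivial. lia.
  - now rewrite pcat_l by lia.
  - rewrite pcat_r by (congruence || lia). rewrite <- C'. f_equal. lia.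
  - rewrite pcat_l by lia. unfold prev. rewrite <- C. f_equal. lia.
  - rewrite pcat_r by (congruence || lia). rewrite <- C'. f_equal. lia.
  - now rewrite pcat_l by lia.
  - rewrite pcat_l by lia. unfold prev. f_equal. lia.
Qed.

(** Cut the three sides at the center of the tripod: the halves cancel in pairs by [cnt_opp], and
    each cut costs at most [l]. *)
Lemma cnt_triangle x y z :
  (Z.abs (cnt x z - cnt x y - cnt y z) <= 3 * Z.of_nat l)%Z.
Proof.
  destruct (tripod x y z)
    as (p & q & r & i & j & k & Gp & Gq & Gr & P0 & P1 & Q0 & Q1 & R0 & R1 & C1 & C2).
  pose proof (cnt_split Gp) as X. pose proof (cnt_split Gq) as Y. pose proof (cnt_split Gr) as Z.
  rewrite P0, P1 in X. rewrite Q0, Q1, <- C1 in Y. rewrite R0, R1, <- C2 in Z.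
  rewrite (cnt_opp (p i) y) in Z. lia.
Qed.

(** Along the axis no weight is negative, by [no_reversed_copy], and every multiple of [s] starts a
    translate by a power of [g]. The loss [l] allows for translates that overrun the end. *)
Lemma cnt_axis N :
  (Z.of_nat N - Z.of_nat l <= cnt (a 0%Z) (gpow g N · a 0%Z))%Z.
Proof.
  rewrite (act_gpow_line 0 N Hg).
  pose proof (cnt_geo (line_geo 0 (N * Z.to_nat s) La)) as H. cbn beta in H.
  rewrite !Z.add_0_l in H. replace (Z.of_nat (N * Z.to_nat s)) with (Z.of_nat N * s)%Z in H by lia.
  cbn [Z.of_nat] in H. rewrite Z.add_0_l, H. unfold count.
  set (f := fun j : nat => lam (a (0 + Z.of_nat j)%Z) (a (0 + Z.of_nat (j + l))%Z)).
  assert (F0 : forall j, (0 <= f j)%Z).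
  { intros j. unfold f, lam. repeat destruct excluded_middle_informative; try lia.
    exfalso. destruct c as (e & H1 & H2). apply (@no_reversed_copy e (Z.of_nat j)).
    - rewrite <- H1. f_equal. lia.
    - rewrite <- H2. f_equal. }
  assert (F1 : forall j, (1 <= f (Z.to_nat s * j)%nat)%Z).
  { intros j. unfold f, lam. destruct excluded_middle_informative as [|n]; [lia|].
    exfalso. apply n. exists (gpow g j). rewrite !(act_gpow_line _ j Hg).
    split; f_equal; lia. }
  destruct (le_lt_dec N l) as [L|L].
  - pose proof (@zsum_nonneg f (N * Z.to_nat s + 1 - l) F0). lia.
  - replace (N * Z.to_nat s + 1 - l) with
      (Z.to_nat s * (N - l) + (N * Z.to_nat s + 1 - l - Z.to_nat s * (N - l))) by nia.
    rewrite zsum_add.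
    pose proof (@zsum_mult f (Z.to_nat s) (N - l) ltac:(lia) F0 F1).
    pose proof (@zsum_nonneg (fun k => f (Z.to_nat s * (N - l) + k))
      (N * Z.to_nat s + 1 - l - Z.to_nat s * (N - l)) (fun k => F0 _)). lia.
Qed.

End Counting.

Theorem hyperbolic_quasimorphism g : ~ elliptic g ->
  exists (D : R) (phi : E -> R),
    (forall x y, Rabs (phi (x ** y) - phi x - phi y) <= D)%R /\
    (forall N, INR N - D <= phi (gpow g N))%R.
Proof.
  intros NE. destruct (axis_exists NE) as (a & s & La & Hs & Hg).
  set (c := cnt a s). set (l := Z.of_nat (Z.to_nat (2 * s + 3))).
  (* The bound [3 * l] of [cnt_triangle] also covers the loss [l] of [cnt_axis]. *)
  exists (IZR (3 * l)), (fun x => IZR (c (a 0%Z) (x · a 0%Z))). split.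
  - intros x y. rewrite <- !minus_IZR, <- abs_IZR. apply IZR_le.
    unfold c. rewrite <- (@cnt_act a s Hs x (a 0%Z) (y · a 0%Z)), <- act_mul.
    apply (cnt_triangle La Hs Hg).
  - intros N. rewrite INR_IZR_INZ, <- minus_IZR. apply IZR_le.
    pose proof (@cnt_axis a g s La Hs Hg N) as H. fold c l in H. lia.
Qed.
End TreeAction.

(** * Quotients, permutation groups and coset representatives *)

Section Quotient.
Context (W : Type) (R : W -> W -> Prop).
Context (Rrefl : forall x, R x x) (Rsym : forall x y, R x y -> R y x).
Context (Rtrans : forall x y z, R x y -> R y z -> R x z).

(** Classes are predicates, so equivalent elements have equal classes by extensionality. *)
Definition quot : Type := {P : W -> Prop | exists w, P = R w}.
Definition pr (w : W) : quot := exist _ (R w) (ex_intro _ w eq_refl).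
Definition repr (q : quot) : W := proj1_sig (constructive_indefinite_description _ (proj2_sig q)).

Lemma pr_repr q : pr (repr q) = q.
Proof.
  unfold repr, pr. destruct q as [P HP]. cbn.
  destruct (constructive_indefinite_description _ HP) as [w Hw]. cbn.
  apply subset_eq_compat. now symmetry.
Qed.

Lemma pr_eq w w' : pr w = pr w' <-> R w w'.
Proof.
  split.
  - intros e. apply (f_equal (@proj1_sig _ _)) in e. cbn in e. rewrite e. apply Rrefl.
  - intros H. apply subset_eq_compat. extensionality z. apply propositional_extensionality.
    split; intros K; [apply (Rtrans (Rsym H) K)|apply (Rtrans H K)].
Qed.

Lemma repr_pr w : R (repr (pr w)) w.
Proof. apply pr_eq. apply pr_repr. Qed.
End Quotient.

Section Permutations.
Context (X : Type).

Definition perm : Type :=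
  {f : (X -> X) * (X -> X) | (forall x, fst f (snd f x) = x) /\ (forall x, snd f (fst f x) = x)}.

Lemma perm_eq (f g : perm) : (forall x, fst (proj1_sig f) x = fst (proj1_sig g) x) -> f = g.
Proof.
  destruct f as [[f f'] [F1 F2]], g as [[g g'] [G1 G2]]. cbn in *. intros e.
  apply subset_eq_compat. f_equal; extensionality x; [apply e|].
  rewrite <- (G1 x) at 1. now rewrite <- e, F2.
Qed.

Lemma perm_mul_proof (f g : perm) :
  let h := (fun x => fst (proj1_sig f) (fst (proj1_sig g) x),
            fun x => snd (proj1_sig g) (snd (proj1_sig f) x)) in
  (forall x, fst h (snd h x) = x) /\ (forall x, snd h (fst h x) = x).
Proof.
  destruct f as [[f f'] [F1 F2]], g as [[g g'] [G1 G2]]. cbn in *.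
  split; intros x; [now rewrite G1|now rewrite F2].
Qed.

Definition perm_group : Group.
Proof.
  refine {| gcar := perm;
    gmul := fun f g => exist _ _ (perm_mul_proof f g);
    ginv := fun f => exist _ (snd (proj1_sig f), fst (proj1_sig f))
              (conj (proj2 (proj2_sig f)) (proj1 (proj2_sig f)));
    gone := exist _ (fun x => x, fun x => x)
              (conj (fun x => eq_refl x) (fun x => eq_refl x)) |};
  intros; apply perm_eq; cbn; trivial.
  intros z. apply (proj2_sig x).
Defined.

Definition perm_of (f g : X -> X) (H1 : forall x, f (g x) = x) (H2 : forall x, g (f x) = x) :
  perm_group := exist _ (f, g) (conj H1 H2).
End Permutations.

Record is_subgroup (G : Group) (P : G -> Prop) : Prop := {
  sub1 : P gone;
  subM : forall x y, P x -> P y -> P (x ** y);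
  subV : forall x, P x -> P (ginv x)
}.

Lemma subMr (G : Group) (P : G -> Prop) u c : is_subgroup P -> P c -> P (u ** c) <-> P u.
Proof.
  intros HP Hc. split; intros H.
  - replace u with (u ** c ** ginv c) by now gsimp. apply HP; trivial. now apply HP.
  - now apply HP.
Qed.

Lemma subMl (G : Group) (P : G -> Prop) u c : is_subgroup P -> P c -> P (c ** u) <-> P u.
Proof.
  intros HP Hc. split; intros H.
  - replace u with (ginv c ** (c ** u)) by now gsimp. apply HP; trivial. now apply HP.
  - now apply HP.
Qed.

(** The subgroup itself is represented by the identity, so that a trivial representative in a normal
    form detects membership. *)
Definition coset_rep (G : Group) (P : G -> Prop) (u : G) : G :=
  if excluded_middle_informative (P u) then gone
  else epsilon (inhabits gone) (fun v => P (ginv v ** u)).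

Section CosetRep.
Context (G : Group) (P : G -> Prop) (HP : is_subgroup P).

Lemma coset_rep_spec u : P (ginv (coset_rep P u) ** u).
Proof.
  unfold coset_rep. destruct excluded_middle_informative as [H|H].
  - now gsimp.
  - apply (@epsilon_spec _ (inhabits gone) (fun v => P (ginv v ** u))).
    exists u. gsimp. apply HP.
Qed.

Lemma coset_rep_mul u c : P c -> coset_rep P (u ** c) = coset_rep P u.
Proof.
  intros Hc. unfold coset_rep.
  replace (fun v => P (ginv v ** (u ** c))) with (fun v => P (ginv v ** u)).
  - pose proof (subMr u HP Hc).
    do 2 destruct excluded_middle_informative; tauto.
  - extensionality v. apply propositional_extensionality.
    rewrite gmulA. symmetry. now apply subMr.
Qed.

Lemma coset_rep_in c : P c -> coset_rep P c = gone.
Proof. intros H. unfold coset_rep. now destruct excluded_middle_informative. Qed.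

Lemma coset_rep_1 u : coset_rep P u = gone <-> P u.
Proof.
  split; [|apply coset_rep_in]. intros e. pose proof (coset_rep_spec u) as H.
  rewrite e in H. now gsimp_in H.
Qed.

Lemma coset_rep_idem u : coset_rep P (coset_rep P u) = coset_rep P u.
Proof.
  rewrite <- (@coset_rep_mul (coset_rep P u) _ (coset_rep_spec u)). now gsimp.
Qed.
End CosetRep.

(** * Amalgamated products *)

Section Amalgam.
Context (H BB : Group) (I : Type).
Context (inC : I -> H -> Prop) (inB : I -> BB -> Prop) (eps : H -> BB).

(* [inC i] and [inB i] are subgroups C_i of [H] and B_i of [BB], the latter abelian, and [eps]
   embeds C_i into B_i: the amalgamated product of [H] and all the B_i identifies c in C_i with
   [eps c] in B_i. *)
Record amalgam_data : Prop := {
  C_sub : forall i, is_subgroup (inC i);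
  B_sub : forall i, is_subgroup (inB i);
  B_comm : forall i b b', inB i b -> inB i b' -> comm b b';
  eps_in : forall i c, inC i c -> inB i (eps c);
  epsM : forall i c d, inC i c -> inC i d -> eps (c ** d) = eps c ** eps d;
  eps_ker : forall i c, inC i c -> eps c = gone -> c = gone
}.

Definition compat (K : Group) (fH : H -> K) (fB : I -> BB -> K) : Prop :=
  is_group_hom fH /\
  (forall i b b', inB i b -> inB i b' -> fB i (b ** b') = fB i b ** fB i b') /\
  (forall i c, inC i c -> fB i (eps c) = fH c).

Definition letter : Type := (H + I * BB)%type.

(** Ill-formed letters count as the identity, so words carry no side conditions. *)
Definition eval_letter (K : Group) (fH : H -> K) (fB : I -> BB -> K) (l : letter) : K :=
  match l with
  | inl h => fH h
  | inr (i, b) => if excluded_middle_informative (inB i b) then fB i b else gone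
  end.

Fixpoint eval (K : Group) (fH : H -> K) (fB : I -> BB -> K) (w : list letter) : K :=
  match w with
  | nil => gone
  | l :: w => eval_letter fH fB l ** eval fH fB w
  end.

Lemma eval_app (K : Group) (fH : H -> K) fB w w' :
  eval fH fB (w ++ w') = eval fH fB w ** eval fH fB w'.
Proof. induction w as [|l w IH]; cbn; [now gsimp|]. now rewrite IH, gmulA. Qed.

Definition inv_letter (l : letter) : letter :=
  match l with inl h => inl (ginv h) | inr (i, b) => inr (i, ginv b) end.

Definition inv_word (w : list letter) : list letter := rev (map inv_letter w).

(** The universal property is built into the equality of words; the quantification over groups stays
    in [Prop], so the quotient remains in the universe of words. *)
Definition weq (w w' : list letter) : Prop :=
  forall (K : Group) (fH : H -> K) fB, compat fH fB -> eval fH fB w = eval fH fB w'.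

Lemma weq_refl w : weq w w. Proof. easy. Qed.
Lemma weq_sym w w' : weq w w' -> weq w' w.
Proof. intros e K fH fB C. now rewrite (e K fH fB C). Qed.
Lemma weq_trans w w' w'' : weq w w' -> weq w' w'' -> weq w w''.
Proof. intros e e' K fH fB C. now rewrite (e K fH fB C), (e' K fH fB C). Qed.

Context (D : amalgam_data).

Lemma compat_B1 (K : Group) (fH : H -> K) fB i : compat fH fB -> fB i gone = gone.
Proof.
  intros (_ & M & _). pose proof (sub1 (B_sub D i)) as B1.
  apply (@gcancel_l K (fB i gone)). rewrite <- M by trivial. now gsimp.
Qed.

Lemma eval_inv (K : Group) (fH : H -> K) fB w : compat fH fB ->
  eval fH fB (inv_word w) = ginv (eval fH fB w).
Proof.
  intros C. unfold inv_word. induction w as [|l w IH]; cbn; [now gsimp|].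
  rewrite eval_app, IH. cbn. gsimp. f_equal.
  destruct l as [h|[i b]]; cbn.
  - apply homV, (proj1 C).
  - pose proof (subV (B_sub D i) (x := b)) as V. pose proof (subV (B_sub D i) (x := ginv b)) as V'.
    rewrite ginvK in V'.
    destruct (excluded_middle_informative (inB i b)) as [Hb|Hb];
    destruct (excluded_middle_informative (inB i (ginv b))); try tauto; [|now gsimp].
    apply ginv_unique. rewrite <- (proj1 (proj2 C) i b (ginv b)) by tauto.
    rewrite gmulVr. apply (compat_B1 i C).
Qed.

Notation cls := (pr weq).
Notation rep := (@repr _ weq).

Lemma rep_cls w : weq (rep (cls w)) w.
Proof. apply repr_pr; [apply weq_refl|apply weq_sym|apply weq_trans]. Qed.

Lemma cls_eq w w' : cls w = cls w' <-> weq w w'.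
Proof. apply pr_eq; [apply weq_refl|apply weq_sym|apply weq_trans]. Qed.

Definition amalgam : Group.
Proof.
  refine {| gcar := quot weq;
    gmul := fun x y => cls (rep x ++ rep y);
    ginv := fun x => cls (inv_word (rep x));
    gone := cls nil |}.
  - intros x y z. apply cls_eq. intros K fH fB C.
    rewrite !eval_app, !(rep_cls _ C), !eval_app. apply gmulA.
  - intros x. rewrite <- (pr_repr x) at 2. apply cls_eq. intros K fH fB C.
    rewrite eval_app, (rep_cls _ C). apply gmul1.
  - intros x. apply cls_eq. intros K fH fB C.
    rewrite eval_app, (rep_cls _ C), eval_inv by trivial. apply gmulV.
Defined.

Definition jH (h : H) : amalgam := cls (inl h :: nil).
Definition jB (i : I) (b : BB) : amalgam := cls (inr (i, b) :: nil).

Lemma cls_app w w' : (cls (w ++ w') : amalgam) = gmul (g := amalgam) (cls w) (cls w').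
Proof.
  apply cls_eq. intros K fH fB C. now rewrite !eval_app, !(rep_cls _ C).
Qed.

Lemma j_compat : compat jH jB.
Proof.
  repeat split.
  - intros x y. unfold jH. rewrite <- cls_app. apply cls_eq. intros K fH fB C. cbn.
    rewrite (proj1 C). now gsimp.
  - intros i b b' Hb Hb'. unfold jB. rewrite <- cls_app. apply cls_eq. intros K fH fB C. cbn.
    pose proof (subM (B_sub D i) Hb Hb').
    repeat destruct excluded_middle_informative; try tauto.
    rewrite (proj1 (proj2 C)) by trivial. now gsimp.
  - intros i c Hc. apply cls_eq. intros K fH fB C. cbn.
    pose proof (eps_in D Hc).
    destruct excluded_middle_informative; try tauto.
    now rewrite (proj2 (proj2 C)) by trivial.
Qed.

Lemma jH_hom : is_group_hom jH. Proof. apply j_compat. Qed.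

Lemma jBM i b b' : inB i b -> inB i b' -> jB i (b ** b') = jB i b ** jB i b'.
Proof. apply j_compat. Qed.

Lemma jB_eps i c : inC i c -> jB i (eps c) = jH c.
Proof. apply j_compat. Qed.

Lemma jB1 i : jB i gone = gone.
Proof. apply (compat_B1 i j_compat). Qed.

Lemma jBV i b : inB i b -> jB i (ginv b) = ginv (jB i b).
Proof.
  intros Hb. apply ginv_unique. rewrite <- jBM; trivial; [|now apply B_sub].
  now rewrite gmulVr, jB1.
Qed.

Lemma amalgam_ind (P : amalgam -> Prop) :
  P gone -> (forall h e, P e -> P (jH h ** e)) ->
  (forall i b e, inB i b -> P e -> P (jB i b ** e)) -> forall e, P e.
Proof.
  intros P1 PH PB e. rewrite <- (pr_repr e). generalize (rep e) as w. clear e.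
  induction w as [|l w IH]; [exact P1|].
  change (l :: w) with ((l :: nil) ++ w). rewrite cls_app.
  destruct l as [h|[i b]]; [now apply PH|].
  destruct (excluded_middle_informative (inB i b)) as [Hb|Hb]; [now apply PB|].
  enough (e : jB i b = gone)
    by (change (P (jB i b ** (cls w : amalgam))); rewrite e, gmul1; exact IH).
  apply cls_eq. intros K fH fB C. cbn. destruct excluded_middle_informative; [easy|].
  now gsimp.
Qed.

Lemma amalgam_lift (K : Group) (fH : H -> K) fB : compat fH fB ->
  exists f : amalgam -> K, is_group_hom f /\ (forall h, f (jH h) = fH h) /\
    (forall i b, inB i b -> f (jB i b) = fB i b).
Proof.
  intros C. exists (fun x => eval fH fB (rep x)). repeat split.
  - intros x y. cbn. now rewrite (rep_cls _ C), eval_app.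
  - intros h. unfold jH. rewrite (rep_cls _ C). cbn. now gsimp.
  - intros i b Hb. unfold jB. rewrite (rep_cls _ C). cbn.
    destruct excluded_middle_informative; [|easy]. now gsimp.
Qed.

(** The universal property, applied to the group of permutations of [X]. *)
Lemma amalgam_act (X : Type) (aH : H -> X -> X) (aB : I -> BB -> X -> X) :
  (forall x, aH gone x = x) -> (forall h h' x, aH (h ** h') x = aH h (aH h' x)) ->
  (forall i x, aB i gone x = x) ->
  (forall i b b' x, inB i b -> inB i b' -> aB i (b ** b') x = aB i b (aB i b' x)) ->
  (forall i c x, inC i c -> aB i (eps c) x = aH c x) ->
  exists a : amalgam -> X -> X, (forall x, a gone x = x) /\
    (forall e e' x, a (e ** e') x = a e (a e' x)) /\
    (forall h x, a (jH h) x = aH h x) /\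
    (forall i b x, inB i b -> a (jB i b) x = aB i b x).
Proof.
  intros H1 HM B1 BM HC.
  assert (V1 : forall h x, aH h (aH (ginv h) x) = x) by (intros; now rewrite <- HM, gmulVr).
  assert (V2 : forall h x, aH (ginv h) (aH h x) = x) by (intros; now rewrite <- HM, gmulV).
  set (fH := fun h => perm_of (V1 h) (V2 h)).
  assert (W1 : forall i b (Hb : inB i b) x, aB i b (aB i (ginv b) x) = x).
  { intros. rewrite <- BM; trivial; [now rewrite gmulVr|now apply B_sub]. }
  assert (W2 : forall i b (Hb : inB i b) x, aB i (ginv b) (aB i b x) = x).
  { intros. rewrite <- BM; trivial; [now rewrite gmulV|now apply B_sub]. }
  set (fB := fun i b => match excluded_middle_informative (inB i b) with
    | left Hb => perm_of (W1 i b Hb) (W2 i b Hb) | right _ => gone end).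
  destruct (@amalgam_lift (perm_group X) fH fB) as (f & F & FH & FB).
  { repeat split.
    - intros h h'. apply perm_eq. cbn. apply HM.
    - intros i b b' Hb Hb'. unfold fB. pose proof (subM (B_sub D i) Hb Hb').
      do 3 (destruct excluded_middle_informative; [|easy]).
      apply perm_eq. cbn. intros x. now apply BM.
    - intros i c Hc. unfold fB. pose proof (eps_in D Hc).
      destruct excluded_middle_informative; [|easy]. apply perm_eq. cbn. intros x. now apply HC. }
  exists (fun e => fst (proj1_sig (f e))). repeat split.
  - intros x. now rewrite (hom1 F).
  - intros e e' x. now rewrite F.
  - intros h x. now rewrite FH.
  - intros i b x Hb. rewrite FB by trivial. unfold fB.
    now destruct excluded_middle_informative.
Qed.

Definition inepsC (i : I) (b : BB) : Prop := exists c, inC i c /\ b = eps c.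

Lemma eps1 i : inC i gone -> eps gone = gone.
Proof.
  intros H1. apply (@gcancel_l BB (eps gone)). rewrite <- (epsM D H1 H1). now gsimp.
Qed.

Lemma epsV i c : inC i c -> eps (ginv c) = ginv (eps c).
Proof.
  intros Hc. apply ginv_unique. rewrite <- (epsM D Hc); [|now apply C_sub].
  rewrite gmulVr. apply (eps1 (i := i)). apply (C_sub D i).
Qed.

Lemma eps_inj i c d : inC i c -> inC i d -> eps c = eps d -> c = d.
Proof.
  intros Hc Hd e. apply eq_of_inv_mul. apply (eps_ker D (i := i)).
  - apply C_sub; trivial. now apply C_sub.
  - rewrite (epsM D (i := i)), (epsV Hc), e; trivial; [apply gmulV|now apply C_sub].
Qed.

Lemma C_comm i c d : inC i c -> inC i d -> comm c d.
Proof.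
  intros Hc Hd. apply (@eps_inj i); try now apply C_sub.
  rewrite !(epsM D (i := i)) by trivial. apply (B_comm D (i := i)); now apply eps_in.
Qed.

Lemma inepsC_sub i : is_subgroup (inepsC i).
Proof.
  split.
  - exists gone. split; [apply (C_sub D i)|symmetry; apply (eps1 (i := i)), (C_sub D i)].
  - intros x y (c & Hc & ->) (d & Hd & ->). exists (c ** d). split; [now apply C_sub|].
    symmetry. now apply (epsM D (i := i)).
  - intros x (c & Hc & ->). exists (ginv c). split; [now apply C_sub|].
    symmetry. now apply (epsV (i := i)).
Qed.

(** Elements split as a coset representative ([sH], [sB]) times a part in C_i ([kH], [kB]); [kB] is
    pulled back to [H] along [eps]. *)
Definition sH i u := coset_rep (inC i) u.
Definition kH i u := ginv (sH i u) ** u.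
Definition sB i b := coset_rep (inepsC i) b.
Definition kB i b : H := epsilon (inhabits gone) (fun c => inC i c /\ ginv (sB i b) ** b = eps c).

Lemma kH_in i u : inC i (kH i u).
Proof. exact (coset_rep_spec (C_sub D i) u). Qed.

Lemma sH_mul i u c : inC i c -> sH i (u ** c) = sH i u.
Proof. exact (coset_rep_mul (C_sub D i) u (c := c)). Qed.

Lemma kH_mul i u c : inC i c -> kH i (u ** c) = kH i u ** c.
Proof. intros Hc. unfold kH. rewrite sH_mul by trivial. apply gmulA. Qed.

Lemma skH i u : u = sH i u ** kH i u.
Proof. unfold kH. now gsimp. Qed.

Lemma sH_in i c : inC i c -> sH i c = gone.
Proof. apply coset_rep_in. Qed.

Lemma kH_inC i c : inC i c -> kH i c = c.
Proof. intros Hc. unfold kH. rewrite sH_in by trivial. now gsimp. Qed.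

Lemma kH_rep i u : sH i u = u -> kH i u = gone.
Proof. intros e. unfold kH. now rewrite e, gmulV. Qed.

Lemma kB_spec i b : inC i (kB i b) /\ ginv (sB i b) ** b = eps (kB i b).
Proof.
  apply (@epsilon_spec _ (inhabits gone) (fun c => inC i c /\ ginv (sB i b) ** b = eps c)).
  exact (coset_rep_spec (inepsC_sub i) b).
Qed.

Lemma kB_in i b : inC i (kB i b). Proof. apply kB_spec. Qed.

Lemma skB i b : b = sB i b ** eps (kB i b).
Proof. rewrite <- (proj2 (kB_spec i b)). now gsimp. Qed.

Lemma sB_mul i b c : inC i c -> sB i (b ** eps c) = sB i b.
Proof. intros Hc. apply (coset_rep_mul (inepsC_sub i)). now exists c. Qed.

Lemma kB_mul i b c : inC i c -> kB i (b ** eps c) = kB i b ** c.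
Proof.
  intros Hc. apply (@eps_inj i); [apply kB_in|apply C_sub; trivial; apply kB_in|].
  rewrite (epsM D (i := i)) by (trivial; apply kB_in).
  apply (@gcancel_l BB (sB i b)). rewrite gmulA, <- skB.
  rewrite <- (sB_mul b Hc). now rewrite <- skB.
Qed.

Lemma sB_eps i c : inC i c -> sB i (eps c) = gone.
Proof. intros Hc. apply coset_rep_in. now exists c. Qed.

Lemma kB_eps i c : inC i c -> kB i (eps c) = c.
Proof.
  intros Hc. apply (@eps_inj i); [apply kB_in|trivial|].
  rewrite (skB i (eps c)) at 2. rewrite sB_eps by trivial. now gsimp.
Qed.

Lemma sB_idem i b : sB i (sB i b) = sB i b.
Proof. apply (coset_rep_idem (inepsC_sub i)). Qed.

Lemma kB_rep i b : sB i b = b -> kB i b = gone.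
Proof.
  intros e. apply (eps_ker D (kB_in i b)). apply (@gcancel_l BB (sB i b)).
  rewrite <- skB, e. now gsimp.
Qed.

Lemma sB_in i b : inB i b -> inB i (sB i b).
Proof.
  intros Hb. apply (subMr (c := eps (kB i b)) _ (B_sub D i)).
  - apply (eps_in D), kB_in.
  - now rewrite <- skB.
Qed.

End Amalgam.

(** * Normal forms and the Bass-Serre tree *)

Section BassSerre.
Context (H BB : Group) (I : Type).
Context (inC : I -> H -> Prop) (inB : I -> BB -> Prop) (eps : H -> BB).
Context (D : amalgam_data inC inB eps).
Notation Am := (amalgam D).
Notation jH := (jH D).
Notation jB := (jB D).
Notation sH := (sH inC).
Notation kH := (kH inC).
Notation sB := (sB inC eps).
Notation kB := (kB inC eps).

(* The normal form u_1 b_1 ... u_k b_k h is encoded as ([(i_1,u_1,b_1); ...], h), where u_j and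
   b_j are representatives of cosets of C_{i_j}. *)
Definition nf : Type := (list (I * H * BB) * H)%type.

(** The product [h ** u] becomes its representative; the remainder in C_i commutes with [b], since
    B_i is abelian, and passes to the next syllable. *)
Fixpoint actH_list (h : H) (w : list (I * H * BB)) (k : H) : nf :=
  match w with
  | nil => (nil, h ** k)
  | (i, u, b) :: w => let r := actH_list (kH i (h ** u)) w k in
                      ((i, sH i (h ** u), b) :: fst r, snd r)
  end.
Definition actH (h : H) (z : nf) : nf := actH_list h (fst z) (snd z).

(** The leading factor in B_i is visible exactly when the first syllable has index [i] and trivial
    representative [u]; [put] is the converse operation. *)
Definition strip (i : I) (z : nf) : BB * nf :=
  match fst z with
  | (i', u, b) :: w =>
      if excluded_middle_informative (i' = i /\ u = gone) then (b, (w, snd z)) else (gone, z)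
  | nil => (gone, z)
  end.

Definition put (i : I) (b : BB) (z : nf) : nf :=
  let r := actH (kB i b) z in
  if excluded_middle_informative (sB i b = gone) then r
  else ((i, gone, sB i b) :: fst r, snd r).

Definition actB (i : I) (b : BB) (z : nf) : nf := put i (b ** fst (strip i z)) (snd (strip i z)).

Definition nostart (i : I) (w : list (I * H * BB)) : Prop :=
  match w with (i', u, _) :: _ => ~ (i' = i /\ u = gone) | nil => True end.

Fixpoint wf (w : list (I * H * BB)) : Prop :=
  match w with
  | nil => True
  | (i, u, b) :: w =>
      sH i u = u /\ sB i b = b /\ b <> gone /\ inB i b /\ nostart i w /\ wf w
  end.

Lemma actH_mul h h' z : actH (h ** h') z = actH h (actH h' z).
Proof.
  destruct z as [w k]. unfold actH. cbn [fst snd]. revert h h'.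
  induction w as [|[[i u] b] w IH]; intros h h'; cbn.
  - now gsimp.
  - assert (E : h ** h' ** u = h ** sH i (h' ** u) ** kH i (h' ** u)).
    { rewrite gmulA_r, (skH inC i (h' ** u)) at 1. apply gmulA. }
    pose proof (kH_in D i (h' ** u)) as Hk.
    rewrite E, (kH_mul D _ Hk), (sH_mul D _ Hk). now rewrite IH.
Qed.

Lemma actH_one z : wf (fst z) -> actH gone z = z.
Proof.
  destruct z as [w k]. unfold actH. cbn [fst snd].
  induction w as [|[[i u] b] w IH]; cbn; intros Hw.
  - now gsimp.
  - destruct Hw as (Hu & _ & _ & _ & _ & Hw). rewrite gmul1, Hu.
    rewrite (kH_rep Hu). now rewrite IH.
Qed.

Lemma actH_length h z : length (fst (actH h z)) = length (fst z).
Proof.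
  destruct z as [w k]. unfold actH. cbn [fst snd]. revert h.
  induction w as [|[[i u] b] w IH]; intros h; cbn; congruence.
Qed.

Lemma actH_nostart i c z : inC i c -> wf (fst z) -> nostart i (fst z) ->
  nostart i (fst (actH c z)).
Proof.
  destruct z as [[|[[i' u] b] w] k]; cbn; trivial. intros Hc (Hu & _) N [-> e].
  apply N. split; trivial. rewrite <- Hu. apply (sH_in (i := i)).
  apply (coset_rep_1 (C_sub D i)) in e. exact (proj1 (subMl _ (C_sub D i) Hc) e).
Qed.

Lemma actH_wf h z : wf (fst z) -> wf (fst (actH h z)).
Proof.
  destruct z as [w k]. unfold actH. cbn [fst snd]. revert h.
  induction w as [|[[i u] b] w IH]; intros h; cbn; trivial.
  intros (Hu & Hb & Nb & Bb & Ns & Hw). repeat split; trivial.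
  - apply (coset_rep_idem (C_sub D i)).
  - apply (actH_nostart (z := (w, k))); trivial. apply (kH_in D).
  - now apply IH.
Qed.

Lemma strip_nostart i z : nostart i (fst z) -> strip i z = (gone, z).
Proof.
  destruct z as [[|[[i' u] b] w] k]; cbn; trivial. intros N.
  unfold strip. cbn. now destruct excluded_middle_informative.
Qed.

Lemma strip_put i b z : wf (fst z) -> nostart i (fst z) ->
  strip i (put i b z) = (sB i b, actH (kB i b) z).
Proof.
  intros Hw N. unfold put. destruct excluded_middle_informative as [e|e].
  - rewrite e. apply strip_nostart. apply actH_nostart; trivial. apply (kB_in D).
  - unfold strip. cbn. destruct excluded_middle_informative as [_|F]; [|now destruct F].
    now destruct (actH (kB i b) z).
Qed.

Lemma strip_spec i z : wf (fst z) ->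
  wf (fst (snd (strip i z))) /\ nostart i (fst (snd (strip i z))) /\ inB i (fst (strip i z)) /\
  put i (fst (strip i z)) (snd (strip i z)) = z.
Proof.
  intros Hw.
  assert (B1 : nostart i (fst z) ->
    wf (fst z) /\ nostart i (fst z) /\ inB i gone /\ put i gone z = z).
  { intros N. repeat split; trivial; [apply (B_sub D i)|]. unfold put.
    assert (e1 : gone = eps gone) by (symmetry; apply (eps1 D (i := i)), (C_sub D i)).
    assert (C1 : inC i gone) by apply (C_sub D i).
    assert (s1 : sB i gone = gone) by (rewrite e1 at 1; now apply sB_eps).
    assert (k1 : kB i gone = gone) by (rewrite e1; now apply (kB_eps D)).
    rewrite s1, k1. destruct excluded_middle_informative; [|easy]. now apply actH_one. }
  destruct z as [[|[[i' u] b] w] k]; [now apply B1|].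
  unfold strip. cbn [fst snd]. destruct excluded_middle_informative as [[-> ->]|N].
  - destruct Hw as (Hu & Hb & Nb & Bb & Ns & Hw). repeat split; trivial. cbn.
    unfold put. rewrite Hb, (kB_rep D) by trivial. rewrite actH_one by trivial.
    now destruct excluded_middle_informative.
  - apply B1; trivial.
Qed.

Lemma put_eps i b c z : inC i c -> put i (b ** eps c) z = put i b (actH c z).
Proof.
  intros Hc. unfold put. rewrite (sB_mul D), (kB_mul D) by trivial. now rewrite actH_mul.
Qed.

Lemma actH_put i b c z : inC i c -> actH c (put i b z) = put i b (actH c z).
Proof.
  intros Hc. pose proof (kB_in D i b) as Hk.
  unfold put. rewrite <- actH_mul, <- (C_comm D Hc Hk), actH_mul.
  destruct excluded_middle_informative as [e|e]; trivial.
  unfold actH at 1. cbn. rewrite gmul1r, (kH_inC Hc), (sH_in Hc). reflexivity.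
Qed.

Lemma put_wf i b z : inB i b -> wf (fst z) -> nostart i (fst z) -> wf (fst (put i b z)).
Proof.
  intros Hb Hw N. unfold put. pose proof (actH_wf (kB i b) Hw).
  destruct excluded_middle_informative as [e|e]; trivial. cbn. repeat split; trivial.
  - apply sH_in, (C_sub D i).
  - apply (sB_idem D).
  - now apply (sB_in D).
  - apply actH_nostart; trivial. apply (kB_in D).
Qed.

Lemma actB_wf i b z : inB i b -> wf (fst z) -> wf (fst (actB i b z)).
Proof.
  intros Hb Hw. destruct (strip_spec i Hw) as (A1 & A2 & A3 & _).
  apply put_wf; trivial. now apply (B_sub D i).
Qed.

Lemma actB_mul i b b' z : wf (fst z) -> actB i (b ** b') z = actB i b (actB i b' z).
Proof.
  intros Hw. destruct (strip_spec i Hw) as (A1 & A2 & A3 & _).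
  unfold actB at 2 3. set (b0 := fst (strip i z)) in *. set (z0 := snd (strip i z)) in *.
  unfold actB. rewrite strip_put by trivial. cbn [fst snd].
  rewrite <- put_eps by apply (kB_in D). f_equal.
  now rewrite !gmulA_r, <- (skB D).
Qed.

Lemma actB_one i z : wf (fst z) -> actB i gone z = z.
Proof.
  intros Hw. unfold actB. rewrite gmul1. now apply strip_spec.
Qed.

(** Commutativity of B_i carries [eps c] past the leading factor, to where [H] acts. *)
Lemma actB_eps i c z : inC i c -> wf (fst z) -> actB i (eps c) z = actH c z.
Proof.
  intros Hc Hw. destruct (strip_spec i Hw) as (A1 & A2 & A3 & A4).
  unfold actB. rewrite (B_comm D (eps_in D Hc) A3), put_eps, <- actH_put by trivial.
  now rewrite A4.
Qed.

(** Ill-formed normal forms are left fixed, so that the action laws hold on the whole type. *)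
Definition on_wf (f : nf -> nf) (z : nf) : nf :=
  if excluded_middle_informative (wf (fst z)) then f z else z.

Lemma on_wf_in f z : wf (fst z) -> on_wf f z = f z.
Proof. intros Hw. unfold on_wf. now destruct excluded_middle_informative. Qed.

(** Van der Waerden's method: an action on normal forms tells elements apart without any confluence
    argument. *)
Lemma nf_action : exists a : Am -> nf -> nf,
  (forall z, a gone z = z) /\ (forall e e' z, a (e ** e') z = a e (a e' z)) /\
  (forall h z, wf (fst z) -> a (jH h) z = actH h z) /\
  (forall i b z, inB i b -> wf (fst z) -> a (jB i b) z = actB i b z).
Proof.
  destruct (@amalgam_act _ _ _ _ _ _ D nf (fun h => on_wf (actH h)) (fun i b => on_wf (actB i b)))
    as (a & A1 & AM & AH & AB).
  - intros z. unfold on_wf. destruct excluded_middle_informative; trivial. now apply actH_one.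
  - intros h h' z. unfold on_wf at 1 3. destruct excluded_middle_informative as [Hw|Hw].
    + rewrite on_wf_in by now apply actH_wf. apply actH_mul.
    + unfold on_wf. now destruct excluded_middle_informative.
  - intros i z. unfold on_wf. destruct excluded_middle_informative; trivial. now apply actB_one.
  - intros i b b' z Hb Hb'. unfold on_wf at 1 3. destruct excluded_middle_informative as [Hw|Hw].
    + rewrite on_wf_in by now apply actB_wf. now apply actB_mul.
    + unfold on_wf. now destruct excluded_middle_informative.
  - intros i c z Hc. unfold on_wf. destruct excluded_middle_informative; trivial. now apply actB_eps.
  - exists a. repeat split; trivial.
    + intros h z Hw. now rewrite AH, on_wf_in.
    + intros i b z Hb Hw. now rewrite AB, on_wf_in.
Qed.

Lemma put_outside i b z : sB i b <> gone -> exists w k, put i b z = ((i, gone, sB i b) :: w, k) /\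
  length w = length (fst z).
Proof.
  intros N. unfold put. destruct excluded_middle_informative; [easy|].
  eexists _, _. split; [reflexivity|]. apply actH_length.
Qed.

(** The image of the empty normal form under [jH h] displays [h]. *)
Lemma jH_inj h h' : jH h = jH h' -> h = h'.
Proof.
  apply (hom_injective (jH_hom D)). clear h h'. intros h e.
  destruct nf_action as (a & A1 & AM & AH & AB).
  pose proof (AH h (nil, gone) Logic.I) as K. rewrite e, A1 in K. cbn in K.
  gsimp_in K. congruence.
Qed.

Lemma sB_1 i b : sB i b = gone -> exists c, inC i c /\ b = eps c.
Proof. intros e. now apply (coset_rep_1 (inepsC_sub D i)) in e. Qed.

(** An element of B_i outside [eps] C_i adds a syllable to the empty normal form; an element of [H]
    does not. *)
Lemma jH_cap_jB i h b : inB i b -> jH h = jB i b -> inC i h /\ b = eps h.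
Proof.
  intros Hb e. destruct nf_action as (a & A1 & AM & AH & AB).
  destruct (classic (sB i b = gone)) as [s|N].
  - destruct (sB_1 s) as (c & Hc & ->). rewrite (jB_eps D Hc) in e.
    apply jH_inj in e. now subst.
  - exfalso. pose proof (AH h (nil, gone) Logic.I) as K.
    rewrite e, AB in K by (trivial; exact Logic.I). unfold actB in K. cbn in K. rewrite gmul1r in K.
    destruct (put_outside (nil, gone) N) as (w & k & P & _). rewrite P in K. discriminate.
Qed.

(** * The Bass-Serre tree *)

Definition vsub (k : option I) (e : Am) : Prop :=
  match k with
  | None => exists h, e = jH h
  | Some i => exists b, inB i b /\ e = jB i b
  end.

Lemma vsub_sub k : is_subgroup (vsub k).
Proof.
  destruct k as [i|]; split; cbn.
  - exists gone. split; [apply (B_sub D i)|]. now rewrite jB1.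
  - intros x y (b & Hb & ->) (b' & Hb' & ->). exists (b ** b').
    split; [now apply (B_sub D i)|]. now rewrite jBM.
  - intros x (b & Hb & ->). exists (ginv b). split; [now apply (B_sub D i)|]. now rewrite jBV.
  - exists gone. now rewrite (hom1 (jH_hom D)).
  - intros x y (h & ->) (h' & ->). exists (h ** h'). now rewrite (jH_hom D).
  - intros x (h & ->). exists (ginv h). now rewrite (homV (jH_hom D)).
Qed.

(* Vertices are cosets of [H] (kind [None]) and of the B_i (kind [Some i]). *)
Definition vrel (x y : option I * Am) : Prop :=
  fst x = fst y /\ vsub (fst x) (ginv (snd x) ** snd y).

Lemma vrel_refl x : vrel x x.
Proof. split; trivial. rewrite gmulV. apply vsub_sub. Qed.

Lemma vrel_sym x y : vrel x y -> vrel y x.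
Proof.
  intros [e K]. split; [easy|]. rewrite <- e. apply vsub_sub in K. now gsimp_in K.
Qed.

Lemma vrel_trans x y z : vrel x y -> vrel y z -> vrel x z.
Proof.
  intros [e K] [e' K']. split; [congruence|]. rewrite <- e in K'.
  pose proof (subM (vsub_sub (fst x)) K K') as M. now gsimp_in M.
Qed.

Definition bsv : Type := quot vrel.
Definition vtx (k : option I) (e : Am) : bsv := pr vrel (k, e).

Lemma vtx_eq k e k' e' : vtx k e = vtx k' e' <-> k = k' /\ vsub k (ginv e ** e').
Proof. apply (pr_eq vrel_refl vrel_sym vrel_trans). Qed.

Lemma vtx_surj v : exists k e, v = vtx k e.
Proof. exists (fst (repr v)), (snd (repr v)). rewrite <- (pr_repr v) at 1. now destruct (repr v). Qed.

Lemma vtxM k e x : vsub k x -> vtx k (e ** x) = vtx k e.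
Proof. intros K. symmetry. apply vtx_eq. split; trivial. now gsimp. Qed.

Definition bs_act (x : Am) (v : bsv) : bsv := vtx (fst (repr v)) (x ** snd (repr v)).

Lemma bs_act_vtx x k e : bs_act x (vtx k e) = vtx k (x ** e).
Proof.
  destruct (repr_pr vrel_refl vrel_sym vrel_trans (k, e)) as [K1 K2].
  unfold bs_act. fold (vtx k e) in K1, K2. cbn in K1, K2.
  apply vtx_eq. split; trivial. gsimp. exact K2.
Qed.

Definition bs_adj (v w : bsv) : Prop :=
  exists i e, (v = vtx None e /\ w = vtx (Some i) e) \/ (w = vtx None e /\ v = vtx (Some i) e).

Definition bs_isB (v : bsv) : Prop := exists i e, v = vtx (Some i) e.

Lemma bs_adj_None e w : bs_adj (vtx None e) w -> exists i h, w = vtx (Some i) (e ** jH h).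
Proof.
  intros (i & e' & [[K ->]|[-> K]]); apply vtx_eq in K as [E K]; [|easy].
  destruct K as [h K]. exists i, h. now rewrite <- K, gmulKV.
Qed.

Lemma bs_adj_Some i e w : bs_adj (vtx (Some i) e) w ->
  exists b, inB i b /\ w = vtx None (e ** jB i b).
Proof.
  intros (i' & e' & [[K ->]|[-> K]]); apply vtx_eq in K as [E K]; [easy|].
  destruct K as (b & Hb & K). exists b. split; trivial. now rewrite <- K, gmulKV.
Qed.

Lemma bs_adj_sym v w : bs_adj v w -> bs_adj w v.
Proof. intros (i & e & [[-> ->]|[-> ->]]); exists i, e; auto. Qed.

Lemma bs_isB_None e : ~ bs_isB (vtx None e).
Proof. intros (i & e' & K). now apply vtx_eq in K as [K _]. Qed.

Lemma bs_isB_Some i e : bs_isB (vtx (Some i) e).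
Proof. now exists i, e. Qed.

Lemma bs_adj_isB v w : bs_adj v w -> (bs_isB v <-> ~ bs_isB w).
Proof.
  intros (i & e & [[-> ->]|[-> ->]]);
  pose proof (@bs_isB_None e); pose proof (@bs_isB_Some i e); tauto.
Qed.

Lemma bs_act_one v : bs_act gone v = v.
Proof. destruct (vtx_surj v) as (k & e & ->). now rewrite bs_act_vtx, gmul1. Qed.

Lemma bs_act_mul x y v : bs_act (x ** y) v = bs_act x (bs_act y v).
Proof. destruct (vtx_surj v) as (k & e & ->). now rewrite !bs_act_vtx, gmulA. Qed.

Lemma bs_act_adj x v w : bs_adj v w -> bs_adj (bs_act x v) (bs_act x w).
Proof.
  intros (i & e & [[-> ->]|[-> ->]]); exists i, (x ** e); rewrite !bs_act_vtx; auto.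
Qed.

Lemma bs_act_inj x v w : bs_act x v = bs_act x w -> v = w.
Proof.
  intros e. rewrite <- (bs_act_one v), <- (bs_act_one w), <- (gmulV x), !bs_act_mul.
  now rewrite e.
Qed.

Lemma bs_act_isB x v : bs_isB (bs_act x v) <-> bs_isB v.
Proof.
  destruct (vtx_surj v) as ([i|] & e & ->); rewrite bs_act_vtx.
  - split; intros _; apply bs_isB_Some.
  - pose proof (@bs_isB_None e). pose proof (@bs_isB_None (x ** e)). tauto.
Qed.

Lemma bs_stab x k e : bs_act x (vtx k e) = vtx k e <-> vsub k (gconj (ginv e) x).
Proof.
  rewrite bs_act_vtx. unfold gconj. rewrite ginvK. split; intros K.
  - symmetry in K. apply vtx_eq in K as [_ K]. now gsimp; gsimp_in K.
  - symmetry. apply vtx_eq. split; trivial. now gsimp; gsimp_in K.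
Qed.

(* A reduced path ending at the base vertex spells, read backwards, a normal form with one
   syllable per visited coset of the B_i. *)
Lemma bs_path_nf (a : Am -> nf -> nf) :
  (forall z, a gone z = z) -> (forall e e' z, a (e ** e') z = a e (a e' z)) ->
  (forall h z, wf (fst z) -> a (jH h) z = actH h z) ->
  (forall i b z, inB i b -> wf (fst z) -> a (jB i b) z = actB i b z) ->
  forall m p e, geod bs_adj p (2 * m) -> p 0 = vtx None e -> p (2 * m) = vtx None gone ->
  let w := fst (a (ginv e) (nil, gone)) in
  wf w /\ length w = m /\
  (forall i h, 1 <= m -> p 1 = vtx (Some i) (e ** jH h) -> exists b w', w = (i, sH i h, b) :: w').
Proof.
  intros A1 AM AH AB. induction m as [|m IH]; intros p e G P0 P1 w.
  - change (2 * 0) with 0 in P1. rewrite P0 in P1. apply vtx_eq in P1 as [_ [h K]]. rewrite gmul1r in K.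
    subst w. rewrite K, AH by exact Logic.I. repeat split; trivial. lia.
  - destruct G as [GA GR].
    pose proof (GA 0 ltac:(lia)) as Ad0. rewrite P0 in Ad0.
    apply bs_adj_None in Ad0 as (i & h & E1).
    pose proof (GA 1 ltac:(lia)) as Ad1. rewrite E1 in Ad1.
    apply bs_adj_Some in Ad1 as (b & Hb & E2).
    set (e' := e ** jH h ** jB i b) in *.
    destruct (IH (fun k => p (2 + k)) e') as (W & L & Hd); trivial.
    { split; intros k Lk.
      - replace (2 + S k) with (S (2 + k)) by lia. apply GA. lia.
      - replace (2 + S (S k)) with (S (S (2 + k))) by lia. apply GR. lia. }
    { rewrite <- P1. f_equal. lia. }
    set (z' := a (ginv e') (nil, gone)) in *.
    assert (Ez : a (ginv e) (nil, gone) = actH h (actB i b z')).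
    { rewrite <- AB, <- AH by (trivial; rewrite ?AB by trivial; now apply actB_wf).
      unfold z'. rewrite <- !AM. f_equal. unfold e'. now gsimp. }
    (* If the tail started in the same B_i, the path would backtrack: [p 1 = p 3]. *)
    assert (Ns : nostart i (fst z')).
    { destruct m as [|m].
      - destruct (fst z'); [exact Logic.I|discriminate].
      - pose proof (GA 2 ltac:(lia)) as Ad2. rewrite E2 in Ad2.
        apply bs_adj_None in Ad2 as (i2 & h2 & E3).
        destruct (Hd i2 h2) as (b2 & w2 & Ew); [lia|exact E3|].
        rewrite Ew. cbn. intros [-> s].
        apply (coset_rep_1 (C_sub D i)) in s. apply (GR 1); [lia|].
        rewrite E1, E3. unfold e'. symmetry. rewrite !gmulA_r, gmulA. apply vtxM.
        rewrite <- (jB_eps D s), <- jBM by (trivial; now apply (eps_in D)).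
        exists (b ** eps h2). split; trivial. apply (B_sub D i); trivial. now apply (eps_in D). }
    (* A [b] in the image of C_i would give [p 0 = p 2]. *)
    assert (Nb : sB i b <> gone).
    { intros s. destruct (sB_1 s) as (c & Hc & ->). apply (GR 0); [lia|].
      rewrite P0, E2. unfold e'. rewrite (jB_eps D Hc), gmulA_r, <- (jH_hom D).
      symmetry. apply vtxM. now exists (h ** c). }
    assert (EB : actB i b z' = put i b z').
    { unfold actB. rewrite strip_nostart by trivial. cbn. now rewrite gmul1r. }
    destruct (put_outside z' Nb) as (w0 & k0 & Ep & Lw).
    assert (Wp : wf (fst (put i b z'))) by (rewrite <- EB; now apply actB_wf).
    subst w. rewrite Ez, EB. repeat split.
    + now apply actH_wf.
    + rewrite actH_length, Ep. cbn. lia.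
    + intros i' h' _ E1'. rewrite E1 in E1'. apply vtx_eq in E1' as [ei K].
      injection ei as <-. destruct K as (b' & Hb' & K).
      replace (ginv (e ** jH h) ** (e ** jH h')) with (jH (ginv h ** h')) in K
        by (rewrite (jH_hom D), (homV (jH_hom D)); now gsimp).
      apply jH_cap_jB in K as [K _]; trivial.
      rewrite Ep. unfold actH. cbn. rewrite gmul1r.
      exists (sB i b). eexists. f_equal. f_equal. f_equal.
      replace h' with (h ** (ginv h ** h')) by now gsimp. now rewrite (sH_mul D).
Qed.

Lemma bs_parity p n : geod bs_adj p n -> forall k, k <= n ->
  (bs_isB (p k) <-> (if Nat.even k then bs_isB (p 0) else ~ bs_isB (p 0))).
Proof.
  intros [A _]. induction k as [|k IH]; intros L; [reflexivity|].
  pose proof (bs_adj_isB (A k ltac:(lia))). specialize (IH ltac:(lia)).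
  rewrite Nat.even_succ, <- Nat.negb_even. destruct (Nat.even k); cbn; tauto.
Qed.

(** Translated to the base vertex, a closed reduced path of length [2 * m] would spell a normal form
    of the identity with [m] syllables. *)
Lemma bs_no_closed_None p n : geod bs_adj p n -> ~ bs_isB (p 0) -> p 0 = p n -> n = 0.
Proof.
  intros G N E. pose proof (bs_parity G (le_n n)) as Pn. rewrite <- E in Pn.
  destruct (Nat.even n) eqn:Ev; [|tauto].
  apply Nat.even_spec in Ev as [m ->].
  destruct (vtx_surj (p 0)) as ([i|] & e & P0); [exfalso; apply N; rewrite P0; apply bs_isB_Some|].
  destruct nf_action as (a & A1 & AM & AH & AB).
  destruct (bs_path_nf A1 AM AH AB (m := m) (p := fun k => bs_act (ginv e) (p k)) (e := gone))
    as (_ & L & _).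
  - destruct G as [GA GR]. split; intros k Lk.
    + apply bs_act_adj. auto.
    + intros K. apply bs_act_inj in K. now apply (GR k).
  - cbn beta. now rewrite P0, bs_act_vtx, gmulV.
  - cbn beta. now rewrite <- E, P0, bs_act_vtx, gmulV.
  - rewrite ginv1, A1 in L. cbn in L. lia.
Qed.

(** To start at a coset of [H], move the base point by one edge: trim both ends if they agree,
    otherwise rotate the path. *)
Lemma bs_no_closed p n : geod bs_adj p n -> p 0 = p n -> n = 0.
Proof.
  intros G E. destruct (classic (bs_isB (p 0))) as [B|N]; [|now apply (bs_no_closed_None G)].
  destruct (Nat.eq_dec n 0) as [|Nn]; trivial. exfalso.
  pose proof (bs_parity G (le_n n)) as Pn. rewrite <- E in Pn.
  destruct (Nat.even n) eqn:Ev; [|tauto].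
  apply Nat.even_spec in Ev as [m Em].
  pose proof (bs_parity G (k := 1) ltac:(lia)) as Pb. cbn in Pb.
  destruct G as [GA GR].
  destruct (classic (p 1 = p (n - 1))) as [E'|E'].
  - assert (n - 2 = 0).
    { apply (@bs_no_closed_None (fun k => p (1 + k))).
      - split; intros k Lk.
        + apply GA. lia.
        + apply (GR (S k)). lia.
      - tauto.
      - cbn. rewrite E'. f_equal. lia. }
    apply (GR 0); [lia|]. rewrite E. f_equal. lia.
  - enough (n = 0) by easy.
    apply (@bs_no_closed_None (fun k => if k <? n then p (S k) else p 1)).
    + split; intros k Lk.
      * rewrite (proj2 (Nat.ltb_lt k n)) by lia.
        destruct (Nat.ltb_spec (S k) n); [apply GA; lia|].
        replace (S k) with n by lia. rewrite <- E. apply GA. lia.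
      * rewrite (proj2 (Nat.ltb_lt k n)) by lia.
        destruct (Nat.ltb_spec (S (S k)) n); [apply GR; lia|].
        replace (S k) with (n - 1) by lia. auto.
    + rewrite (proj2 (Nat.ltb_lt 0 n)) by lia. tauto.
    + rewrite Nat.ltb_irrefl, (proj2 (Nat.ltb_lt 0 n)) by lia. reflexivity.
Qed.

Inductive reach (v : bsv) : bsv -> Prop :=
| reach_refl : reach v v
| reach_step w w' : reach v w -> bs_adj w w' -> reach v w'.

Lemma reach_trans u v w : reach u v -> reach v w -> reach u w.
Proof. intros R1 R2. induction R2; trivial. now apply (reach_step (w := w)). Qed.

Lemma reach_sym v w : reach v w -> reach w v.
Proof.
  induction 1 as [|w w' _ IH A]; [constructor|].
  apply (reach_trans (v := w)); trivial.
  apply (reach_step (w := w')); [constructor|now apply bs_adj_sym].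
Qed.

Lemma reach_act x v w : reach v w -> reach (bs_act x v) (bs_act x w).
Proof.
  induction 1 as [|w w' _ IH A]; [constructor|].
  apply (reach_step (w := bs_act x w)); trivial. now apply bs_act_adj.
Qed.

Lemma bs_adj_vtx i e : bs_adj (vtx None e) (vtx (Some i) e).
Proof. exists i, e. auto. Qed.

(** Letters of [H] fix the base vertex, and a letter of B_i moves it across the vertex B_i;
    translating by the letters of a word connects everything. *)
Lemma reach_base v : reach (vtx None gone) v.
Proof.
  assert (K : forall e, reach (vtx None gone) (vtx None e)).
  { apply (amalgam_ind (D := D)); [constructor| |].
    - intros h e IH. apply (reach_act (jH h)) in IH. rewrite !bs_act_vtx, gmul1r in IH.
      rewrite <- (gmul1 (jH h)), (vtxM (k := None) gone) in IH by now exists h.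
      now rewrite gmul1 in IH.
    - intros i b e Hb IH. apply (reach_act (jB i b)) in IH. rewrite !bs_act_vtx, gmul1r in IH.
      apply (reach_trans (v := vtx None (jB i b))); trivial.
      apply (reach_step (w := vtx (Some i) (jB i b))).
      + apply (reach_step (w := vtx None gone)); [constructor|].
        rewrite <- (gmul1 (jB i b)), (vtxM (k := Some i)) by now exists b. apply bs_adj_vtx.
      + apply bs_adj_sym, bs_adj_vtx. }
  destruct (vtx_surj v) as ([i|] & e & ->); trivial.
  apply (reach_step (w := vtx None e)); trivial. apply bs_adj_vtx.
Qed.

Lemma reach_geod v w : reach v w -> exists p n, geod bs_adj p n /\ p 0 = v /\ p n = w.
Proof.
  induction 1 as [|w w' _ (p & n & [A R] & P0 & P1) Ad].
  - exists (fun _ => v), 0. repeat split; intros; lia.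
  - destruct (classic (1 <= n /\ p (n - 1) = w')) as [[L e]|N].
    + exists p, (n - 1). repeat split; trivial; intros k Lk; [apply A|apply R]; lia.
    + exists (fun k => if k <=? n then p k else w'), (S n). repeat split.
      * intros k Lk. rewrite (proj2 (Nat.leb_le k n)) by lia.
        destruct (Nat.leb_spec (S k) n); [apply A; lia|].
        replace k with n by lia. now rewrite P1.
      * intros k Lk. rewrite (proj2 (Nat.leb_le k n)) by lia.
        destruct (Nat.leb_spec (S (S k)) n); [apply R; lia|].
        intros e. apply N. split; [lia|]. now replace (n - 1) with k by lia.
      * exact P0.
      * now rewrite (proj2 (Nat.leb_gt (S n) n)) by lia.
Qed.

Lemma bs_geod_exists v w : exists p n, geod bs_adj p n /\ p 0 = v /\ p n = w.
Proof.
  apply reach_geod, (reach_trans (v := vtx None gone)); [apply reach_sym|]; apply reach_base.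
Qed.

(** * Fixed vertices, when each nontrivial element lies in just one conjugate of one C_i *)

Context (cover : forall h : H, h <> gone -> exists i f, inC i (gconj (ginv f) h)).
Context (malnormal : forall i j (x f : H), x <> gone -> inC i x -> inC j (gconj f x) ->
  i = j /\ inC i f).
Context (BB_tf : torsion_free BB).

Lemma bs_fixB x v : x <> gone -> bs_act x v = v -> exists w, bs_isB w /\ bs_act x w = w.
Proof.
  intros Nx F. destruct (vtx_surj v) as ([i|] & e & ->).
  - exists (vtx (Some i) e). split; trivial. apply bs_isB_Some.
  - apply bs_stab in F as [h K].
    destruct (@cover h) as (i & f & Hc).
    { intros ->. apply Nx. rewrite (hom1 (jH_hom D)) in K. now apply conj_eq1 in K. }
    exists (vtx (Some i) (e ** jH f)). split; [apply bs_isB_Some|].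
    apply bs_stab. exists (eps (gconj (ginv f) h)). split; [now apply (eps_in D)|].
    rewrite (jB_eps D Hc), (hom_conj (jH_hom D)), (homV (jH_hom D)), <- K, conj_conj.
    now rewrite ginvM.
Qed.

(** Seen from [u], a coset of [H], the fixed neighbours [v] and [w] are conjugates of C_i and C_j
    with a common nontrivial element; [malnormal] identifies them. *)
Lemma bs_fixB_local x v u w : x <> gone -> bs_isB v -> bs_adj v u -> bs_adj u w ->
  bs_act x v = v -> bs_act x u = u -> bs_act x w = w -> v = w.
Proof.
  intros Nx (i0 & e0 & ->) A1 A2 Fv Fu Fw.
  destruct (bs_adj_Some A1) as (b0 & Hb0 & ->).
  set (e := e0 ** jB i0 b0) in *.
  destruct (bs_adj_None (bs_adj_sym A1)) as (i & f & Ev).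
  destruct (bs_adj_None A2) as (j & g & Ew).
  rewrite Ev in *. rewrite Ew in *. clear Ev Ew A1 A2.
  apply bs_stab in Fu as [h K].
  assert (R : forall k f, bs_act x (vtx (Some k) (e ** jH f)) = vtx (Some k) (e ** jH f) ->
     inC k (gconj (ginv f) h)).
  { intros k f' F. apply bs_stab in F as (b & Hb & F).
    rewrite ginvM, <- conj_conj, K, <- (homV (jH_hom D)), <- (hom_conj (jH_hom D)) in F.
    now apply jH_cap_jB in F. }
  apply R in Fv. apply R in Fw.
  destruct (@malnormal i j (gconj (ginv f) h) (ginv g ** f)) as [<- M]; trivial.
  { intros E. apply conj_eq1 in E. subst h. apply Nx.
    rewrite (hom1 (jH_hom D)) in K. now apply conj_eq1 in K. }
  { rewrite conj_conj. now gsimp. }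
  symmetry. apply vtx_eq. split; trivial.
  exists (eps (ginv g ** f)). split; [now apply (eps_in D)|].
  rewrite (jB_eps D M), (jH_hom D), (homV (jH_hom D)). now gsimp.
Qed.

Lemma bs_stabB_comm x y v : bs_isB v -> bs_act x v = v -> bs_act y v = v -> comm x y.
Proof.
  intros (i & e & ->) Fx Fy.
  apply bs_stab in Fx as (b & Hb & Kx). apply bs_stab in Fy as (b' & Hb' & Ky).
  rewrite <- (conjK (ginv e) x), <- (conjK (ginv e) y), Kx, Ky.
  apply conj_comm. unfold comm. rewrite <- !jBM by trivial. f_equal. now apply (B_comm D (i := i)).
Qed.

Lemma jB_gpow i b n : inB i b -> inB i (gpow b n) /\ gpow (jB i b) n = jB i (gpow b n).
Proof.
  intros Hb. induction n as [|n [IH1 IH2]].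
  - split; [apply (B_sub D i)|]. symmetry. apply jB1.
  - split; [now apply (B_sub D i)|]. now rewrite !gpowS, IH2, jBM.
Qed.

Lemma jB_ker i b : inB i b -> jB i b = gone -> b = gone.
Proof.
  intros Hb E. rewrite <- (hom1 (jH_hom D)) in E. symmetry in E.
  apply jH_cap_jB in E as [E1 ->]; trivial. now apply (eps1 D (i := i)).
Qed.

Lemma bs_stabB_torsion_free x v n : bs_isB v -> bs_act x v = v -> 1 <= n ->
  gpow x n = gone -> x = gone.
Proof.
  intros (i & e & ->) F L E. apply bs_stab in F as (b & Hb & K).
  apply (@conj_eq1 _ (ginv e)). rewrite K.
  destruct (jB_gpow n Hb) as [Hn En]. rewrite <- K, gpow_conj, E in En.
  replace b with (gone (g := BB)); [apply jB1|]. symmetry.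
  apply (BB_tf L). apply (jB_ker Hn). rewrite <- En. unfold gconj. now gsimp.
Qed.

Definition bass_serre : tree_action Am.
Proof.
  exact {| vert := bsv; adj := bs_adj; isB := bs_isB; act := bs_act; base := vtx None gone;
    adj_sym := bs_adj_sym; adj_isB := bs_adj_isB; no_closed := bs_no_closed;
    geod_exists := bs_geod_exists; act_one := bs_act_one; act_mul := bs_act_mul;
    act_adj := bs_act_adj; act_isB := bs_act_isB; fixB := bs_fixB;
    fixB_local := bs_fixB_local; stabB_comm := bs_stabB_comm;
    stabB_torsion_free := bs_stabB_torsion_free |}.
Defined.

Lemma amalgam_elliptic x : x <> gone -> elliptic bass_serre x ->
  exists i b e, inB i b /\ b <> gone /\ x = gconj e (jB i b).
Proof.
  intros Nx [v F]. destruct (fixB Nx F) as (w & (i & e & ->) & F').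
  apply bs_stab in F' as (b & Hb & K). exists i, b, e. repeat split; trivial.
  - intros ->. apply Nx. rewrite jB1 in K. now apply conj_eq1 in K.
  - rewrite <- K, conj_conj. unfold gconj. now gsimp.
Qed.

Lemma amalgam_csa : csa Am.
Proof. exact (tree_csa bass_serre). Qed.

Lemma amalgam_torsion_free : torsion_free Am.
Proof. exact (tree_torsion_free bass_serre). Qed.
End BassSerre.

(** * Extending quasimorphisms *)

(* The defect is only controlled for the right factor [y] in a prescribed finite list, but by a
   constant independent of that list: unlike a genuine quasimorphism, this extends to root
   extensions by averaging over a finite set. *)
Definition qm_at (G : Group) (d : nat) (D : R) (g : G) : Prop :=
  forall L : list G, exists phi : G -> R,
    (forall x y, In y L -> Rabs (phi (x ** y) - phi x - phi y) <= D)%R /\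
    (forall N, INR N - D <= phi (gpow g (d * N)))%R.

Lemma qm_at_conj (G : Group) d D (f g : G) : qm_at d D g -> qm_at d D (gconj f g).
Proof.
  intros Q L. destruct (Q (map (gconj (ginv f)) L)) as (phi & H1 & H2).
  exists (fun x => phi (gconj (ginv f) x)). split.
  - intros x y Hy. rewrite conjM. apply H1. now apply in_map.
  - intros N. now rewrite gpow_conj, conjK.
Qed.

Lemma qm_at_root (G : Group) d D n (g : G) : qm_at d D (gpow g n) -> qm_at (n * d) D g.
Proof.
  intros Q L. destruct (Q L) as (phi & H1 & H2). exists phi. split; trivial.
  intros N. now rewrite <- Nat.mul_assoc, gpowM.
Qed.

Definition rsum (X : Type) (f : X -> R) (P : list X) : R := fold_right (fun x s => f x + s)%R 0%R P.

Lemma rsum_perm (X : Type) (f : X -> R) P P' : Permutation P P' -> rsum f P = rsum f P'.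
Proof. unfold rsum. induction 1; cbn; lra. Qed.

Lemma rsum_map (X Y : Type) (f : Y -> R) (s : X -> Y) P : rsum f (map s P) = rsum (fun x => f (s x)) P.
Proof. unfold rsum. induction P as [|x P IH]; cbn; congruence. Qed.

Lemma rsum_defect (X : Type) (f g h : X -> R) D P :
  (forall x, In x P -> Rabs (f x - g x - h x) <= D)%R ->
  (Rabs (rsum f P - rsum g P - rsum h P) <= D * INR (length P))%R.
Proof.
  induction P as [|x P IH]; intros K.
  - cbn. rewrite Rabs_pos_eq; lra.
  - cbn [rsum fold_right length]. fold (rsum f P) (rsum g P) (rsum h P).
    rewrite S_INR.
    replace (f x + rsum f P - (g x + rsum g P) - (h x + rsum h P))%R
      with ((f x - g x - h x) + (rsum f P - rsum g P - rsum h P))%R by ring.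
    eapply Rle_trans; [apply Rabs_triang|].
    specialize (IH (fun y Hy => K y (or_intror Hy))).
    specialize (K x (or_introl eq_refl)). lra.
Qed.

Lemma rsum_const (X : Type) c (P : list X) : rsum (fun _ => c) P = (c * INR (length P))%R.
Proof.
  induction P as [|x P IH]; [cbn; ring|].
  cbn [rsum fold_right length]. fold (rsum (fun _ : X => c) P). rewrite IH, S_INR. ring.
Qed.

Section Averaging.
Context (H BB : Group) (I : Type).
Context (inC : I -> H -> Prop) (inB : I -> BB -> Prop) (eps : H -> BB).
Context (D : amalgam_data inC inB eps).
Context (n : nat) (Hn : 1 <= n).
Context (exponent : forall i b, inB i b -> exists c, inC i c /\ gpow b n = eps c).
Notation Am := (amalgam D).
Notation jH := (jH D).
Notation jB := (jB D).
Notation sB := (sB inC eps).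
Notation kB := (kB inC eps).

(* A point chooses a coset of [eps] C_i in each B_i. *)
Definition point : Type := I -> BB.
Definition wfp (p : point) : Prop := forall i, inB i (p i) /\ sB i (p i) = p i.

Definition upd (p : point) (i : I) (b : BB) : point :=
  fun j => if excluded_middle_informative (j = i) then b else p j.

Lemma upd_eq p i b : upd p i b i = b.
Proof. unfold upd. now destruct excluded_middle_informative. Qed.

Lemma upd_neq p i j b : j <> i -> upd p i b j = p j.
Proof. intros N. unfold upd. now destruct excluded_middle_informative. Qed.

Lemma upd_upd p i b b' : upd (upd p i b) i b' = upd p i b'.
Proof. extensionality j. unfold upd. now destruct excluded_middle_informative. Qed.

Lemma upd_id p i : upd p i (p i) = p.
Proof. extensionality j. unfold upd. destruct excluded_middle_informative; congruence. Qed.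

Lemma upd_swap p i j b b' : i <> j -> upd (upd p i b) j b' = upd (upd p j b') i b.
Proof.
  intros N. extensionality k. unfold upd.
  do 2 destruct excluded_middle_informative; congruence.
Qed.

Definition shift (i : I) (b : BB) (p : point) : point := upd p i (sB i (b ** p i)).

Lemma shift_wf i b p : inB i b -> wfp p -> wfp (shift i b p).
Proof.
  intros Hb W j. unfold shift. destruct (classic (j = i)) as [->|N].
  - rewrite upd_eq. split; [|apply (sB_idem D)].
    apply (sB_in D). apply (B_sub D i); trivial. apply W.
  - rewrite upd_neq by trivial. apply W.
Qed.

Lemma sB_mul_rep i b b' : sB i (b ** sB i b') = sB i (b ** b').
Proof.
  rewrite (skB D i b') at 2. rewrite gmulA. symmetry. apply (sB_mul D), (kB_in D).
Qed.

Lemma shift_mul i b b' p : shift i (b ** b') p = shift i b (shift i b' p).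
Proof. unfold shift. now rewrite upd_eq, upd_upd, sB_mul_rep, gmulA. Qed.

Lemma shift_eps i c p : inC i c -> wfp p -> shift i (eps c) p = p.
Proof.
  intros Hc W. unfold shift.
  rewrite (B_comm D (eps_in D Hc) (proj1 (W i))), (sB_mul D _ Hc), (proj2 (W i)).
  apply upd_id.
Qed.

(** Distinct coordinates are independent, and each B_i is abelian. Thanks to this, a list invariant
    under one shift stays so when made invariant under another. *)
Lemma shift_comm i b j b' p : inB i b -> inB j b' -> shift i b (shift j b' p) = shift j b' (shift i b p).
Proof.
  intros Hb Hb'. destruct (classic (i = j)) as [<-|N].
  - rewrite <- !shift_mul. f_equal. now apply (B_comm D (i := i)).
  - unfold shift. rewrite !upd_neq by congruence. apply upd_swap. congruence.
Qed.

(** A letter of B_i moves the point, and the C_i-part released by the new representative multiplies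
    the second coordinate. *)
Definition state : Type := (point * H)%type.
Definition state_actB (i : I) (b : BB) (z : state) : state :=
  if excluded_middle_informative (wfp (fst z))
  then (shift i b (fst z), kB i (b ** fst z i) ** snd z)
  else z.
Definition state_actH (h : H) (z : state) : state :=
  if excluded_middle_informative (wfp (fst z)) then (fst z, h ** snd z) else z.

(* [sigma] and [alpha] express a homomorphism from the amalgam to a wreath product of [H]:
   [sigma] is the action on points and [alpha] is a cocycle. *)
Lemma wreath : exists (sigma : Am -> point -> point) (alpha : Am -> point -> H),
  (forall e p, wfp p -> wfp (sigma e p)) /\
  (forall e e' p, wfp p -> sigma (e ** e') p = sigma e (sigma e' p)) /\
  (forall e e' p, wfp p -> alpha (e ** e') p = alpha e (sigma e' p) ** alpha e' p) /\
  (forall p, wfp p -> sigma gone p = p) /\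
  (forall h p, wfp p -> sigma (jH h) p = p /\ alpha (jH h) p = h) /\
  (forall i b p, inB i b -> wfp p -> sigma (jB i b) p = shift i b p).
Proof.
  destruct (@amalgam_act _ _ _ _ _ _ D state state_actH state_actB) as (a & A1 & AM & AH & AB).
  - intros [p k]. unfold state_actH. destruct excluded_middle_informative; trivial. cbn. now gsimp.
  - intros h h' [p k]. unfold state_actH. cbn.
    destruct (excluded_middle_informative (wfp p)) as [W|W]; cbn;
    destruct (excluded_middle_informative (wfp p)); try easy. now rewrite gmulA.
  - intros i [p k]. unfold state_actB. cbn. destruct excluded_middle_informative as [W|]; trivial.
    assert (C1 : inC i gone) by apply (C_sub D i).
    rewrite <- (eps1 D C1), shift_eps by trivial.
    rewrite (B_comm D (eps_in D C1) (proj1 (W i))), (kB_mul D _ C1), (kB_rep D) by apply W.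
    f_equal. now gsimp.
  - intros i b b' [p k] Hb Hb'. unfold state_actB at 1 3. cbn [fst snd].
    destruct excluded_middle_informative as [W|W].
    + unfold state_actB. cbn [fst snd]. pose proof (shift_wf Hb' W).
      destruct excluded_middle_informative; [|easy]. f_equal; [apply shift_mul|].
      unfold shift. rewrite upd_eq. rewrite gmulA. f_equal.
      rewrite <- (kB_mul D) by apply (kB_in D).
      f_equal. now rewrite !gmulA_r, <- (skB D).
    + unfold state_actB. cbn [fst snd]. now destruct excluded_middle_informative.
  - intros i c [p k] Hc. unfold state_actB, state_actH. cbn.
    destruct excluded_middle_informative as [W|]; trivial.
    rewrite shift_eps by trivial. f_equal. f_equal.
    rewrite (B_comm D (eps_in D Hc) (proj1 (W i))), (kB_mul D _ Hc), (kB_rep D) by apply W.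
    now gsimp.
  (* The action commutes with right multiplication on the second coordinate, so its values at [gone]
     define the cocycle. *)
  - assert (K : forall e p k, wfp p ->
       wfp (fst (a e (p, gone))) /\ a e (p, k) = (fst (a e (p, gone)), snd (a e (p, gone)) ** k)).
    { apply (amalgam_ind (D := D) (P := fun e => forall p k, wfp p ->
       wfp (fst (a e (p, gone))) /\ a e (p, k) = (fst (a e (p, gone)), snd (a e (p, gone)) ** k))).
      - intros p k W. rewrite !A1. cbn. split; trivial. now gsimp.
      - intros h e IH p k W. destruct (IH p k W) as [W' E].
        rewrite !AM, E. destruct (a e (p, gone)) as [p' k']. cbn in *.
        rewrite !AH. unfold state_actH. cbn. destruct excluded_middle_informative; [|easy].
        cbn. split; trivial. now rewrite gmulA.
      - intros i b e Hb IH p k W. destruct (IH p k W) as [W' E].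
        rewrite !AM, E. destruct (a e (p, gone)) as [p' k']. cbn in *.
        rewrite !AB by trivial. unfold state_actB. cbn. destruct excluded_middle_informative; [|easy].
        cbn. split; [now apply shift_wf|]. now rewrite gmulA. }
    exists (fun e p => fst (a e (p, gone))), (fun e p => snd (a e (p, gone))).
    refine (conj _ (conj _ (conj _ (conj _ (conj _ _))))).
    + intros e p W. now apply (K e p gone).
    + intros e e' p W. rewrite AM. destruct (K e' p gone W) as [W' _].
      destruct (a e' (p, gone)) as [p' k']. cbn in *. now rewrite (proj2 (K e p' k' W')).
    + intros e e' p W. rewrite AM. destruct (K e' p gone W) as [W' _].
      destruct (a e' (p, gone)) as [p' k']. cbn in *. now rewrite (proj2 (K e p' k' W')).
    + intros p W. now rewrite A1.
    + intros h p W. rewrite AH. unfold state_actH. cbn.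
      destruct excluded_middle_informative; [|easy]. cbn. split; trivial. now gsimp.
    + intros i b p Hb W. rewrite AB by trivial. unfold state_actB. cbn.
      now destruct excluded_middle_informative.
Qed.

Lemma base_point_wf : wfp (fun _ => gone).
Proof.
  intros i. split; [apply (B_sub D i)|]. apply coset_rep_in. apply (inepsC_sub D i).
Qed.

Lemma flat_map_shift (A : Type) (F : nat -> list A) m :
  Permutation (F m) (F 0) -> Permutation (flat_map F (seq 1 m)) (flat_map F (seq 0 m)).
Proof.
  intros E. apply (Permutation_app_inv_l (F 0)).
  change (F 0 ++ flat_map F (seq 1 m)) with (flat_map F (seq 0 (S m))).
  rewrite seq_S, flat_map_app. cbn. rewrite app_nil_r.
  rewrite Permutation_app_comm. now apply Permutation_app_tail.
Qed.

(** For a new letter [b], collect the shifts of [P] by its powers with exponents below [n]. The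
    [n]-th power lies in [eps] C_i and shifts trivially, so [b] rotates the blocks. Points may
    repeat, hence permutations of lists. *)
Lemma invariant_points (ls : list (I * BB)) : exists P : list point,
  P <> nil /\ (forall p, In p P -> wfp p) /\
  forall i b, In (i, b) ls -> inB i b -> Permutation (map (shift i b) P) P.
Proof.
  induction ls as [|[i b] ls (P & NP & WP & IH)].
  - exists ((fun _ => gone) :: nil). split; [easy|]. split; [|easy].
    intros p [<-|[]]. apply base_point_wf.
  - destruct (classic (inB i b)) as [Hb|Nb].
    2: { exists P. split; [|split]; trivial.
         intros i' b' [e|Hi] Hb'; [congruence|now apply IH]. }
    set (F := fun k => map (shift i (gpow b k)) P).
    assert (Bk : forall k, inB i (gpow b k)) by (intros; now apply (jB_gpow D)).
    exists (flat_map F (seq 0 n)). split; [|split].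
    + destruct n as [|n']; [lia|]. destruct P as [|p P]; [easy|]. discriminate.
    + intros p Hp. apply in_flat_map in Hp as (k & _ & Hk). apply in_map_iff in Hk as (q & <- & Hq).
      apply shift_wf; auto.
    + intros i' b' [e|Hi] Hb'.
      * injection e as <- <-.
        replace (map (shift i b) (flat_map F (seq 0 n))) with (flat_map F (seq 1 n)).
        -- apply flat_map_shift. unfold F.
           rewrite (map_ext_in (shift i (gpow b 0)) (shift i (gpow b n)));
             [reflexivity|].
           intros p Hp. destruct (exponent Hb) as (c & Hc & ->).
           rewrite shift_eps by auto. cbn [gpow].
           assert (C1 : inC i gone) by apply (C_sub D i).
           rewrite <- (eps1 D C1). apply shift_eps; auto.
        -- rewrite <- seq_shift. clear - D F. induction (seq 0 n) as [|k l IHl]; [reflexivity|].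
           cbn. rewrite map_app, IHl. f_equal. unfold F. rewrite map_map. apply map_ext.
           intros p. now rewrite <- shift_mul, <- gpowSl.
      * assert (IH' := IH i' b' Hi Hb'). clear IH.
        induction (seq 0 n) as [|k l IHl]; [reflexivity|].
        cbn. rewrite map_app. apply Permutation_app; trivial. unfold F.
        rewrite map_map.
        rewrite (map_ext_in _ (fun p => shift i (gpow b k) (shift i' b' p))).
        -- rewrite <- map_map. now apply Permutation_map.
        -- intros p _. now apply shift_comm.
Qed.

(** Average [phi (al x p)] over a finite list [P]. The cocycle law evaluates [x] at the points moved
    by [y], so only the right factor has to permute [P]: this is why [qm_at] constrains right
    factors only. On [H] the cocycle is constant, so lower bounds survive. *)
Theorem qm_at_extend d C (h : H) : qm_at d C h -> qm_at d C (jH h).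
Proof.
  intros Q L. destruct wreath as (sg & al & SW & SM & AM & S1 & SH & SB).
  (* An element is a product of finitely many letters, and a list invariant under these is invariant
     under the element. *)
  assert (Letters : forall e : Am, exists ls, forall P, (forall p, In p P -> wfp p) ->
    (forall i b, In (i, b) ls -> inB i b -> Permutation (map (shift i b) P) P) ->
    Permutation (map (sg e) P) P).
  { apply (amalgam_ind (D := D)).
    - exists nil. intros P W _. rewrite (map_ext_in _ (fun p => p)); [rewrite map_id; reflexivity|auto].
    - intros h' e (ls & K). exists ls. intros P W HP.
      rewrite (map_ext_in _ (sg e)); [now apply K|].
      intros p Hp. rewrite SM by auto. apply SH. auto.
    - intros i b e Hb (ls & K). exists ((i, b) :: ls). intros P W HP.
      rewrite (map_ext_in _ (fun p => shift i b (sg e p))).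
      + rewrite <- map_map. transitivity (map (shift i b) P).
        * apply Permutation_map. apply K; trivial. intros. apply HP; trivial. now right.
        * apply HP; trivial. now left.
      + intros p Hp. rewrite SM, SB; auto. }
  assert (Letters' : exists ls, forall e, In e L -> forall P, (forall p, In p P -> wfp p) ->
    (forall i b, In (i, b) ls -> inB i b -> Permutation (map (shift i b) P) P) ->
    Permutation (map (sg e) P) P).
  { clear Q. induction L as [|e L (ls & K)]; [now exists nil|].
    destruct (Letters e) as (ls' & K'). exists (ls' ++ ls).
    intros e' [<-|He] P W HP; [apply K'|apply (K e' He)]; trivial;
    intros; apply HP; trivial; apply in_or_app; auto. }
  destruct Letters' as (ls & K).
  destruct (invariant_points ls) as (P & NP & WP & HP).
  (* In [H], the right factors are the cocycle values of [L] at the points of [P]. *)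
  destruct (Q (flat_map (fun e => map (al e) P) L)) as (phi & F1 & F2).
  assert (Lp : (0 < INR (length P))%R).
  { apply lt_0_INR. destruct P; [easy|cbn; lia]. }
  exists (fun e => rsum (fun p => phi (al e p)) P / INR (length P))%R. split.
  - intros x y Hy.
    assert (Ex : rsum (fun p => phi (al x p)) P = rsum (fun p => phi (al x (sg y p))) P).
    { rewrite <- (rsum_perm _ (K y Hy P WP HP)). apply rsum_map. }
    rewrite Ex.
    assert (B := @rsum_defect _ (fun p => phi (al (x ** y) p)) (fun p => phi (al x (sg y p)))
      (fun p => phi (al y p)) C P).
    unfold Rdiv. rewrite <- Rmult_minus_distr_r, <- Rmult_minus_distr_r, Rabs_mult.
    rewrite (Rabs_pos_eq (/ INR (length P))) by (apply Rlt_le, Rinv_0_lt_compat, Lp).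
    apply (Rmult_le_reg_r (INR (length P))); trivial.
    rewrite Rmult_assoc, Rinv_l, Rmult_1_r by lra. apply B.
    intros p Hp. rewrite AM by auto. apply F1. apply in_flat_map. exists y. split; trivial.
    now apply in_map.
  - intros N. rewrite <- (hom_gpow (jH_hom D)).
    replace (rsum (fun p => phi (al (jH (gpow h (d * N))) p)) P)
      with (rsum (fun _ => phi (gpow h (d * N))) P).
    + rewrite rsum_const. unfold Rdiv. rewrite Rmult_assoc, Rinv_r, Rmult_1_r by lra. apply F2.
    + clear - WP SH. induction P as [|p P IH]; [reflexivity|]. cbn.
      f_equal; [|apply IH; intros; apply WP; now right].
      f_equal. symmetry. apply SH, WP. now left.
Qed.
End Averaging.

(** * Adjoining roots *)

Definition qm_positive (G : Group) (g : G) : Prop :=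
  exists d D, 1 <= d /\ qm_at d D g.

Section RootExtension.
Context (H : Group) (Hcsa : csa H) (Htf : torsion_free H) (n : nat) (Hn : 1 <= n).

(* Two nontrivial elements are related if their centralizers are conjugate. *)
Definition crel (c d : H) : Prop := exists f, comm (gconj f c) d.

Lemma conj_neq1 (f c : H) : c <> gone -> gconj f c <> gone.
Proof. intros N e. now apply conj_eq1 in e. Qed.

Lemma crel_sym c d : crel c d -> crel d c.
Proof.
  intros [f E]. exists (ginv f). apply (conj_comm (ginv f)) in E.
  rewrite conjK in E. now apply comm_sym.
Qed.

Lemma crel_trans c d e : c <> gone -> d <> gone -> crel c d -> crel d e -> crel c e.
Proof.
  intros Nc Nd [f E1] [g E2]. exists (g ** f). rewrite <- conj_conj.
  apply (conj_comm (g)) in E1.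
  apply (csa_trans (x := gconj g d)); trivial; try now apply conj_neq1.
  - now apply conj_neq1, conj_neq1.
  - now apply comm_sym.
Qed.

Definition crep (c : H) : H := epsilon (inhabits gone) (fun d => d <> gone /\ crel c d).

Lemma crep_spec c : c <> gone -> crep c <> gone /\ crel c (crep c).
Proof.
  intros N. unfold crep. apply epsilon_spec. exists c. split; trivial. exists gone.
  unfold gconj, comm. now gsimp.
Qed.

(** Related elements define the same predicate, hence the same choice. *)
Lemma crep_eq c d : c <> gone -> d <> gone -> crel c d -> crep c = crep d.
Proof.
  intros Nc Nd E. unfold crep. f_equal. extensionality e.
  apply propositional_extensionality. split; intros [Ne E']; split; trivial.
  - apply (@crel_trans d c e); trivial. now apply crel_sym.
  - now apply (@crel_trans c d e).
Qed.

(** One centralizer is kept per conjugacy class; its conjugates obtain their roots by conjugation in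
    the amalgam. *)
Definition cindex : Type := {c : H | c <> gone /\ crep c = c}.
Definition cent (i : cindex) (x : H) : Prop := comm (proj1_sig i) x.

Lemma cindex_eq (i j : cindex) : crel (proj1_sig i) (proj1_sig j) -> i = j.
Proof.
  destruct i as [c [Nc Ec]], j as [d [Nd Ed]]. cbn. intros E.
  apply subset_eq_compat. rewrite <- Ec, <- Ed. now apply crep_eq.
Qed.

Lemma cent_comm i x y : cent i x -> cent i y -> comm x y.
Proof.
  destruct i as [c [Nc Ec]]. unfold cent. cbn. intros Cx Cy.
  destruct (classic (x = gone)) as [->|Nx]; [apply comm_sym, comm1|].
  now apply (csa_trans (x := c)).
Qed.

(** Each C_i serves as its own B_i, entered by the [n]-th power map; torsion-freeness makes this map
    injective. *)
Lemma root_data : amalgam_data cent cent (fun x => gpow x n).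
Proof.
  assert (S : forall i, is_subgroup (cent i)).
  { intros [c Hc]. unfold cent. cbn. split; intros; [apply comm1|now apply commM|now apply commV]. }
  split; trivial.
  - apply cent_comm.
  - intros i c Hc. now apply comm_gpow.
  - intros i c d Hc Hd. apply gpow_mul. now apply (cent_comm (i := i)).
  - intros i c _ E. now apply (Htf Hn).
Qed.

Lemma root_cover (h : H) : h <> gone -> exists i f, cent i (gconj (ginv f) h).
Proof.
  intros N. destruct (crep_spec N) as [N' [f E]].
  assert (E' : crep (crep h) = crep h) by (symmetry; apply crep_eq; trivial; now exists f).
  exists (exist _ (crep h) (conj N' E')), (ginv f). unfold cent. cbn.
  rewrite ginvK. now apply comm_sym.
Qed.

(** Through [x] the two centralizers are conjugate, so their chosen indices agree; the CSA property
    then puts [f] in the centralizer. *)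
Lemma root_malnormal i j (x f : H) : x <> gone -> cent i x -> cent j (gconj f x) ->
  i = j /\ cent i f.
Proof.
  intros Nx Ci Cj.
  assert (E : i = j).
  { apply cindex_eq. exists f. apply comm_sym.
    destruct i as [c [Nc Ec]], j as [d [Nd Ed]]. unfold cent in *. cbn in *.
    apply (csa_trans (x := gconj f x)); trivial; [now apply conj_neq1|now apply comm_sym|].
    now apply conj_comm, comm_sym. }
  split; trivial. subst j. destruct i as [c [Nc Ec]]. unfold cent in *. cbn in *.
  now apply (Hcsa (y := x)).
Qed.

Definition root_ext : Group := amalgam root_data.
Definition root_inj : H -> root_ext := jH root_data.

Lemma root_ext_hom : is_group_hom root_inj. Proof. apply jH_hom. Qed.

Lemma root_ext_csa : csa root_ext.
Proof. exact (amalgam_csa root_cover root_malnormal Htf). Qed.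

Lemma root_ext_torsion_free : torsion_free root_ext.
Proof. exact (amalgam_torsion_free root_cover root_malnormal Htf). Qed.

(** Once conjugated into some C_i, the element is the [n]-th power of its own copy in B_i. *)
Lemma root_exists x : exists y, gpow y n = root_inj x.
Proof.
  destruct (classic (x = gone)) as [->|N].
  - exists gone. rewrite gpow_one. symmetry. apply (hom1 root_ext_hom).
  - destruct (root_cover N) as (i & f & C).
    exists (gconj (root_inj f) (jB root_data i (gconj (ginv f) x))).
    unfold root_ext, root_inj.
    rewrite gpow_conj, (proj2 (jB_gpow root_data n C)), (jB_eps root_data C).
    rewrite <- (hom_conj (jH_hom root_data)). f_equal.
    rewrite conj_conj. unfold gconj. now gsimp.
Qed.

Lemma root_ext_extend d D h : qm_at d D h -> qm_at d D (root_inj h).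
Proof.
  apply qm_at_extend with (n := n); trivial. intros i b Hb. now exists b.
Qed.

Lemma root_ext_positive : (forall h : H, h <> gone -> qm_positive h) ->
  forall g : root_ext, g <> gone -> qm_positive g.
Proof.
  intros P g Ng. set (T := @bass_serre _ _ _ _ _ _ root_data root_cover root_malnormal Htf).
  destruct (classic (elliptic T g)) as [El|Hy].
  - destruct (amalgam_elliptic Ng El) as (i & b & e & Hb & Nb & ->).
    destruct (P b Nb) as (d & D & Hd & Q).
    (* The [n]-th power of the copy of [b] in B_i is the image of [b] itself, whose bound is known
       in [H]. *)
    exists (n * d), D. split; [nia|].
    apply qm_at_conj, qm_at_root. unfold root_ext.
    rewrite (proj2 (jB_gpow root_data n Hb)), (jB_eps root_data Hb).
    now apply root_ext_extend.
  - destruct (hyperbolic_quasimorphism Hy) as (D & phi & H1 & H2).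
    exists 1, D. split; [lia|]. intros L. exists phi. split; [auto|].
    intros N. rewrite Nat.mul_1_l. apply H2.
Qed.

(** Each B_i is mapped by [f] followed by the root operation [r], which is multiplicative there
    because C_i is abelian. *)
Lemma root_ext_lift (K : Group) (f : H -> K) (r : K -> K) : is_group_hom f ->
  (forall x, r (gpow x n) = x) -> (forall x y, comm x y -> r (x ** y) = r x ** r y) ->
  exists f' : root_ext -> K, is_group_hom f' /\ forall h, f' (root_inj h) = f h.
Proof.
  intros F R1 R2.
  destruct (@amalgam_lift _ _ _ _ _ _ root_data K f (fun _ b => r (f b))) as (f' & F' & FH & _).
  - split; [|split]; trivial.
    + intros i b b' Hb Hb'. rewrite F. apply R2. apply (hom_comm F).
      now apply (cent_comm (i := i)).
    + intros i c _. now rewrite (hom_gpow F), R1.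
  - now exists f'.
Qed.
End RootExtension.

(** * Free groups *)

Section Free.
Context (I : Type).

Definition trivial_group : Group.
Proof.
  refine {| gcar := unit; gmul := fun _ _ => tt; ginv := fun _ => tt; gone := tt |}; trivial.
  now intros [].
Defined.

Definition Zgroup : Group.
Proof.
  refine {| gcar := Z; gmul := Z.add; ginv := Z.opp; gone := 0%Z |}; intros; lia.
Defined.

Lemma Zgroup_gpow (x : Zgroup) n : gpow x n = (x * Z.of_nat n)%Z.
Proof. induction n as [|n IH]; [cbn; lia|]. rewrite gpowS, IH. cbn. lia. Qed.

Lemma Zgroup_torsion_free : torsion_free Zgroup.
Proof. intros x n L. rewrite Zgroup_gpow. cbn. nia. Qed.

(** The free group is the amalgam over the trivial group of one copy of Z per generator, so the
    results on trees cover the initial stage. *)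
Lemma free_data : amalgam_data (fun (_ : I) (_ : trivial_group) => True)
  (fun (_ : I) (_ : Zgroup) => True) (fun _ => gone).
Proof.
  split; try easy.
  - intros _ b b' _ _. unfold comm. cbn. lia.
  - intros _ [] _ _. reflexivity.
Qed.

Lemma free_cover (h : trivial_group) : h <> gone ->
  exists (i : I) (f : trivial_group), True.
Proof. now destruct h. Qed.

Lemma free_malnormal (i j : I) (x f : trivial_group) : x <> gone -> True -> True -> i = j /\ True.
Proof. now destruct x. Qed.

Definition free : Group := amalgam free_data.
Definition free_gen (i : I) : free := jB free_data i 1%Z.

Lemma free_csa : csa free.
Proof. exact (amalgam_csa free_cover free_malnormal Zgroup_torsion_free). Qed.

Lemma free_torsion_free : torsion_free free.
Proof. exact (amalgam_torsion_free free_cover free_malnormal Zgroup_torsion_free). Qed.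

Lemma free_lift (K : Group) (f : I -> K) :
  exists f' : free -> K, is_group_hom f' /\ forall i, f' (free_gen i) = f i.
Proof.
  destruct (@amalgam_lift _ _ _ _ _ _ free_data K (fun _ => gone) (fun i b => gzpow (f i) b))
    as (f' & F' & _ & FB).
  - split; [|split]; trivial.
    + intros x y. now rewrite gmul1.
    + intros i b b' _ _. apply gzpow_add.
  - exists f'. split; trivial. intros i. unfold free_gen. rewrite FB by trivial. apply gpow1.
Qed.

Lemma free_positive (g : free) : g <> gone -> qm_positive g.
Proof.
  intros Ng. set (T := @bass_serre _ _ _ _ _ _ free_data free_cover free_malnormal Zgroup_torsion_free).
  destruct (classic (elliptic T g)) as [El|Hy].
  - destruct (amalgam_elliptic Ng El) as (i & b & e & _ & Nb & ->).
    (* An elliptic element is a conjugate of a power of a generator. The exponent sum of that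
       generator, signed to be positive on [b], is a homomorphism and has no defect. *)
    destruct (@amalgam_lift _ _ _ _ _ _ free_data Zgroup (fun _ => 0%Z)
      (fun j c => if excluded_middle_informative (j = i) then (c * Z.sgn b)%Z else 0%Z))
      as (f & F & _ & FB).
    + split; [|split]; try easy.
      * intros j c c' _ _. destruct excluded_middle_informative; cbn; lia.
      * intros j c _. now destruct excluded_middle_informative.
    + exists 1, 0%R. split; [lia|]. apply qm_at_conj. intros L.
      exists (fun x => IZR (f x)). split.
      * intros x y _. rewrite F. cbn. rewrite plus_IZR.
        match goal with |- (Rabs ?t <= 0)%R => replace t with 0%R by ring end.
        rewrite Rabs_R0. lra.
      * intros N. rewrite Nat.mul_1_l, (hom_gpow F), FB by trivial.
        destruct excluded_middle_informative; [|easy].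
        rewrite Zgroup_gpow, INR_IZR_INZ, Rminus_0_r. apply IZR_le. cbn in Nb. nia.
  - destruct (hyperbolic_quasimorphism Hy) as (D & phi & H1 & H2).
    exists 1, D. split; [lia|]. intros L. exists phi. split; [auto|].
    intros N. rewrite Nat.mul_1_l. apply H2.
Qed.
End Free.

(** * Lower bounds on commutator length *)

(** A form of positive scl that mentions no quasimorphism and pulls back along homomorphisms. *)
Definition linear_bound (G : Group) (g : G) : Prop :=
  exists d D, 1 <= d /\
    forall N c, is_prod_comm c (gpow g (d * N)) -> (INR N <= (8 * INR c + 2) * D)%R.

Lemma qm_at_bound (G : Group) d D (g : G) N c :
  qm_at d D g -> is_prod_comm c (gpow g (d * N)) -> (INR N <= (8 * INR c + 2) * D)%R.
Proof.
  intros Q (a & b & E).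
  (* These are all the right factors that occur; [gone] is added to bound [phi gone]. *)
  destruct (Q (gone :: flat_map (fun k => a k :: b k :: ginv (a k) :: ginv (b k) :: nil) (seq 0 c)))
    as (phi & H1 & H2).
  assert (One : (Rabs (phi gone) <= D)%R).
  { pose proof (H1 gone gone (or_introl eq_refl)) as K. rewrite gmul1 in K.
    replace (phi gone - phi gone - phi gone)%R with (- phi gone)%R in K by ring.
    now rewrite Rabs_Ropp in K. }
  assert (Dpos := Rle_trans _ _ _ (Rabs_pos _) One).
  apply Rabs_le_between in One.
  assert (Step : forall x y, In y (gone :: flat_map
      (fun k => a k :: b k :: ginv (a k) :: ginv (b k) :: nil) (seq 0 c)) ->
      (phi x + phi y - D <= phi (x ** y) <= phi x + phi y + D)%R).
  { intros x y Hy. specialize (H1 x y Hy). apply Rabs_le_between in H1. lra. }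
  (* A commutator costs 8D: 4D for its four multiplications, and 2D for each of the sums of [phi]
     over an element and its inverse. The extra D bounds [phi gone]; a second one comes from the
     lower bound on powers. *)
  assert (K : forall m, m <= c -> (phi (prod_comm a b m) <= (8 * INR m + 1) * D)%R).
  { induction m as [|m IH]; intros L.
    - cbn. lra.
    - specialize (IH ltac:(lia)). cbn [prod_comm]. unfold commg. rewrite !gmulA.
      assert (In4 : forall y, In y (a m :: b m :: ginv (a m) :: ginv (b m) :: nil) ->
        In y (gone :: flat_map
          (fun k => a k :: b k :: ginv (a k) :: ginv (b k) :: nil) (seq 0 c))).
      { intros y Hy. right. apply in_flat_map. exists m. split; trivial. apply in_seq. lia. }
      set (x := prod_comm a b m) in *.
      assert (Ia := In4 (a m) ltac:(cbn; tauto)). assert (Ib := In4 (b m) ltac:(cbn; tauto)).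
      assert (Ia' := In4 (ginv (a m)) ltac:(cbn; tauto)).
      assert (Ib' := In4 (ginv (b m)) ltac:(cbn; tauto)).
      pose proof (Step x (a m) Ia). pose proof (Step (x ** a m) (b m) Ib).
      pose proof (Step (x ** a m ** b m) (ginv (a m)) Ia').
      pose proof (Step (x ** a m ** b m ** ginv (a m)) (ginv (b m)) Ib').
      pose proof (Step (a m) (ginv (a m)) Ia') as Sa. pose proof (Step (b m) (ginv (b m)) Ib') as Sb.
      rewrite gmulVr in Sa, Sb. rewrite S_INR. lra. }
  specialize (K c (le_n _)). specialize (H2 N). rewrite E in H2. lra.
Qed.

Lemma is_prod_comm_mul (G : Group) m n (x y : G) :
  is_prod_comm m x -> is_prod_comm n y -> is_prod_comm (m + n) (x ** y).
Proof.
  intros (a & b & ->) (a' & b' & ->).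
  exists (fun k => if k <? m then a k else a' (k - m)),
         (fun k => if k <? m then b k else b' (k - m)).
  assert (K1 : forall k, k <= m -> prod_comm a b k =
    prod_comm (fun k => if k <? m then a k else a' (k - m))
              (fun k => if k <? m then b k else b' (k - m)) k).
  { induction k as [|k IH]; intros L; [reflexivity|]. cbn [prod_comm].
    rewrite IH by lia. now rewrite (proj2 (Nat.ltb_lt k m)) by lia. }
  induction n as [|n IH].
  - rewrite Nat.add_0_r, <- K1 by lia. cbn. now gsimp.
  - rewrite Nat.add_succ_r. cbn [prod_comm]. rewrite <- IH.
    rewrite (proj2 (Nat.ltb_ge (m + n) m)) by lia.
    replace (m + n - m) with n by lia. apply gmulA.
Qed.

Lemma is_prod_comm_gpow (G : Group) m (x : G) k :
  is_prod_comm m x -> is_prod_comm (k * m) (gpow x k).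
Proof.
  intros Hx. induction k as [|k IH].
  - now exists (fun _ => gone), (fun _ => gone).
  - rewrite gpowS. replace (S k * m) with (k * m + m) by lia. now apply is_prod_comm_mul.
Qed.

Lemma is_prod_comm_hom (G H : Group) (f : G -> H) m x :
  is_group_hom f -> is_prod_comm m x -> is_prod_comm m (f x).
Proof.
  intros F (a & b & ->). exists (fun k => f (a k)), (fun k => f (b k)).
  induction m as [|m IH]; cbn; [apply (hom1 F)|].
  rewrite F, IH. f_equal. unfold commg. now rewrite !F, !(homV F).
Qed.

Lemma linear_bound_hom (G H : Group) (f : G -> H) x :
  is_group_hom f -> linear_bound (f x) -> linear_bound x.
Proof.
  intros F (d & D & Hd & B). exists d, D. split; trivial. intros N c P.
  apply B. rewrite <- (hom_gpow F). now apply is_prod_comm_hom.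
Qed.

Lemma cl_spec (G : Group) (g : G) : in_commutator_subgroup g -> is_prod_comm (cl g) g.
Proof.
  intros (n & Hn). unfold cl.
  apply (@epsilon_spec _ (inhabits 0) (fun n => is_prod_comm n g /\
    forall m, is_prod_comm m g -> (n <= m)%nat)).
  destruct (@exists_min {n | is_prod_comm n g} (@proj1_sig _ _) (exist _ n Hn)) as [[m Hm] Min].
  exists m. split; trivial. intros m' Hm'. exact (Min (exist _ m' Hm')).
Qed.

Lemma linear_bound_scl (G : Group) (g : G) : linear_bound g -> Rbar_lt R0 (scl g).
Proof.
  intros (d & D & Hd & B). unfold scl.
  destruct excluded_middle_informative as [ex|]; [|exact Logic.I].
  destruct (constructive_indefinite_description _ ex) as (k & Hk & Hg). cbn [proj1_sig].
  clear ex. set (h := gpow g k) in *.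
  (* The [d]-th power of [gpow h n] is the power of [g] with exponent [d * (k * n)], and
     [n <= k * n]. *)
  assert (Cl : forall n, (INR n <= (8 * (INR d * INR (cl (gpow h n))) + 2) * D)%R).
  { intros n. rewrite <- mult_INR.
    assert (Hn : in_commutator_subgroup (gpow h n)).
    { destruct Hg as (m & Hm). exists (n * m). now apply is_prod_comm_gpow. }
    apply (Rle_trans _ (INR (k * n))); [apply le_INR; nia|].
    apply B. replace (gpow g (d * (k * n))) with (gpow (gpow h n) d).
    - apply is_prod_comm_gpow, cl_spec, Hn.
    - unfold h. rewrite <- !gpowM. f_equal. lia. }
  assert (Dpos : (0 < D)%R).
  { pose proof (Cl 1) as C1. cbn [INR] in C1.
    pose proof (pos_INR d). pose proof (pos_INR (cl (gpow h 1))).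
    assert (0 <= INR d * INR (cl (gpow h 1)))%R by now apply Rmult_le_pos.
    destruct (Rlt_le_dec 0 D); trivial. exfalso. nra. }
  assert (dpos : (1 <= INR d)%R) by (apply (le_INR 1); lia).
  (* For n > 4D the term 2D is below n/2, so 8dD times the commutator length exceeds n/2. *)
  set (delta := (/ (16 * INR d * D))%R).
  assert (Dd : (0 < delta)%R) by (apply Rinv_0_lt_compat; nra).
  assert (Le : Rbar_le delta (scl_comm h)).
  { unfold scl_comm. rewrite <- (Lim_seq_const delta). apply Lim_seq_le_loc.
    exists (S (Z.to_nat (up (4 * D)))). intros n Ln.
    assert (Nn : (4 * D < INR n)%R).
    { eapply Rlt_le_trans; [apply (archimed (4 * D))|]. rewrite INR_IZR_INZ. apply IZR_le. lia. }
    specialize (Cl n). apply (Rmult_le_reg_r (INR n)); [lra|].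
    unfold Rdiv. rewrite Rmult_assoc, Rinv_l, Rmult_1_r by lra.
    apply (Rmult_le_reg_l (16 * INR d * D)); [nra|].
    unfold delta. rewrite <- Rmult_assoc, Rinv_r by nra. nra. }
  assert (Kp : (0 < / INR k)%R) by (apply Rinv_0_lt_compat, lt_0_INR; lia).
  (* [Lim_seq] has values in [Rbar], so an infinite limit is treated as well. *)
  destruct (scl_comm h) as [r| |]; cbn in Le.
  - cbn. apply Rmult_lt_0_compat; lra.
  - unfold Rbar_mult, Rbar_mult'. destruct Rle_dec; [|lra].
    destruct Rle_lt_or_eq_dec; [exact Logic.I|lra].
  - easy.
Qed.

(** * Direct limits *)

Section Limit.
Context (E : nat -> Group) (iota : forall k, E k -> E (S k)).
Context (Ihom : forall k, is_group_hom (@iota k)).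

Definition ev (P : nat -> Prop) : Prop := exists k0, forall k, k0 <= k -> P k.

Lemma ev_all (P : nat -> Prop) : (forall k, P k) -> ev P.
Proof. intros H. exists 0. auto. Qed.

Lemma ev_and (P Q : nat -> Prop) : ev P -> ev Q -> ev (fun k => P k /\ Q k).
Proof.
  intros [k H] [k' H']. exists (max k k'). intros j L. split; [apply H|apply H']; lia.
Qed.

Lemma ev_mono (P Q : nat -> Prop) : (forall k, P k -> Q k) -> ev P -> ev Q.
Proof. intros I [k H]. exists k. auto. Qed.

Lemma ev_mono2 (P Q R : nat -> Prop) : (forall k, P k -> Q k -> R k) -> ev P -> ev Q -> ev R.
Proof. intros I HP HQ. apply (ev_mono (P := fun k => P k /\ Q k)); [firstorder|now apply ev_and]. Qed.

Lemma ev_exists (P : nat -> Prop) m : ev P -> exists k, m <= k /\ P k.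
Proof. intros [k H]. exists (max k m). split; [lia|apply H; lia]. Qed.

(* The limit consists of the sequences that are eventually compatible with the transition
   maps, modulo eventual equality. *)
Definition thread : Type := {s : forall k, E k | ev (fun k => s (S k) = iota (s k))}.
Definition evq (s t : thread) : Prop := ev (fun k => proj1_sig s k = proj1_sig t k).

Lemma evq_refl s : evq s s. Proof. now apply ev_all. Qed.
Lemma evq_sym s t : evq s t -> evq t s. Proof. now apply ev_mono. Qed.
Lemma evq_trans s t u : evq s t -> evq t u -> evq s u.
Proof. apply ev_mono2. congruence. Qed.

Definition tmul (s t : thread) : thread.
Proof.
  exists (fun k => proj1_sig s k ** proj1_sig t k).
  apply (ev_mono2 (P := fun k => proj1_sig s (S k) = iota (proj1_sig s k))
                  (Q := fun k => proj1_sig t (S k) = iota (proj1_sig t k)));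
  [|apply (proj2_sig s)|apply (proj2_sig t)].
  intros k -> ->. now rewrite Ihom.
Defined.

Definition tinv (s : thread) : thread.
Proof.
  exists (fun k => ginv (proj1_sig s k)).
  apply (ev_mono (P := fun k => proj1_sig s (S k) = iota (proj1_sig s k))); [|apply (proj2_sig s)].
  intros k ->. now rewrite (homV (@Ihom k)).
Defined.

Definition tone : thread.
Proof.
  exists (fun k => gone). apply ev_all. intros k. now rewrite (hom1 (@Ihom k)).
Defined.

Notation cls := (pr evq).
Notation rep := (@repr _ evq).

Lemma rep_thread s : evq (rep (cls s)) s.
Proof. apply repr_pr; [apply evq_refl|apply evq_sym|apply evq_trans]. Qed.

Lemma cls_thread s t : cls s = cls t <-> evq s t.
Proof. apply pr_eq; [apply evq_refl|apply evq_sym|apply evq_trans]. Qed.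

Definition limit : Group.
Proof.
  refine {| gcar := quot evq; gmul := fun x y => cls (tmul (rep x) (rep y));
    ginv := fun x => cls (tinv (rep x)); gone := cls tone |}.
  - intros x y z. apply cls_thread.
    apply (ev_mono2 (P := fun k => proj1_sig (rep (cls (tmul (rep x) (rep y)))) k =
                                   proj1_sig (tmul (rep x) (rep y)) k)
                    (Q := fun k => proj1_sig (rep (cls (tmul (rep y) (rep z)))) k =
                                   proj1_sig (tmul (rep y) (rep z)) k));
    [|apply rep_thread|apply rep_thread].
    intros k H1 H2. cbn [tmul proj1_sig] in *. rewrite H1, H2. apply gmulA.
  - intros x. rewrite <- (pr_repr x) at 2. apply cls_thread.
    apply (ev_mono (P := fun k => proj1_sig (rep (cls tone)) k = proj1_sig tone k));
    [|apply rep_thread].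
    intros k H. cbn [tmul tone proj1_sig] in *. rewrite H. apply gmul1.
  - intros x. apply cls_thread.
    apply (ev_mono (P := fun k => proj1_sig (rep (cls (tinv (rep x)))) k =
                                   proj1_sig (tinv (rep x)) k)); [|apply rep_thread].
    intros k H. cbn [tmul tone tinv proj1_sig] in *. rewrite H. apply gmulV.
Defined.

(** Coordinates of a chosen thread: identities between them hold only from some index on. *)
Definition val (m : limit) (k : nat) : E k := proj1_sig (rep m) k.

Lemma val_eq m m' : m = m' <-> ev (fun k => val m k = val m' k).
Proof.
  rewrite <- (pr_repr m) at 1. rewrite <- (pr_repr m') at 1. apply cls_thread.
Qed.

Lemma val_thread m : ev (fun k => val m (S k) = iota (val m k)).
Proof. exact (proj2_sig (rep m)). Qed.

Lemma val_mul m m' : ev (fun k => val (m ** m') k = val m k ** val m' k).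
Proof. apply (rep_thread (tmul (rep m) (rep m'))). Qed.

Lemma val_inv m : ev (fun k => val (ginv m) k = ginv (val m k)).
Proof. apply (rep_thread (tinv (rep m))). Qed.

Lemma val_one : ev (fun k => val gone k = gone).
Proof. apply (rep_thread tone). Qed.

Lemma val_gpow m n : ev (fun k => val (gpow m n) k = gpow (val m k) n).
Proof.
  induction n as [|n IH]; [apply val_one|].
  apply (ev_mono2 (P := fun k => val (gpow m n) k = gpow (val m k) n)
    (Q := fun k => val (gpow m n ** m) k = val (gpow m n) k ** val m k)); trivial; [|apply val_mul].
  intros k E1 E2. now rewrite !gpowS, E2, E1.
Qed.

Lemma val_prod_comm (a b : nat -> limit) n :
  ev (fun k => val (prod_comm a b n) k = prod_comm (fun i => val (a i) k) (fun i => val (b i) k) n).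
Proof.
  induction n as [|n IH]; [apply val_one|].
  cbn [prod_comm]. unfold commg.
  pose proof (val_inv (a n)) as V1. pose proof (val_inv (b n)) as V2.
  pose proof (val_mul (ginv (a n)) (ginv (b n))) as V3.
  pose proof (val_mul (b n) (ginv (a n) ** ginv (b n))) as V4.
  pose proof (val_mul (a n) (b n ** (ginv (a n) ** ginv (b n)))) as V5.
  pose proof (val_mul (prod_comm a b n) (a n ** (b n ** (ginv (a n) ** ginv (b n))))) as V6.
  pose proof (ev_and IH (ev_and V1 (ev_and V2 (ev_and V3 (ev_and V4 (ev_and V5 V6)))))) as V.
  revert V. apply ev_mono. intros k (E0 & E1 & E2 & E3 & E4 & E5 & E6).
  now rewrite E6, E5, E4, E3, E2, E1, E0.
Qed.

Lemma thread_of_seq (s : forall k, E k) : ev (fun k => s (S k) = iota (s k)) ->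
  exists m : limit, ev (fun k => val m k = s k).
Proof. intros H. exists (cls (exist _ s H)). apply (rep_thread (exist _ s H)). Qed.

Lemma limit_ind (P : forall k, E k -> Prop) k0 (s : forall k, E k) :
  (forall k, k0 <= k -> s (S k) = iota (s k)) -> P k0 (s k0) ->
  (forall k x, P k x -> P (S k) (iota x)) -> forall k, k0 <= k -> P k (s k).
Proof.
  intros H P0 PS k L. induction L as [|k L IH]; trivial. rewrite H by trivial. auto.
Qed.
End Limit.

(** Entries before [k] are set to [gone]. The induction shifts the whole sequence of groups, which
    avoids casts between the types [E j]. *)
Lemma seq_from (E : nat -> Group) (iota : forall k, E k -> E (S k)) k (x : E k) :
  exists s : forall k, E k, s k = x /\ forall j, k <= j -> s (S j) = iota j (s j).
Proof.
  revert E iota x. induction k as [|k IH]; intros E iota x.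
  - exists (nat_rect E x (fun k y => iota k y)). split; [reflexivity|]. reflexivity.
  - destruct (IH (fun j => E (S j)) (fun j => iota (S j)) x) as (s & S1 & S2).
    exists (fun j => match j with 0 => gone | S j => s j end). split; trivial.
    intros [|j] L; [lia|]. apply S2. lia.
Qed.

Section LimitProperties.
Context (E : nat -> Group) (iota : forall k, E k -> E (S k)).
Arguments iota : clear implicits.
Context (Ihom : forall k, is_group_hom (iota k)).
Arguments Ihom : clear implicits.
Notation limit := (limit Ihom).
Notation val := (@val E iota Ihom).

(** That [m] is the image of [x] is expressed by all properties stable under the transition maps,
    without composing these maps. *)
Lemma limit_inject k (x : E k) : exists m : limit, forall P : forall k, E k -> Prop,
  P k x -> (forall j y, P j y -> P (S j) (iota j y)) -> ev (fun j => P j (val m j)).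
Proof.
  destruct (seq_from iota x) as (s & S1 & S2).
  destruct (thread_of_seq Ihom (s := s)) as (m & Hm); [now exists k|].
  exists m. intros P P0 PS.
  apply (ev_mono2 (P := fun j => k <= j) (Q := fun j => val m j = s j)); trivial; [|now exists k].
  intros j L ->. apply (limit_ind (iota := iota) (k0 := k)); trivial. now rewrite S1.
Qed.

Lemma limit_root_unique n (x y : limit) : (forall k, csa (E k)) -> (forall k, torsion_free (E k)) ->
  1 <= n -> gpow x n = gpow y n -> x = y.
Proof.
  intros HC HT Hn Exy. apply val_eq. apply val_eq in Exy.
  pose proof (ev_and Exy (ev_and (val_gpow x n) (val_gpow y n))) as V.
  revert V. apply ev_mono. intros k (E1 & E2 & E3).
  apply (csa_root_unique (HC k) (HT k) Hn). congruence.
Qed.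

Lemma limit_root_exists n (x : limit) :
  (forall k (y : E k), exists z, gpow z (S k) = iota k y) -> 1 <= n ->
  exists z, gpow z n = x.
Proof.
  intros HR Hn. destruct (val_thread x) as [k0 Hk].
  (* At stage [j] roots of order [j + 1], a multiple of [n], are adjoined, and [j >= k0]. The power
     [k0 + 1] of such a root is an [n]-th root. *)
  set (j := (k0 + 1) * n - 1).
  destruct (HR j (val x j)) as [z Hz].
  destruct (seq_from iota z) as (s & S1 & S2).
  destruct (thread_of_seq Ihom (s := s)) as (m & Hm); [now exists (S j)|].
  exists (gpow m (k0 + 1)). rewrite <- gpowM. apply val_eq.
  pose proof (ev_and Hm (val_gpow m ((k0 + 1) * n))) as V.
  assert (Lj : ev (fun k => S j <= k)) by now exists (S j).
  revert Lj V. apply ev_mono2. intros k L (E1 & E2). rewrite E2, E1. clear E1 E2.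
  replace ((k0 + 1) * n) with (S j) by lia.
  induction L as [|k L IH].
  - rewrite S1, Hz. symmetry. apply Hk. nia.
  - rewrite S2, <- (hom_gpow (Ihom k)), IH by trivial. symmetry. apply Hk. nia.
Qed.

Lemma limit_lift (K : Group) (f : forall k, E k -> K) :
  (forall k, is_group_hom (f k)) -> (forall k x, f (S k) (iota k x) = f k x) ->
  exists F : limit -> K, is_group_hom F /\ forall m, ev (fun k => f k (val m k) = F m).
Proof.
  intros Fh Fc.
  assert (C : forall m : limit, exists v, ev (fun k => f k (val m k) = v)).
  { intros m. destruct (val_thread m) as [k0 Hk]. exists (f k0 (val m k0)), k0.
    apply (limit_ind (iota := iota) (P := fun k y => f k y = f k0 (val m k0))); trivial.
    intros k y Ey. now rewrite Fc. }
  destruct (choice _ C) as [F HF]. exists F. split; trivial.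
  intros x y.
  destruct (ev_exists 0 (ev_and (val_mul x y) (ev_and (HF x) (ev_and (HF y) (HF (x ** y))))))
    as (k & _ & E1 & <- & <- & <-).
  now rewrite E1, Fh.
Qed.

(** The constants come from a stage [k0] where [m] is nontrivial. A product of commutators in the
    limit is one at some later stage, where the same constants are valid. *)
Lemma limit_linear_bound (m : limit) :
  (forall k (g : E k), g <> gone -> qm_positive g) ->
  (forall k d D (g : E k), qm_at d D g -> qm_at d D (iota k g)) ->
  m <> gone -> linear_bound m.
Proof.
  intros Pos Ext Nm. destruct (val_thread m) as [k0 Hk].
  assert (N0 : val m k0 <> gone).
  { intros e. apply Nm. apply val_eq.
    assert (L : ev (fun k => k0 <= k)) by now exists k0.
    generalize (val_one Ihom). revert L. apply ev_mono2. intros k L ->.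
    apply (limit_ind (iota := iota) (P := fun k y => y = gone) Hk); trivial.
    intros j y ->. apply (hom1 (Ihom j)). }
  destruct (Pos k0 _ N0) as (d & D & Hd & Q).
  exists d, D. split; trivial. intros N c (a & b & Eab).
  apply val_eq in Eab.
  destruct (ev_exists k0 (ev_and Eab (ev_and (val_gpow m (d * N)) (val_prod_comm a b c))))
    as (k & L & E1 & E2 & E3).
  apply (@qm_at_bound (E k) d D (val m k)).
  - apply (limit_ind (iota := iota) (P := fun k y => qm_at d D y) Hk); trivial. auto.
  - exists (fun i => val (a i) k), (fun i => val (b i) k). congruence.
Qed.
End LimitProperties.

(** * Groups with unique roots *)

Module Fractions.
Import ssreflect ssrfun ssrbool eqtype ssrnat ssralg ssrint ssrnum rat ring.
Import GRing.Theory Num.Theory.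
Local Open Scope ring_scope.

(** The fraction z/d represents [a]; writing [z] as a difference of naturals relates Stdlib integers
    to [rat] by casts from [nat] only. *)
Definition frac (a : rat) (z : Z) (d : nat) : Prop :=
  (1 <= d)%coq_nat /\ exists k l : nat,
    z = Z.sub (Z.of_nat k) (Z.of_nat l) /\ a * d%:R = k%:R - l%:R.

Definition rat_add (a b : rat) : rat := a + b.
Definition rat_mul (a b : rat) : rat := a * b.

Lemma frac0 : frac 0 Z0 1.
Proof. by split; [lia|exists 0%N, 0%N; rewrite mul0r subrr]. Qed.

Lemma frac1 : frac 1 (Zpos xH) 1.
Proof. by split; [lia|exists 1%N, 0%N; rewrite mul1r subr0]. Qed.

Lemma frac_exists a : exists z d, frac a z d.
Proof.
have [d Ed] : exists d : nat, denq a = d%:Z by exists `|denq a|%N; rewrite absz_denq.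
have d0 : (0 < d)%N by have := denq_gt0 a; rewrite Ed.
have Ea : a * d%:R = (numq a)%:~R by rewrite -[a in LHS]divq_num_den Ed mulfVK // pnatr_eq0 -lt0n.
case En : (numq a) => [k|k].
- exists (Z.sub (Z.of_nat k) (Z.of_nat 0)), d; split; first exact/leP.
  by exists k, 0%N; rewrite Ea En subr0.
- exists (Z.sub (Z.of_nat 0) (Z.of_nat k.+1)), d; split; first exact/leP.
  by exists 0%N, k.+1; rewrite Ea En NegzE sub0r mulrNz.
Qed.

Lemma frac_unique a z d z' d' : frac a z d -> frac a z' d' ->
  Z.mul z (Z.of_nat d') = Z.mul z' (Z.of_nat d).
Proof.
move=> [_ [k [l [-> E]]]] [_ [k' [l' [-> E']]]].
have : (k * d' + l' * d)%N = (k' * d + l * d')%N; last by rewrite -!plusE -!multE; nia.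
apply/eqP; rewrite -(eqr_nat rat) !natrD !natrM; apply/eqP.
have -> : k%:R = a * d%:R + l%:R by rewrite E subrK.
have -> : k'%:R = a * d'%:R + l'%:R by rewrite E' subrK.
by ring.
Qed.

Lemma fracD a b z d z' d' : frac a z d -> frac b z' d' ->
  frac (rat_add a b) (Z.add (Z.mul z (Z.of_nat d')) (Z.mul z' (Z.of_nat d))) (d * d')%coq_nat.
Proof.
move=> [Ld [k [l [-> E]]]] [Ld' [k' [l' [-> E']]]]; split; first by nia.
exists (k * d' + k' * d)%N, (l * d' + l' * d)%N; split; first by rewrite -!plusE -!multE; nia.
rewrite multE /rat_add /rat_mul !natrD !natrM.
have -> : k%:R = a * d%:R + l%:R by rewrite E subrK.
have -> : k'%:R = b * d'%:R + l'%:R by rewrite E' subrK.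
by ring.
Qed.

Lemma fracM a b z d z' d' : frac a z d -> frac b z' d' ->
  frac (rat_mul a b) (Z.mul z z') (d * d')%coq_nat.
Proof.
move=> [Ld [k [l [-> E]]]] [Ld' [k' [l' [-> E']]]]; split; first by nia.
exists (k * k' + l * l')%N, (k * l' + l * k')%N; split; first by rewrite -!plusE -!multE; nia.
rewrite multE /rat_add /rat_mul !natrD !natrM.
have -> : k%:R = a * d%:R + l%:R by rewrite E subrK.
have -> : k'%:R = b * d'%:R + l'%:R by rewrite E' subrK.
by ring.
Qed.

Definition inv_nat (n : nat) : rat := n%:R^-1.

Lemma inv_natK n : (1 <= n)%coq_nat -> n%:R * inv_nat n = 1.
Proof. by move/leP=> Hn; rewrite /inv_nat mulfV // pnatr_eq0 -lt0n. Qed.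

Lemma qpow_nat (G : QGroup) (g : G) (n : nat) : qpow g n%:R = gpow g n.
Proof. by elim: n => [|n IH]; [exact: qpow0|rewrite -addn1 natrD qpowD IH qpow1 addn1]. Qed.

Lemma qpow_opp (G : QGroup) (g : G) (a : rat) : qpow g (- a) = ginv (qpow g a).
Proof. by apply: ginv_unique; rewrite -qpowD subrr qpow0. Qed.

Lemma gpow_qpow (G : QGroup) (g : G) a z d : frac a z d -> gpow (qpow g a) d = gzpow g z.
Proof.
move=> [_ [k [l [-> E]]]].
rewrite -qpow_nat qpowM E qpowD qpow_opp !qpow_nat.
by rewrite -[X in _ = gzpow _ X]/(Z.add (Z.of_nat k) (Z.opp (Z.of_nat l)))
  gzpow_add gzpow_nat gzpow_opp_nat.
Qed.

Lemma qgroup_root (G : QGroup) (g : G) n : (1 <= n)%coq_nat ->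
  qpow (gpow g n) (inv_nat n) = g.
Proof. by move=> Hn; rewrite -qpow_nat qpowM inv_natK // qpow1. Qed.
End Fractions.

Import Fractions.

Lemma qgroup_root_unique (G : QGroup) (x y : G) n : 1 <= n -> gpow x n = gpow y n -> x = y.
Proof.
  intros Hn E. rewrite <- (qgroup_root x Hn), <- (qgroup_root y Hn). now rewrite E.
Qed.

Section UniqueRoots.
Context (M : Group).
Context (Mex : forall n (x : M), 1 <= n -> exists y, gpow y n = x).
Context (Muniq : forall n (x y : M), 1 <= n -> gpow x n = gpow y n -> x = y).

Definition is_power (g : M) (a : rat.rat) (x : M) : Prop :=
  exists z d, frac a z d /\ gpow x d = gzpow g z.

Lemma is_power_exists g a : exists x, is_power g a x.
Proof.
  destruct (frac_exists a) as (z & d & F). destruct (Mex (gzpow g z) (proj1 F)) as [x E].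
  now exists x, z, d.
Qed.

(** Both sides have the same [d']-th power by cross-multiplication, and roots are unique. *)
Lemma is_power_frac g a x z d : is_power g a x -> frac a z d -> gpow x d = gzpow g z.
Proof.
  intros (z' & d' & F' & E) F. apply (Muniq (n := d') (proj1 F')).
  rewrite <- gpowM, Nat.mul_comm, gpowM, E, <- !gzpow_nat, !gzpow_mult.
  f_equal. symmetry. apply (frac_unique F F').
Qed.

Lemma is_power_unique g a x y : is_power g a x -> is_power g a y -> x = y.
Proof.
  intros (z & d & F & E) P. apply (Muniq (n := d) (proj1 F)).
  rewrite E. symmetry. now apply (is_power_frac P).
Qed.

(** The conjugate of [x] by [y] is another [d]-th root of the same element. *)
Lemma root_comm (x y : M) d : 1 <= d -> comm (gpow x d) y -> comm x y.
Proof.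
  intros Hd C. apply comm_sym, conj_fix_comm, (Muniq Hd).
  rewrite gpow_conj. apply conj_fix_comm. now apply comm_sym.
Qed.

Lemma is_power_comm g a x h b y : comm g h -> is_power g a x -> is_power h b y -> comm x y.
Proof.
  intros C (z & d & F & E) (z' & d' & F' & E').
  apply (root_comm (proj1 F)). rewrite E.
  apply comm_sym, (root_comm (proj1 F')). rewrite E'.
  apply comm_gzpow, comm_sym, comm_gzpow, C.
Qed.

Lemma is_powerD g a b x y : is_power g a x -> is_power g b y ->
  is_power g (rat_add a b) (x ** y).
Proof.
  intros P Q. assert (C := is_power_comm (comm_refl g) P Q).
  destruct P as (z & d & F & E), Q as (z' & d' & F' & E').
  exists (z * Z.of_nat d' + z' * Z.of_nat d)%Z, (d * d'). split; [now apply fracD|].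
  rewrite gpow_mul by trivial.
  rewrite gpowM, E, (Nat.mul_comm d d'), gpowM, E', gzpow_add, <- !gzpow_mult.
  now rewrite !gzpow_nat.
Qed.

Lemma is_powerM g a b x y : is_power g a x -> is_power x b y ->
  is_power g (rat_mul a b) y.
Proof.
  intros (z & d & F & E) (z' & d' & F' & E').
  exists (z * z')%Z, (d * d'). split; [now apply fracM|].
  rewrite Nat.mul_comm, gpowM, E', <- gzpow_nat, gzpow_mult.
  now rewrite Z.mul_comm, <- gzpow_mult, gzpow_nat, E, gzpow_mult.
Qed.

Lemma is_powerJ g h a x : is_power g a x -> is_power (gconj h g) a (gconj h x).
Proof.
  intros (z & d & F & E). exists z, d. split; trivial. now rewrite gpow_conj, gzpow_conj, E.
Qed.

Lemma is_power_mul g h a x y : comm g h -> is_power g a x -> is_power h a y ->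
  is_power (g ** h) a (x ** y).
Proof.
  intros C P Q. assert (C' := is_power_comm C P Q).
  destruct P as (z & d & F & E). exists z, d. split; trivial.
  rewrite gpow_mul, gzpow_mul_comm, E, (is_power_frac Q F); trivial.
Qed.

Definition rpow (g : M) (a : rat.rat) : M := epsilon (inhabits gone) (is_power g a).

Lemma rpow_spec g a : is_power g a (rpow g a).
Proof. unfold rpow. apply epsilon_spec, is_power_exists. Qed.

Lemma rpow_eq g a x : is_power g a x -> rpow g a = x.
Proof. apply is_power_unique, rpow_spec. Qed.

Definition unique_roots_QGroup : QGroup.
Proof.
  refine {| qgrp := M; qpow := rpow |}; intros.
  - apply rpow_eq. exists 0%Z, 1. split; [apply frac0|]. apply gpow_one.
  - apply rpow_eq. exists 1%Z, 1. split; [apply frac1|]. reflexivity.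
  - apply rpow_eq. destruct (frac_exists a) as (z & d & F). exists z, d. split; trivial.
    rewrite gpow_one. apply (@hom_gzpow M M (fun _ => gone) gone).
    intros x y. now gsimp.
  - apply rpow_eq, is_powerD; apply rpow_spec.
  - symmetry. apply rpow_eq, (is_powerM (x := rpow g a)); apply rpow_spec.
  - apply rpow_eq. rewrite !gmulA. apply is_powerJ, rpow_spec.
  - apply rpow_eq, is_power_mul; trivial; apply rpow_spec.
Defined.

(** Roots are unique in the target, so a group homomorphism automatically respects rational
    powers. *)
Lemma unique_roots_Qhom (G : QGroup) (f : M -> G) :
  is_group_hom f -> is_Qhom (G := unique_roots_QGroup) f.
Proof.
  intros F. split; trivial. intros g a. cbn.
  destruct (rpow_spec g a) as (z & d & Fr & E).
  apply (qgroup_root_unique (proj1 Fr)).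
  rewrite (gpow_qpow _ Fr), <- (hom_gpow F), E. now apply hom_gzpow.
Qed.
End UniqueRoots.

(** * The tower of root extensions *)

(** The maps [smap] to the fixed group [K] are carried along: in the limit they form the
    retraction. *)
Record stage (K : Group) := {
  sgrp :> Group;
  smap : sgrp -> K;
  smap_hom : is_group_hom smap;
  s_csa : csa sgrp;
  s_tf : torsion_free sgrp;
  s_pos : forall g : sgrp, g <> gone -> qm_positive g
}.

Section Tower.
Context (K : QGroup).

Lemma next_stage_exists (s : stage K) (n : nat) : exists s' : {s' : stage K & s -> s'},
  let i := projT2 s' in
  is_group_hom i /\ (forall x, smap (i x) = smap x) /\
  (forall x, exists y, gpow y (S n) = i x) /\
  (forall d D g, qm_at d D g -> qm_at d D (i g)).
Proof.
  assert (Hn : 1 <= S n) by lia.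
  (* In [K] the root operation is the rational power with exponent 1/(n+1). *)
  destruct (@root_ext_lift s (@s_csa K s) (@s_tf K s) (S n) Hn K (@smap K s)
    (fun x => qpow x (inv_nat (S n)))) as (f & F & Fc).
  - apply smap_hom.
  - intros x. now apply qgroup_root.
  - intros x y C. now apply qpow_comm.
  - exists (existT _ {| smap_hom := F;
      s_csa := @root_ext_csa s (@s_csa K s) (@s_tf K s) (S n) Hn;
      s_tf := @root_ext_torsion_free s (@s_csa K s) (@s_tf K s) (S n) Hn;
      s_pos := @root_ext_positive s (@s_csa K s) (@s_tf K s) (S n) Hn (@s_pos K s) |}
      (@root_inj s (@s_csa K s) (@s_tf K s) (S n) Hn)).
    cbv zeta. refine (conj _ (conj Fc (conj _ _))).
    + exact (@root_ext_hom s (@s_csa K s) (@s_tf K s) (S n) Hn).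
    + exact (@root_exists s (@s_csa K s) (@s_tf K s) (S n) Hn).
    + exact (@root_ext_extend s (@s_csa K s) (@s_tf K s) (S n) Hn).
Qed.

Definition next_stage (s : stage K) (n : nat) : {s' : stage K & s -> s'} :=
  proj1_sig (constructive_indefinite_description _ (next_stage_exists s n)).

Lemma next_stage_spec s n : let i := projT2 (next_stage s n) in
  is_group_hom i /\ (forall x, smap (i x) = smap x) /\
  (forall x, exists y, gpow y (S n) = i x) /\
  (forall d D g, qm_at d D g -> qm_at d D (i g)).
Proof. apply (proj2_sig (constructive_indefinite_description _ (next_stage_exists s n))). Qed.

(** The step from [k] to [k + 1] adjoins roots of order [k + 1]. *)
Fixpoint tower (s : stage K) (k : nat) : stage K :=
  match k with 0 => s | S k => projT1 (next_stage (tower s k) k) end.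

Lemma tower_limit (s : stage K) : exists (M : Group) (inc : s -> M) (rho : M -> K),
  is_group_hom inc /\ is_group_hom rho /\ (forall x, rho (inc x) = smap x) /\
  (forall n (x : M), 1 <= n -> exists y, gpow y n = x) /\
  (forall n (x y : M), 1 <= n -> gpow x n = gpow y n -> x = y) /\
  (forall m : M, m <> gone -> linear_bound m).
Proof.
  set (iota := fun k => projT2 (next_stage (tower s k) k) : tower s k -> tower s (S k)).
  assert (Ih : forall k, is_group_hom (iota k)) by (intros k; apply next_stage_spec).
  assert (Im : forall k x, smap (iota k x) = smap x) by (intros k; apply next_stage_spec).
  assert (Ir : forall k x, exists y, gpow y (S k) = iota k x) by (intros k; apply next_stage_spec).
  assert (Iq : forall k d D g, qm_at d D g -> qm_at d D (iota k g))
    by (intros k; apply next_stage_spec).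
  destruct (@limit_lift _ iota Ih K (fun k => @smap K (tower s k))) as (rho & R & Rv).
  { intros k. apply smap_hom. } { exact Im. }
  destruct (choice _ (fun x : s => @limit_inject _ iota Ih 0 x)) as [inc Hinc].
  exists (limit Ih), inc, rho. repeat split; trivial.
  (* The map [inc] is known only through stable properties, so explicit sequences through [x] and
     [y] are compared with it. *)
  - intros x y. apply val_eq.
    destruct (seq_from iota (k := 0) x) as (sx & X0 & XS).
    destruct (seq_from iota (k := 0) y) as (sy & Y0 & YS).
    assert (Vx : ev (fun k => val (inc x) k = sx k)).
    { apply (Hinc x (fun k y => y = sx k)); [easy|]. intros j y' ->. symmetry. apply XS. lia. }
    assert (Vy : ev (fun k => val (inc y) k = sy k)).
    { apply (Hinc y (fun k y => y = sy k)); [easy|]. intros j y' ->. symmetry. apply YS. lia. }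
    assert (Vxy : ev (fun k => val (inc (x ** y)) k = sx k ** sy k)).
    { apply (Hinc (x ** y) (fun k y => y = sx k ** sy k)); [now rewrite X0, Y0|].
      intros j y' ->. now rewrite Ih, XS, YS by lia. }
    pose proof (ev_and (val_mul (inc x) (inc y)) (ev_and Vx (ev_and Vy Vxy))) as V.
    revert V. apply ev_mono. intros k (E1 & E2 & E3 & E4). congruence.
  - intros x.
    assert (V : ev (fun k => smap (val (inc x) k) = smap x)).
    { apply (Hinc x (fun k (y : tower s k) => smap y = smap x)); [easy|].
      intros j y E. now rewrite Im. }
    destruct (ev_exists 0 (ev_and V (Rv (inc x)))) as (k & _ & E1 & E2). congruence.
  - intros n x Hn. now apply (limit_root_exists (iota := iota)).
  - intros n x y Hn. apply (limit_root_unique (iota := iota)); trivial;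
    intros k; [apply s_csa|apply s_tf].
  - intros m Nm. apply (limit_linear_bound (iota := iota)); trivial.
    intros k g Ng. now apply s_pos.
Qed.
End Tower.

Theorem theoremC :
  forall (S : Type) (F : Group) (i : S -> F), is_free_group i ->
  forall (G : QGroup) (j : F -> G), is_Q_completion j ->
  forall g : G, g <> gone -> Rbar_lt R0 (scl g).
Proof.
  intros S F i Fi G j [Jh Jc] g Ng.
  (* Generators are indexed by the image of [i], which stays in the universe of [F] and lets [j]
     define the map to [G] directly. *)
  set (I := {x : F | exists s, i s = x}).
  destruct (@free_lift I G (fun x => j (proj1_sig x))) as (f0 & F0 & F0g).
  set (s0 := {| smap_hom := F0; s_csa := @free_csa I; s_tf := @free_torsion_free I;
                s_pos := @free_positive I |}).
  destruct (@tower_limit G s0) as (M & inc & rho & Hi & Hr & Hri & Mex & Muniq & Mlb).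
  destruct (Fi (free I) (fun s => free_gen (exist _ (i s) (ex_intro _ s eq_refl))))
    as (phi & Hp & Pg & _).
  set (MQ := unique_roots_QGroup Mex Muniq).
  assert (RQ : is_Qhom (G := MQ) rho) by now apply unique_roots_Qhom.
  destruct (Jc MQ (fun x => inc (phi x))) as (theta & Th & Tj & _).
  { intros x y. now rewrite Hp, Hi. }
  (* Both sides are homomorphisms on [F] with the same values on the generators. *)
  assert (Rj : forall x, rho (theta (j x)) = j x).
  { intros x. rewrite Tj, Hri. cbn.
    destruct (Fi G (fun s => j (i s))) as (u & _ & _ & U).
    rewrite (U (fun x => f0 (phi x))), (U j); trivial.
    - intros a b. now rewrite Hp, F0.
    - intros s. now rewrite Pg, F0g. }
  (* The composite and the identity both extend [j], so the uniqueness clause of the completion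
     identifies them. *)
  assert (Id : forall y, rho (theta y) = y).
  { destruct (Jc G j Jh) as (u & _ & _ & U). intros y.
    rewrite (U (fun y => y)) by (try split; easy).
    apply (U (fun y => rho (theta y))); trivial.
    destruct Th as [Th1 Th2], RQ as [RQ1 RQ2]. split.
    - intros a b. now rewrite Th1, Hr.
    - intros a q. now rewrite Th2, RQ2. }
  apply linear_bound_scl, (linear_bound_hom (f := theta) (proj1 Th)).
  apply Mlb. intros e. apply Ng. rewrite <- (Id g), e. apply (hom1 Hr).
Qed.
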